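(* Let $\mathbf{G}(s)=C(sI-A)^{-1}B$ be the transfer function of a minimal strictly proper LTI plant, let $\mathbf{K}$ be a dynamic controller that internally stabilizes $\mathbf{G}$, and let $\mathbf{K}_r$ be another dynamic controller. Denote $\mathbf{\Delta}:=\mathbf{K}_r-\mathbf{K}$, $\mathbf{Y}:=(I-\mathbf{G}\mathbf{K})^{-1}$ and $\mathbf{X}:=(I-\mathbf{G}\mathbf{K})^{-1}\mathbf{G}$. If $$\|\mathbf{\Delta}\|_{\mathcal{H}_\infty}<\frac{1}{\|(I-\mathbf{G}\mathbf{K})^{-1}\mathbf{G}\|_{\mathcal{H}_\infty}},$$ then $\mathbf{K}_r$ internally stabilizes the plant, and the resulting LQG cost satisfies $$J(\mathbf{K}_r)\le\frac{1}{\left(1-\|\mathbf{X}\|_{\mathcal{H}_\infty}\|\mathbf{\Delta}\|_{\mathcal{H}_\infty}\right)^2}\,\bigl(J(\mathbf{K})+S_1+S_2\bigr),$$ where $$S_1:=2\|\mathbf{\Delta}\|_{\mathcal{H}_\infty}\|\mathbf{X}\|_{\mathcal{H}_2}\|\mathbf{X}\mathbf{K}\|_{\mathcal{H}_2}+2\|\mathbf{\Delta}\|_{\mathcal{H}_2}\bigl(\|\mathbf{K}\mathbf{Y}\|_{\mathcal{H}_2}\|\mathbf{Y}\|_{\mathcal{H}_\infty}+\|\mathbf{K}\mathbf{X}\|_{\mathcal{H}_2}\|\mathbf{X}\|_{\mathcal{H}_\infty}\bigr)\bigl(1+\|\mathbf{K}\mathbf{X}\|_{\mathcal{H}_\infty}\bigr),$$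 $$S_2:=\|\mathbf{\Delta}\|_{\mathcal{H}_\infty}^2\|\mathbf{X}\|_{\mathcal{H}_2}^2+\|\mathbf{\Delta}\|_{\mathcal{H}_2}^2\bigl(\|\mathbf{Y}\|_{\mathcal{H}_\infty}^2+\|\mathbf{X}\|_{\mathcal{H}_\infty}^2\bigr)\bigl(1+\|\mathbf{K}\mathbf{X}\|_{\mathcal{H}_\infty}\bigr)^2.$$
   Context: Plant: $\dot x=Ax+Bu+Bw$, $y=Cx+v$, with real matrices, $x(t)\in\mathbb{R}^{n_x}$, $u(t),w(t)\in\mathbb{R}^m$, $y(t),v(t)\in\mathbb{R}^p$; the plant is minimal, i.e. $(A,B)$ is controllable and $(C,A)$ is observable. Its transfer function is $\mathbf{G}(s)=C(sI-A)^{-1}B$. The signals $w$ and $v$ are zero-mean Gaussian white noises, each with spectrum equal to the identity. Dynamic controller: $\dot\xi=A_K\xi+B_Ky$, $u=C_K\xi$, with $\xi(t)\in\mathbb{R}^q$ and real matrices $A_K,B_K,C_K$; it is identified with the (strictly proper, real-rational) transfer function $\mathbf{K}(s)=C_K(sI-A_K)^{-1}B_K$, represented by a minimal realization. Note the feedback sign convention $\mathbf{u}=\mathbf{K}\mathbf{y}$. Different controllers may have different orders $q$. A controller $\mathbf{K}$ internally stabilizes $\mathbf{G}$ if the closed-loop matrix $\begin{bmatrix}A & BC_K\\ B_KC & A_K\end{bmatrix}$ has all eigenvalues in the open left-half plane; equivalently, if the four transfer matrices $(I-\mathbf{G}\mathbf{K})^{-1}\mathbf{G}$, $(I-\mathbf{G}\mathbf{K})^{-1}\mathbf{G}\mathbf{K}$,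 $\mathbf{K}(I-\mathbf{G}\mathbf{K})^{-1}\mathbf{G}$, $\mathbf{K}(I-\mathbf{G}\mathbf{K})^{-1}$ all belong to $\mathcal{RH}_\infty$. $\mathcal{RH}_\infty$ is the set of real-rational proper transfer matrices all of whose poles lie in the open left-half plane (''stable''). For a stable transfer matrix $\mathbf{F}$, $\|\mathbf{F}\|_{\mathcal{H}_\infty}=\sup_{\omega\in\mathbb{R}}\sigma_{\max}(\mathbf{F}(j\omega))$, and for a stable strictly proper $\mathbf{F}$, $\|\mathbf{F}\|_{\mathcal{H}_2}=\sqrt{\frac{1}{2\pi}\int_{-\infty}^{\infty}\mathrm{Tr}\bigl(\mathbf{F}(-j\omega)^{\mathsf T}\mathbf{F}(j\omega)\bigr)\,d\omega}$. Only stable transfer matrices have finite $\mathcal{H}_\infty$ norm, so a bound on an $\mathcal{H}_\infty$ norm includes the assertion that the transfer matrix is stable. The (normalized) LQG cost of an internally stabilizing controller is $J(\mathbf{K})=\lim_{T\to\infty}\mathbb{E}\left[\frac1T\int_0^T x(t)^{\mathsf T}C^{\mathsf T}Cx(t)+u(t)^{\mathsf T}u(t)\,dt\right]$, which equals $$\|(I-\mathbf{G}\mathbf{K})^{-1}\mathbf{G}\|_{\mathcal{H}_2}^2+\|(I-\mathbf{G}\mathbf{K})^{-1}\mathbf{G}\mathbf{K}\|_{\mathcal{H}_2}^2+\|\mathbf{K}(I-\mathbf{G}\mathbf{K})^{-1}\mathbf{G}\|_{\mathcal{H}_2}^2+\|\mathbf{K}(I-\mathbf{G}\mathbf{K})^{-1}\|_{\mathcal{H}_2}^2.$$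 *)

(* Defs.v *)
From HB Require Import structures.
From mathcomp Require Import all_boot all_order all_algebra.
From mathcomp Require Import fraction.
From mathcomp Require Import complex.
From mathcomp Require Import all_classical all_reals all_analysis.

Set Implicit Arguments.
Unset Strict Implicit.
Unset Printing Implicit Defensive.

Import Order.TTheory GRing.Theory Num.Theory.
Import numFieldNormedType.Exports.

Local Open Scope classical_set_scope.
Local Open Scope ring_scope.
Local Open Scope complex_scope.

Section RationalFunctions.
Variable R : realType.

(* The field R(s); transfer matrices are matrices over it, so that products
   and inverses such as (I - GK)^-1 G are formed as rational matrices, with
   all cancellations carried out, and not pointwise. *)
Definition ratfun : fieldType := {fraction {poly R}}.

(* numerator and denominator in lowest terms (up to a common constant):
   repr picks an arbitrary, possibly non-reduced, representative *)
Definition rnum (f : ratfun) : {poly R} :=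
  (frac (repr f)).1 %/ gcdp (frac (repr f)).1 (frac (repr f)).2.
Definition rden (f : ratfun) : {poly R} :=
  (frac (repr f)).2 %/ gcdp (frac (repr f)).1 (frac (repr f)).2.

Definition toC (a : R) : R[i] := a%:C.

Definition is_pole (f : ratfun) (s : R[i]) : bool :=
  root (map_poly toC (rden f)) s.

Definition reval (f : ratfun) (s : R[i]) : R[i] :=
  (map_poly toC (rnum f)).[s] / (map_poly toC (rden f)).[s].

Definition proper (f : ratfun) : bool := (size (rnum f) <= size (rden f))%N.

Definition RHinf p m (F : 'M[ratfun]_(p, m)) : Prop :=
  forall i j, proper (F i j) /\
    forall s : R[i], is_pole (F i j) s -> complex.Re s < 0.

Definition freq_resp p m (F : 'M[ratfun]_(p, m)) (w : R) : 'M[R[i]]_(p, m) :=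
  map_mx (fun f => reval f (w *i)) F.

Definition is_singular_value p m (M : 'M[R[i]]_(p, m)) (s : R) : Prop :=
  0 <= s /\ eigenvalue ((map_mx Num.conj M)^T *m M) (s ^+ 2)%:C.

(* the set below is finite, and is empty only when m = 0, where sup gives 0 *)
Definition sigma_max p m (M : 'M[R[i]]_(p, m)) : R :=
  sup [set s | is_singular_value M s].

Definition hinf_norm p m (F : 'M[ratfun]_(p, m)) : \bar R :=
  if `[< RHinf F >]
  then ereal_sup [set (sigma_max (freq_resp F w))%:E | w in [set: R]]
  else +oo%E.

(* real value of the norm, meaningful for F in RHinf *)
Definition hinf p m (F : 'M[ratfun]_(p, m)) : R := fine (hinf_norm F).

(* meaningful for stable strictly proper F; the trace is then real *)
Definition h2 p m (F : 'M[ratfun]_(p, m)) : R :=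
  Num.sqrt ((2 * pi)^-1 *
    \int[lebesgue_measure]_(w in [set: R])
      complex.Re (\tr ((freq_resp F (- w))^T *m freq_resp F w))).

End RationalFunctions.

Section StateSpace.
Variable R : realType.

Definition cst_rat (a : R) : ratfun R := FracField.tofrac a%:P.

Definition transfer n m p (A : 'M[R]_n) (B : 'M[R]_(n, m)) (C : 'M[R]_(p, n)) :
    'M[ratfun R]_(p, m) :=
  map_mx cst_rat C
    *m invmx ((FracField.tofrac 'X : ratfun R)%:M - map_mx cst_rat A)
    *m map_mx cst_rat B.

Definition controllable n m (A : 'M[R]_n) (B : 'M[R]_(n, m)) : bool :=
  \rank (\mxrow_(k < n) (A ^+ k *m B)) == n.

Definition observable n p (C : 'M[R]_(p, n)) (A : 'M[R]_n) : bool :=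
  \rank (\mxcol_(k < n) (C *m A ^+ k)) == n.

Definition minimal n m p (A : 'M[R]_n) (B : 'M[R]_(n, m)) (C : 'M[R]_(p, n)) :
    bool :=
  controllable A B && observable C A.

Definition hurwitz n (M : 'M[R]_n) : Prop :=
  forall s : R[i], eigenvalue (map_mx (@toC R) M) s -> complex.Re s < 0.

Definition internally_stabilizes n m p q
    (A : 'M[R]_n) (B : 'M[R]_(n, m)) (C : 'M[R]_(p, n))
    (AK : 'M[R]_q) (BK : 'M[R]_(q, p)) (CK : 'M[R]_(m, q)) : Prop :=
  hurwitz (block_mx A (B *m CK) (BK *m C) AK).

End StateSpace.

Section LQG.
Variable R : realType.

Definition normal_law d (Omega : measurableType d) (P : probability Omega R)
    (X : Omega -> R) : Prop :=
  exists2 ms : R * R, 0 <= ms.2 &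
    forall U : set R, measurable U ->
      P (X @^-1` U) =
        if ms.2 == 0 then dirac ms.1 U else normal_prob ms.1 ms.2 U.

Definition measurable_process d (Omega : measurableType d) k
    (X : R -> Omega -> 'cV[R]_k) : Prop :=
  forall i, measurable_fun
    (([set t | 0 <= t] : set (measurableTypeR R)) `*` [set: Omega])
    (fun z : measurableTypeR R * Omega => X z.1 z.2 i 0).

Definition continuous_paths d (Omega : measurableType d) k
    (X : R -> Omega -> 'cV[R]_k) : Prop :=
  forall om i, {within `[0, +oo[, continuous (fun t : R => X t om i 0)}.

(* Zero-mean Gaussian white noise with identity spectrum (i.e. with covariance
   delta(t - s) I) has no pathwise values, and is given by its primitive
   W(t) = "\int_0^t noise", a zero-mean Gaussian process with continuous paths
   and covariance E[W(s) W(t)^T] = min(s, t) I, i.e. a standard Brownian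
   motion. *)
Record white_noise d (Omega : measurableType d) (P : probability Omega R) k
    (W : R -> Omega -> 'cV[R]_k) : Prop := WhiteNoise {
  wn_measurable : measurable_process W ;
  wn_continuous : continuous_paths W ;
  wn_gaussian : forall N (t : 'I_N -> R) (a : 'I_N -> 'rV[R]_k),
    (forall j, 0 <= t j) ->
    normal_law P (fun om => \sum_(j < N) (a j *m W (t j) om) 0 0) ;
  wn_mean : forall (t : R) i, 0 <= t ->
    ('E_P[fun om => (W t om i 0)%R] = 0)%E ;
  wn_cov : forall (s t : R) i j, 0 <= s -> 0 <= t ->
    ('E_P[fun om => (W s om i 0 * W t om j 0)%R] =
      ((i == j)%:R * Num.min s t)%:E)%E }.

Definition integral_cV k (f : R -> 'cV[R]_k) (t : R) : 'cV[R]_k :=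
  \col_i \int[lebesgue_measure]_(s in `[0, t]) f s i 0.

(* Closed loop of dx/dt = A x + B u + B w, y = C x + v with
   dxi/dt = AK xi + BK y, u = CK xi, integrated in time: W and V are the
   primitives of the noises w and v. *)
Record closed_loop_response d (Omega : measurableType d) n m p q
    (A : 'M[R]_n) (B : 'M[R]_(n, m)) (C : 'M[R]_(p, n))
    (AK : 'M[R]_q) (BK : 'M[R]_(q, p)) (CK : 'M[R]_(m, q))
    (W : R -> Omega -> 'cV[R]_m) (V : R -> Omega -> 'cV[R]_p)
    (x0 : 'cV[R]_n) (xi0 : 'cV[R]_q)
    (x : R -> Omega -> 'cV[R]_n) (xi : R -> Omega -> 'cV[R]_q) : Prop :=
  ClosedLoopResponse {
  cl_x_measurable : measurable_process x ;
  cl_xi_measurable : measurable_process xi ;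
  cl_x_continuous : continuous_paths x ;
  cl_xi_continuous : continuous_paths xi ;
  cl_x_eq : forall om t, 0 <= t ->
    x t om = x0
      + integral_cV (fun s => A *m x s om + B *m (CK *m xi s om)) t
      + B *m W t om ;
  cl_xi_eq : forall om t, 0 <= t ->
    xi t om = xi0
      + integral_cV (fun s => AK *m xi s om + BK *m (C *m x s om)) t
      + BK *m V t om }.

Definition mean_cost d (Omega : measurableType d) (P : probability Omega R)
    n m p (C : 'M[R]_(p, n))
    (x : R -> Omega -> 'cV[R]_n) (u : R -> Omega -> 'cV[R]_m) (T : R) :
    \bar R :=
  ('E_P[fun om => (T^-1 *
    \int[lebesgue_measure]_(t in `[0, T])
      (((x t om)^T *m C^T *m C *m x t om) 0 0
        + ((u t om)^T *m u t om) 0 0))%R])%E.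

(* J is the LQG cost of the controller (AK, BK, CK): for any realization of the
   noises and any deterministic initial state, J is the limit of the mean cost.
   w and v are independent, hence jointly white.  Brownian motions exist, so
   that there is at most one such J. *)
Definition is_lqg_cost n m p q
    (A : 'M[R]_n) (B : 'M[R]_(n, m)) (C : 'M[R]_(p, n))
    (AK : 'M[R]_q) (BK : 'M[R]_(q, p)) (CK : 'M[R]_(m, q)) (J : R) : Prop :=
  forall (d : measure_display) (Omega : measurableType d)
    (P : probability Omega R)
    (W : R -> Omega -> 'cV[R]_m) (V : R -> Omega -> 'cV[R]_p),
  white_noise P (fun t om => col_mx (W t om) (V t om)) ->
  forall (x0 : 'cV[R]_n) (xi0 : 'cV[R]_q)
    (x : R -> Omega -> 'cV[R]_n) (xi : R -> Omega -> 'cV[R]_q),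
  closed_loop_response A B C AK BK CK W V x0 xi0 x xi ->
  mean_cost P C x (fun t om => CK *m xi t om) T @[T --> +oo] --> J%:E.

End LQG.

(* Main.v *)
Require Import Defs.
From mathcomp Require Import all_boot all_order all_algebra.
From mathcomp Require Import ring lra zify perm fraction complex spectral.
From mathcomp Require Import all_classical all_reals all_analysis measurable_realfun.

(** Let M be the state matrix of the closed loop. Its four transfer matrices
    X = (I - GK)^-1 G, XK, KX and KY = K (I - GK)^-1 are the blocks of
    (s - M)^-1 seen from the inputs w, v and from the outputs C x, u, and
    Y = I + XK.

    Stability. Replacing K by Kr = K + Delta gives Xr = X + X Delta Xr and
    similar identities for the other blocks ([perturbed_X] and its companions).
    On the imaginary axis X Delta is a contraction, with ratio g < 1 the product
    of the two H-infinity norms. Poisson's formula for the right half-plane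
    carries the bound on the numerical range of X Delta from the axis to the
    half-plane, so 1 is nowhere an eigenvalue of X Delta ([small_gain]) and the
    perturbed transfer matrices have no unstable pole. Since the plant and the
    new controller are minimal, no unstable mode can be hidden
    ([minimal_regular]), and the new closed loop is internally stable
    ([robust_stability]).

    Norms. At each frequency the same identities bound the Frobenius norms of
    Xr, Xr Kr, Kr Xr and Kr Yr by 1 / (1 - g) times a combination of the norms
    of the nominal ones and of Delta. Integration over the frequencies turns
    this into bounds on H2 norms ([h2_triangle], [h2_Xr] and its companions),
    and the sum of the squares of the four bounds is exactly the right-hand
    side of the theorem ([cost_arith]).

    The cost in the frequency domain. The principal value of the integral of
    (iw - M)^-1 over the real line is pi I ([PV_resolvent]); this is proved with
    partial fractions and explicit primitives rather than with contour
    integrals. If M^T Pi + Pi M = - Q, then with R = (iw - M)^-1 one has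
    R^* Q R = Pi R + R^* Pi, hence the integral of R^* Q R is 2 pi Pi
    ([PVr_lyapunov]). This gives at the same time that the Lyapunov equation is
    uniquely solvable, that Pi is positive when Q is, and that the squared H2
    norm of C (s - M)^-1 B is tr (B^T Pi B) for Q = C^T C ([h2_transfer]).

    The cost in the time domain. The closed loop is z = z0 + (integral of M z)
    + L W with W a Brownian motion. Pathwise, Gronwall's inequality bounds z by
    W, so z is square-integrable ([solution_process]). The increments of W after
    a time s are orthogonal to z(s) ([state_increment_orthogonal]), and
    therefore P = E z z^T satisfies P' = M P + P M^T + L L^T
    ([second_moment]). Pairing P with the solution Pi of the Lyapunov equation
    gives <Pi, P>' = - <Q, P> + <Pi, L L^T>. For Q = I this shows that P is
    bounded; when Q is the cost matrix, dividing by T shows that the mean of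
    z^T Q z over [0, T] tends to <Pi, L L^T> = tr (L^T Pi L)
    ([time_average]), which is the sum of the four squared H2 norms
    ([lqg_cost_h2]). *)

Import Order.TTheory GRing.Theory Num.Theory.
Import numFieldNormedType.Exports.

Set Implicit Arguments.
Unset Strict Implicit.
Unset Printing Implicit Defensive.

Local Open Scope classical_set_scope.
Local Open Scope ring_scope.
Local Open Scope complex_scope.


(** * Principal values of integrals along the imaginary axis *)

Section RealLimits.
Variable R : realType.
Notation mu := (@lebesgue_measure R).

Lemma continuous_itv_integrable (f : R -> R) (a b : R) :
  continuous f -> mu.-integrable `[a, b] (EFin \o f).
Proof.
move=> cf; apply: continuous_compact_integrable; first exact: segment_compact.
exact: continuous_subspaceT.
Qed.

Lemma FTC_is_derive (f F : R -> R) (a b : R) : a <= b -> continuous f ->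
  (forall x : R, is_derive x 1 F (f x)) ->
  \int[mu]_(x in `[a, b]) f x = F b - F a.
Proof.
move=> + cf dF; rewrite le_eqVlt => /predU1P[->|ab].
  by rewrite set_itv1 Rintegral_set1 subrr.
have cF : continuous F.
  by move=> x; apply/differentiable_continuous/derivable1_diffP/(@ex_derive _ _ _ _ _ _ _ (dF x)).
rewrite /Rintegral (@continuous_FTC2 _ f F a b) //.
- exact: continuous_subspaceT.
- split; first by move=> x _; exact: (@ex_derive _ _ _ _ _ _ _ (dF x)).
  + by apply: cvg_at_right_filter; exact: cF.
  + by apply: cvg_at_left_filter; exact: cF.
- by move=> x _; rewrite derive1E; exact: (@derive_val _ _ _ _ _ _ _ (dF x)).
Qed.

Lemma cvg_natB (b : R) : ((n%:R : R) - b) @[n --> \oo] --> +oo.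
Proof.
apply/cvgryPge => A; near=> n; rewrite lerBrDr.
by near: n; have /cvgryPge := @cvgr_idn R; apply.
Unshelve. all: by end_near. Qed.

Lemma cvg_natBV (b : R) : ((n%:R : R) - b)^-1 @[n --> \oo] --> (0 : R).
Proof.
apply/(gtr0_cvgV0 (f := fun n : nat => (n%:R : R) - b)); last exact: cvg_natB.
by have /cvgryPgt := @cvg_natB b; exact.
Qed.

Lemma ratio_cvg0 (a b c d : R) : 0 < a ->
  ((c * ((n%:R : R) - b) + d) / (((n%:R : R) - b) ^+ 2 + a ^+ 2)) @[n --> \oo]
    --> (0 : R).
Proof.
move=> a0; apply/norm_cvg0P.
apply: (@squeeze_cvgr _ _ _ _ (fun _ => 0)
   (fun n : nat => (`|c| + `|d|) * ((n%:R : R) - b)^-1)).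
- near=> n; have u1 : 1 <= (n%:R : R) - b.
    by near: n; have /cvgryPge := @cvg_natB b; apply.
  set u := _ - b in u1 *; have u0 : 0 < u by apply: lt_le_trans u1.
  rewrite normr_ge0 /= normrM normfV (@gtr0_norm _ (_ + _ ^+ 2)); last first.
    by rewrite addr_gt0 // exprn_gt0.
  rewrite ler_pdivrMr ?addr_gt0 ?exprn_gt0 // -mulrA.
  apply: (@le_trans _ _ ((`|c| + `|d|) * u)); last first.
    rewrite ler_wpM2l ?addr_ge0 // ler_pdivlMl // -expr2.
    by rewrite lerDl sqr_ge0.
  apply: le_trans (ler_normD _ _) _; rewrite normrM (gtr0_norm u0) mulrDl.
  by rewrite lerD2l ler_peMr.
- exact: cvg_cst.
- rewrite -(mulr0 (`|c| + `|d|)); apply: cvgMr; exact: cvg_natBV.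
Unshelve. all: by end_near. Qed.

End RealLimits.

Section ComplexFunctions.
Variable R : realType.
Notation mu := (@lebesgue_measure R).
Notation C := R[i].
Implicit Types (f g : R -> C) (c z : C).
Notation Re := (@complex.Re R).
Notation Im := (@complex.Im R).

Lemma cReD z c : Re (z + c) = Re z + Re c. Proof. by case: z; case: c. Qed.
Lemma cImD z c : Im (z + c) = Im z + Im c. Proof. by case: z; case: c. Qed.
Lemma cReN z : Re (- z) = - Re z. Proof. by case: z. Qed.
Lemma cImN z : Im (- z) = - Im z. Proof. by case: z. Qed.
Lemma cReM z c : Re (z * c) = Re z * Re c - Im z * Im c.
Proof. by case: z; case: c. Qed.
Lemma cImM z c : Im (z * c) = Re z * Im c + Im z * Re c.
Proof. by case: z; case: c. Qed.
Lemma cReV z : Re z^-1 = Re z / (Re z ^+ 2 + Im z ^+ 2).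
Proof. by case: z. Qed.
Lemma cImV z : Im z^-1 = - (Im z / (Re z ^+ 2 + Im z ^+ 2)).
Proof. by case: z. Qed.
Lemma cReJ z : Re (conjc z) = Re z. Proof. by case: z. Qed.
Lemma cImJ z : Im (conjc z) = - Im z. Proof. by case: z. Qed.
Lemma complex_ext z c : Re z = Re c -> Im z = Im c -> z = c.
Proof. by case: z => a b; case: c => d e /= -> ->. Qed.

(** The topology of [R[i]] is avoided: a complex function is handled through its
    real and imaginary parts, which are also what is integrated. *)
Definition ccont f := continuous (Re \o f) /\ continuous (Im \o f).

Lemma ccont_cst c : ccont (fun=> c).
Proof. by split=> x; exact: cvg_cst. Qed.

Lemma ccontD f g : ccont f -> ccont g -> ccont (fun w => f w + g w).
Proof.
move=> [f1 f2] [g1 g2]; split=> x.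
- rewrite (_ : Re \o _ = (Re \o f) \+ (Re \o g)).
    by apply: continuousD; [exact: f1|exact: g1].
  by apply/funext => w /=; rewrite cReD.
- rewrite (_ : Im \o _ = (Im \o f) \+ (Im \o g)).
    by apply: continuousD; [exact: f2|exact: g2].
  by apply/funext => w /=; rewrite cImD.
Qed.

Lemma ccontM f g : ccont f -> ccont g -> ccont (fun w => f w * g w).
Proof.
move=> [f1 f2] [g1 g2]; split=> x.
- rewrite (_ : Re \o _ = ((Re \o f) \* (Re \o g)) \- ((Im \o f) \* (Im \o g))).
    by apply: continuousB; apply: continuousM;
       [exact: f1|exact: g1|exact: f2|exact: g2].
  by apply/funext => w /=; rewrite cReM.
- rewrite (_ : Im \o _ = ((Re \o f) \* (Im \o g)) \+ ((Im \o f) \* (Re \o g))).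
    by apply: continuousD; apply: continuousM;
       [exact: f1|exact: g2|exact: f2|exact: g1].
  by apply/funext => w /=; rewrite cImM.
Qed.

Lemma nsq_gt0 z : z != 0 -> 0 < Re z ^+ 2 + Im z ^+ 2.
Proof.
move=> z0; rewrite lt_def addr_ge0 ?sqr_ge0 // andbT.
apply: contra z0; rewrite paddr_eq0 ?sqr_ge0 // !sqrf_eq0 => /andP[/eqP a /eqP b].
by apply/eqP/complex_ext.
Qed.

Lemma ccontV f : ccont f -> (forall w, f w != 0) -> ccont (fun w => (f w)^-1).
Proof.
move=> [f1 f2] f0.
have cn : continuous (fun w => (Re (f w) ^+ 2 + Im (f w) ^+ 2)^-1).
  move=> x; apply: cvgV; first by apply: lt0r_neq0; apply: nsq_gt0.
  by apply: cvgD; rewrite expr2; under eq_fun do rewrite expr2;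
    apply: cvgM; (exact: f1 || exact: f2).
split=> x.
- rewrite (_ : Re \o _ = (Re \o f) \* (fun w => (Re (f w) ^+ 2 + Im (f w) ^+ 2)^-1)).
    by apply: continuousM; [exact: f1|exact: cn].
  by apply/funext => w /=; rewrite cReV.
- rewrite (_ : Im \o _ = \- ((Im \o f) \* (fun w => (Re (f w) ^+ 2 + Im (f w) ^+ 2)^-1))).
    by apply: continuousN; apply: continuousM; [exact: f2|exact: cn].
  by apply/funext => w /=; rewrite cImV.
Qed.

Lemma ccont_iw : ccont (fun w => w *i).
Proof. by split=> x; [exact: cvg_cst|exact: cvg_id]. Qed.

Lemma ccont_horner (p : {poly C}) : ccont (fun w => p.[w *i]).
Proof.
elim/poly_ind: p => [|p c IH].
  rewrite (_ : (fun _ => _) = fun=> 0); first exact: ccont_cst.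
  by apply/funext => w; rewrite horner0.
rewrite (_ : (fun _ => _) = fun w => p.[w *i] * (w *i) + c).
  apply: ccontD; last exact: ccont_cst.
  by apply: ccontM => //; exact: ccont_iw.
by apply/funext => w; rewrite hornerMXaddC.
Qed.

(** A principal value along the imaginary axis: the integrals over the
    symmetric intervals [-n, n] converge, although the integrand may decay
    only like the inverse of the frequency. *)
Definition PVr (f : R -> R) (c : R) := continuous f /\
  (\int[mu]_(w in `[- (n%:R), n%:R]) f w) @[n --> \oo] --> c.
Definition PV f c := PVr (Re \o f) (Re c) /\ PVr (Im \o f) (Im c).

Lemma PVrD (f g : R -> R) a b : PVr f a -> PVr g b ->
  PVr (fun w => f w + g w) (a + b).
Proof.
move=> [cf la] [cg lb]; split.
  by move=> x; apply: continuousD; [exact: cf|exact: cg].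
rewrite (_ : (fun n => _) = fun n : nat => (\int[mu]_(w in `[- (n%:R), n%:R]) f w)
   + (\int[mu]_(w in `[- (n%:R), n%:R]) g w)); first exact: cvgD.
by apply/funext => n; rewrite RintegralD //; exact: continuous_itv_integrable.
Qed.

Lemma PVrZ (f : R -> R) a k : PVr f a -> PVr (fun w => k * f w) (k * a).
Proof.
move=> [cf la]; split.
  by move=> x; apply: continuousM; [exact: cvg_cst|exact: cf].
rewrite (_ : (fun n => _) = fun n : nat => k * (\int[mu]_(w in `[- (n%:R), n%:R]) f w)).
  by apply: cvgMr.
by apply/funext => n; rewrite RintegralZl //; exact: continuous_itv_integrable.
Qed.

Lemma PVr0 : PVr (fun=> 0) 0.
Proof.
split; first by move=> x; exact: cvg_cst.
rewrite (_ : (fun n => _) = fun=> 0); first exact: cvg_cst.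
by apply/funext => n; rewrite Rintegral_cst // mul0r.
Qed.

Lemma eq_PVr (f g : R -> R) a b : f =1 g -> a = b -> PVr f a -> PVr g b.
Proof. by move=> /funext -> ->. Qed.

Lemma eq_PV f g a b : f =1 g -> a = b -> PV f a -> PV g b.
Proof. by move=> /funext -> ->. Qed.

Lemma PV_uniq (f : R -> R) a b : PVr f a -> PVr f b -> a = b.
Proof. by move=> [_ la] [_]; apply: cvg_unique => //. Qed.

Lemma PVD f g a b : PV f a -> PV g b -> PV (fun w => f w + g w) (a + b).
Proof.
move=> [f1 f2] [g1 g2]; split.
- by apply: eq_PVr (PVrD f1 g1); [move=> w; rewrite /= cReD|rewrite cReD].
- by apply: eq_PVr (PVrD f2 g2); [move=> w; rewrite /= cImD|rewrite cImD].
Qed.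

Lemma PVZ f a k : PV f a -> PV (fun w => k * f w) (k * a).
Proof.
move=> [f1 f2]; split.
- apply: eq_PVr (PVrD (PVrZ (Re k) f1) (PVrZ (- Im k) f2)).
  + by move=> w; rewrite /= cReM mulNr.
  + by rewrite cReM mulNr.
- apply: eq_PVr (PVrD (PVrZ (Re k) f2) (PVrZ (Im k) f1)).
  + by move=> w; rewrite /= cImM.
  + by rewrite cImM.
Qed.

Lemma PV0 : PV (fun=> 0) 0. Proof. by split; exact: PVr0. Qed.

Lemma PV_sum (I : Type) (r : seq I) (F : I -> R -> C) (a : I -> C) :
  (forall i, PV (F i) (a i)) ->
  PV (fun w => \sum_(i <- r) F i w) (\sum_(i <- r) a i).
Proof.
move=> cF; elim: r => [|i r IH].
  by apply: eq_PV PV0; [move=> w|]; rewrite big_nil.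
by apply: eq_PV (PVD (cF i) IH); [move=> w|]; rewrite big_cons.
Qed.

Lemma PVJ f a : PV f a -> PV (fun w => conjc (f w)) (conjc a).
Proof.
move=> [f1 f2]; split.
- by apply: eq_PVr f1; [move=> w /=; rewrite cReJ|rewrite cReJ].
- apply: eq_PVr (PVrZ (-1) f2).
  + by move=> w /=; rewrite mulN1r cImJ.
  + by rewrite mulN1r cImJ.
Qed.

Lemma le_PVr (f g : R -> R) a b : PVr f a -> PVr g b -> (forall w, f w <= g w) ->
  a <= b.
Proof.
move=> [cf la] [cg lb] fg; apply: ler_cvg_to la lb _; near=> n.
by apply: le_Rintegral => //; exact: continuous_itv_integrable.
Unshelve. all: by end_near. Qed.

Definition cderiv f f' :=
  (forall x : R, is_derive x 1 (Re \o f) (Re (f' x))) /\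
  (forall x : R, is_derive x 1 (Im \o f) (Im (f' x))).

Lemma cderivM f g f' g' : cderiv f f' -> cderiv g g' ->
  cderiv (fun w => f w * g w) (fun w => f' w * g w + f w * g' w).
Proof.
move=> [f1 f2] [g1 g2]; split=> x.
- rewrite (_ : Re \o _ = (Re \o f) * (Re \o g) - (Im \o f) * (Im \o g)); last first.
    by apply/funext => w /=; rewrite cReM.
  apply: is_derive_eq (is_deriveB (is_deriveM (f1 x) (g1 x)) (is_deriveM (f2 x) (g2 x))) _.
  rewrite /GRing.scale /= !cReD !cReM.
  have E (a b c d a' b' c' d' : R) :
    a * c' + c * a' - (b * d' + d * b') = a' * c - b' * d + (a * c' - b * d') by ring.
  exact: E.
- rewrite (_ : Im \o _ = (Re \o f) * (Im \o g) + (Im \o f) * (Re \o g)); last first.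
    by apply/funext => w /=; rewrite cImM.
  apply: is_derive_eq (is_deriveD (is_deriveM (f1 x) (g2 x)) (is_deriveM (f2 x) (g1 x))) _.
  rewrite /GRing.scale /= !cImD !cImM.
  have E (a b c d a' b' c' d' : R) :
    a * d' + d * a' + (b * c' + c * b') = a' * d + b' * c + (a * d' + b * c') by ring.
  exact: E.
Qed.

Lemma cderivZ f f' k : cderiv f f' -> cderiv (fun w => k * f w) (fun w => k * f' w).
Proof.
move=> df; have dk : cderiv (fun=> k) (fun=> 0) by split=> x; exact: is_derive_cst.
have [d1 d2] := cderivM dk df.
by split=> x; [have := d1 x|have := d2 x]; rewrite mul0r add0r.
Qed.

Definition cvanish f :=
  [/\ Re (f n%:R) @[n --> \oo] --> (0 : R), Re (f (- n%:R)) @[n --> \oo] --> (0 : R),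
      Im (f n%:R) @[n --> \oo] --> (0 : R) & Im (f (- n%:R)) @[n --> \oo] --> (0 : R)].

Lemma cvanishM f g : cvanish f -> cvanish g -> cvanish (fun w => f w * g w).
Proof.
have L (a b c d : R ^nat) : a @ \oo --> (0 : R) -> b @ \oo --> (0 : R) ->
   c @ \oo --> (0 : R) -> d @ \oo --> (0 : R) ->
   (a n * b n + c n * d n) @[n --> \oo] --> (0 : R).
  move=> la lb lc ld; rewrite [X in _ --> X](_ : 0 = 0 * 0 + 0 * 0); last by ring.
  by apply: cvgD; apply: cvgM.
have L' (a b c d : R ^nat) : a @ \oo --> (0 : R) -> b @ \oo --> (0 : R) ->
   c @ \oo --> (0 : R) -> d @ \oo --> (0 : R) ->
   (a n * b n - c n * d n) @[n --> \oo] --> (0 : R).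
  move=> la lb lc ld; rewrite [X in _ --> X](_ : 0 = 0 * 0 - 0 * 0); last by ring.
  by apply: cvgB; apply: cvgM.
move=> [f1 f2 f3 f4] [g1 g2 g3 g4]; split.
- by under eq_fun do rewrite cReM; exact: L'.
- by under eq_fun do rewrite cReM; exact: L'.
- by under eq_fun do rewrite cImM; exact: L.
- by under eq_fun do rewrite cImM; exact: L.
Qed.

Lemma cvanishZ f k : cvanish f -> cvanish (fun w => k * f w).
Proof.
move=> [f1 f2 f3 f4].
have L (a b : R ^nat) (s t : R) : a @ \oo --> (0 : R) -> b @ \oo --> (0 : R) ->
   (s * a n + t * b n) @[n --> \oo] --> (0 : R).
  move=> la lb; rewrite [X in _ --> X](_ : 0 = s * 0 + t * 0); last by ring.
  by apply: cvgD; apply: cvgMr.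
have L' (a b : R ^nat) (s t : R) : a @ \oo --> (0 : R) -> b @ \oo --> (0 : R) ->
   (s * a n - t * b n) @[n --> \oo] --> (0 : R).
  move=> la lb; rewrite [X in _ --> X](_ : 0 = s * 0 - t * 0); last by ring.
  by apply: cvgB; apply: cvgMr.
split.
- by under eq_fun do rewrite cReM; exact: L'.
- by under eq_fun do rewrite cReM; exact: L'.
- by under eq_fun do rewrite cImM; exact: L.
- by under eq_fun do rewrite cImM; exact: L.
Qed.

(** The boundary terms of the fundamental theorem of calculus vanish. *)
Lemma PV_derive f f' : ccont f' -> cderiv f f' -> cvanish f -> PV f' 0.
Proof.
move=> [c1 c2] [d1 d2] [v1 v2 v3 v4].
have nn (n : nat) : - (n%:R : R) <= n%:R by rewrite lerNl (le_trans _ (ler0n _ n)) ?oppr_le0.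
split; split=> //.
- rewrite -[X in _ --> X](subrr 0).
  under eq_fun do rewrite (FTC_is_derive (nn _) c1 d1).
  exact: cvgB.
- rewrite -[X in _ --> X](subrr 0).
  under eq_fun do rewrite (FTC_is_derive (nn _) c2 d2).
  exact: cvgB.
Qed.

End ComplexFunctions.

(** * Integrals of products of first-order kernels *)

Section PrincipalValues.
Variable R : realType.
Notation C := R[i].
Notation Re := (@complex.Re R).
Notation Im := (@complex.Im R).
Implicit Types (l z : C) (ls : seq C).

Definition kern l (w : R) : C := (w *i - l)^-1.

Lemma ReB_iw l w : Re (w *i - l) = - Re l.
Proof. by rewrite cReD cReN /= add0r. Qed.
Lemma ImB_iw l w : Im (w *i - l) = w - Im l.
Proof. by rewrite cImD cImN. Qed.

Lemma Re_kern l w : Re (kern l w) = - Re l * ((w - Im l) ^+ 2 + Re l ^+ 2)^-1.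
Proof. by rewrite /kern cReV ReB_iw ImB_iw sqrrN addrC. Qed.

Lemma Im_kern l w : Im (kern l w) = - (w - Im l) * ((w - Im l) ^+ 2 + Re l ^+ 2)^-1.
Proof. by rewrite /kern cImV ReB_iw ImB_iw sqrrN mulNr [Re l ^+ 2 + _]addrC. Qed.

Lemma iw_subr_neq0 l w : Re l != 0 -> w *i - l != 0.
Proof.
by apply: contra_neq => /(congr1 Re); rewrite ReB_iw => /= /eqP; rewrite oppr_eq0 => /eqP.
Qed.

Lemma nsq_kern_gt0 l w : Re l != 0 -> 0 < (w - Im l) ^+ 2 + Re l ^+ 2.
Proof. by move=> l0; rewrite ltr_wpDl ?sqr_ge0 // lt_def sqrf_eq0 l0 sqr_ge0. Qed.

Lemma ccont_kern l : Re l != 0 -> ccont (kern l).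
Proof.
move=> l0; apply: ccontV; last by move=> w; exact: iw_subr_neq0.
by apply: ccontD; [exact: ccont_iw|exact: ccont_cst].
Qed.

Lemma is_derive_nsq (a b w : R) :
  is_derive w 1 (fun w => (w - b) ^+ 2 + a ^+ 2) (2 * (w - b)).
Proof.
apply: is_derive_eq; rewrite /GRing.scale /= subr0 addr0 mulr1.
by rewrite -mulr2n mulr_natl.
Qed.

Lemma cderiv_kern l : Re l != 0 ->
  cderiv (kern l) (fun w => - 'i * kern l w ^+ 2).
Proof.
move=> l0; split=> w; have n0 := lt0r_neq0 (nsq_kern_gt0 w l0);
  have dV := is_deriveV (f := fun w => (w - Im l) ^+ 2 + Re l ^+ 2) n0
    (is_derive_nsq (Re l) (Im l) w).
- rewrite (_ : Re \o _ = (- Re l) \*: (fun w => ((w - Im l) ^+ 2 + Re l ^+ 2)^-1 : R^o)); last first.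
    by apply/funext => x /=; rewrite Re_kern.
  apply: is_derive_eq (is_deriveZ (- Re l) dV) _.
  rewrite cReM !(cReM, cImM, cReN, cImN, expr2) Re_kern Im_kern /GRing.scale /=.
  by move: n0; move: (Re l) (w - Im l) => a u n0; field.
- rewrite (_ : Im \o _ = (fun w => - (w - Im l)) * (fun w => ((w - Im l) ^+ 2 + Re l ^+ 2)^-1)); last first.
    by apply/funext => x /=; rewrite Im_kern.
  have dw : is_derive w 1 (fun w => - (w - Im l)) (-1 : R).
    by apply: is_derive_eq; rewrite subr0.
  apply: is_derive_eq (is_deriveM dw dV) _.
  rewrite cImM !(cReM, cImM, cReN, cImN, expr2) Re_kern Im_kern /GRing.scale /=.
  by move: n0; move: (Re l) (w - Im l) => a u n0; field.
Qed.

Lemma cvanish_kern l : Re l != 0 -> cvanish (kern l).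
Proof.
move=> l0.
have r0 : 0 < `|Re l| by rewrite normr_gt0.
have sq : `|Re l| ^+ 2 = Re l ^+ 2 by rewrite real_normK ?num_real.
have neg (n : nat) : - (n%:R : R) - Im l = - (n%:R - - Im l) by ring.
split.
- under eq_fun do rewrite Re_kern -sq.
  rewrite (_ : (fun n => _) = fun n : nat => (0 * (n%:R - Im l) + (- Re l)) /
    ((n%:R - Im l) ^+ 2 + `|Re l| ^+ 2)); first exact: ratio_cvg0.
  by apply/funext => n; rewrite mul0r add0r.
- under eq_fun do rewrite Re_kern neg sqrrN -sq.
  rewrite (_ : (fun n => _) = fun n : nat => (0 * (n%:R - - Im l) + (- Re l)) /
    ((n%:R - - Im l) ^+ 2 + `|Re l| ^+ 2)); first exact: ratio_cvg0.
  by apply/funext => n; rewrite mul0r add0r.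
- under eq_fun do rewrite Im_kern -sq.
  rewrite (_ : (fun n => _) = fun n : nat => (-1 * (n%:R - Im l) + 0) /
    ((n%:R - Im l) ^+ 2 + `|Re l| ^+ 2)); first exact: ratio_cvg0.
  by apply/funext => n; rewrite mulN1r addr0.
- under eq_fun do rewrite Im_kern neg sqrrN -sq opprK.
  rewrite (_ : (fun n => _) = fun n : nat => (1 * (n%:R - - Im l) + 0) /
    ((n%:R - - Im l) ^+ 2 + `|Re l| ^+ 2)); first exact: ratio_cvg0.
  by apply/funext => n; rewrite mul1r addr0.
Qed.

(** The real part integrates to an arctangent, the imaginary part to a
    logarithm that cancels on symmetric intervals. *)
Lemma PV_kern l : Re l < 0 -> PV (kern l) (pi : R)%:C.
Proof.
move=> l0; have ln0 : Re l != 0 by rewrite lt_eqF.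
have nn (n : nat) : - (n%:R : R) <= n%:R by rewrite lerNl (le_trans _ (ler0n _ n)) ?oppr_le0.
have [c1 c2] := ccont_kern ln0.
have a0 : 0 < - Re l by rewrite oppr_gt0.
have at_lim (b : R) : atan ((n%:R - b) / - Re l) @[n --> \oo] --> (pi / 2 : R).
  have lim : ((n%:R - b) / - Re l : R) @[n --> \oo] --> +oo.
    apply/cvgryPge => A; near=> n; rewrite ler_pdivlMr //.
    by near: n; have /cvgryPge := @cvg_natB R b; apply.
  exact: cvg_comp lim (@cvgy_atan R).
split; split=> //.
- have dF (x : R) : is_derive x 1 (fun w => atan ((w - Im l) / - Re l)) (Re (kern l x)).
    apply: is_derive_eq; rewrite Re_kern /GRing.scale /=.
    have := lt0r_neq0 (nsq_kern_gt0 x ln0); have := lt0r_neq0 a0.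
    rewrite oppr_eq0.
    move: (Re l) (x - Im l) => a u h0 h1; rewrite subr0 mulr0 add0r mulr1.
    have -> : 1 + (u / - a) ^+ 2 = (u ^+ 2 + a ^+ 2) / a ^+ 2 by field.
    by field; rewrite h0 h1.
  rewrite (_ : (fun n => _) = fun n : nat => atan ((n%:R - Im l) / - Re l) +
      atan ((n%:R - - Im l) / - Re l)); last first.
    apply/funext => n; rewrite (FTC_is_derive (nn _) c1 dF) -atanN.
    by congr (_ + atan _); rewrite -mulNr; congr (_ / _); ring.
  rewrite [X in _ --> X](_ : _ = pi / 2 + pi / 2) /=; last by field.
  by apply: cvgD.
- pose D (b : R) (w : R) := (w - b) ^+ 2 + Re l ^+ 2.
  have Dp b w : 0 < D b w by rewrite ltr_wpDl ?sqr_ge0 // lt_def sqrf_eq0 ln0 sqr_ge0.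
  have dF (x : R) : is_derive x 1 (fun w => - 2^-1 * ln (D (Im l) w)) (Im (kern l x)).
    have dl := is_derive1_comp (is_derive1_ln (Dp (Im l) x)) (is_derive_nsq (Re l) (Im l) x).
    apply: is_derive_eq (is_deriveZ (- 2^-1) dl) _.
    rewrite Im_kern /GRing.scale /=; have := lt0r_neq0 (Dp (Im l) x); rewrite /D.
    by move: (Re l) (x - Im l) => a u h; field.
  (* the two boundary values of the logarithm have a quotient tending to 1 *)
  pose b := Im l; pose a : R := `|Re l|.
  have r0 : 0 < a by rewrite normr_gt0.
  rewrite (_ : (fun n => _) = fun n : nat => - 2^-1 * ln (1 +
     ((- (4 * b) * (n%:R - - b) + 4 * b ^+ 2) / ((n%:R - - b) ^+ 2 + a ^+ 2)))); last first.
    apply/funext => n; rewrite (FTC_is_derive (nn _) c2 dF) -mulrBr -ln_div ?posrE //; congr (_ * ln _).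
    have Dn : D b (- n%:R) = (n%:R - - b) ^+ 2 + a ^+ 2.
      by rewrite /D /a real_normK ?num_real //; ring.
    rewrite Dn; have := lt0r_neq0 (Dp b (- n%:R)); rewrite Dn => h.
    rewrite /D -/b (_ : Re l ^+ 2 = a ^+ 2); last by rewrite /a real_normK ?num_real.
    by move: h; move: (n%:R : R) => x h; field.
  rewrite [X in _ --> X](_ : _ = - 2^-1 * ln (1 + 0)) /=; last by rewrite addr0 ln1 mulr0.
  apply: cvgMr.
  have lim : 1 + (- (4 * b) * (n%:R - - b) + 4 * b ^+ 2) / ((n%:R - - b) ^+ 2 + a ^+ 2)
      @[n --> \oo] --> (1 + 0 : R).
    by apply: cvgD; [exact: cvg_cst|exact: ratio_cvg0].
  have cl : ln x @[x --> (1 + 0 : R)] --> ln (1 + 0 : R) by apply: continuous_ln; rewrite addr0.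
  exact: (cvg_comp _ _ lim cl).
Unshelve. all: by end_near. Qed.

Definition kprod ls (w : R) : C := \prod_(l <- ls) kern l w.

Lemma kprod_cons l ls w : kprod (l :: ls) w = kern l w * kprod ls w.
Proof. by rewrite /kprod big_cons. Qed.

(** For k >= 2 the k-th power of the kernel has the (k-1)-th power, up to a
    constant, as primitive, and this one vanishes at infinity. *)
Lemma PV_kern_pow l k : Re l != 0 -> PV (fun w => kern l w ^+ k.+2) 0.
Proof.
move=> l0.
have cX j : ccont (fun w => kern l w ^+ j.+1).
  elim: j => [|j IH].
    rewrite (_ : (fun _ => _) = kern l); first exact: ccont_kern.
    by apply/funext => w; rewrite expr1.
  rewrite (_ : (fun _ => _) = fun w => kern l w * kern l w ^+ j.+1).
    by apply: ccontM => //; exact: ccont_kern.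
  by apply/funext => w; rewrite exprS.
have vX j : cvanish (fun w => kern l w ^+ j.+1).
  elim: j => [|j IH].
    rewrite (_ : (fun _ => _) = kern l); first exact: cvanish_kern.
    by apply/funext => w; rewrite expr1.
  rewrite (_ : (fun _ => _) = fun w => kern l w * kern l w ^+ j.+1).
    by apply: cvanishM => //; exact: cvanish_kern.
  by apply/funext => w; rewrite exprS.
have dX j : cderiv (fun w => kern l w ^+ j.+1) (fun w => (j.+1%:R * - 'i) * kern l w ^+ j.+2).
  elim: j => [|j IH].
    rewrite (_ : (fun w => kern l w ^+ 1) = kern l); last by apply/funext => w; rewrite expr1.
    rewrite (_ : (fun w => _ * kern l w ^+ 2) = (fun w => - 'i * kern l w ^+ 2)).
      exact: cderiv_kern.
    by apply/funext => w; rewrite mul1r.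
  rewrite (_ : (fun w => kern l w ^+ j.+2) = fun w => kern l w * kern l w ^+ j.+1); last first.
    by apply/funext => w; rewrite exprS.
  rewrite (_ : (fun w => _ * kern l w ^+ j.+3) = fun w =>
     (- 'i * kern l w ^+ 2) * kern l w ^+ j.+1 +
     kern l w * ((j.+1%:R * - 'i) * kern l w ^+ j.+2)).
    by apply: cderivM => //; exact: cderiv_kern.
  apply/funext => w; rewrite -[j.+2%:R]natr1 !exprS.
  by move: (kern l w ^+ j) (kern l w) (j.+1%:R) ('i%C : C) => a b c d; ring.
have k0 : (k.+1%:R : C) != 0 by rewrite pnatr_eq0.
have ii : ('i * 'i : C) = -1 by rewrite -expr2 sqr_i.
apply: eq_PV (PV_derive _ (cderivZ ('i / k.+1%:R) (dX k)) (cvanishZ ('i / k.+1%:R) (vX k))) => //.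
  move=> w; move: (kern l w ^+ k.+2) => x.
  rewrite -!mulrA (mulrA k.+1%:R^-1) mulVf // mul1r mulrA mulrN ii opprK.
  by rewrite mul1r.
by apply: ccontM; [exact: ccont_cst|]; apply: ccontM; [exact: ccont_cst|].
Qed.

(** Two distinct poles are separated by partial fractions, so that only powers
    of a single kernel, which have an explicit primitive, remain. *)
Lemma PV_kprod ls : all (fun l => Re l < 0) ls -> (1 < size ls)%N -> PV (kprod ls) 0.
Proof.
have [m] := ubnP (size ls); elim: m ls => // m IH ls.
case: ls => // a ls1 sz /=; case/andP => ha hall s1.
have [eqa|] := boolP (all (pred1 a) ls1).
  have -> : ls1 = nseq (size ls1) a by apply/all_pred1P.
  case: (size ls1) s1 => // k _.
  apply: eq_PV (@PV_kern_pow a k _) => //; last by rewrite lt_eqF.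
  by move=> w; rewrite /kprod -[_ :: _]/(nseq k.+2 a) big_nseq iter_mulr_1.
rewrite -has_predC => /hasP [b bl /= nab].
have hb : Re b < 0 by move/allP: hall => /(_ _ bl).
have E w : kprod (a :: ls1) w = (a - b)^-1 * (kprod (a :: rem b ls1) w) +
    - (a - b)^-1 * kprod (b :: rem b ls1) w.
  rewrite !kprod_cons {1}/kprod (perm_big _ (perm_to_rem bl)) /= big_cons -/(kprod _ w).
  move: (kprod _ w) => t.
  have a0 : w *i - a != 0 by apply: iw_subr_neq0; rewrite lt_eqF.
  have b0 : w *i - b != 0 by apply: iw_subr_neq0; rewrite lt_eqF.
  have ab : a - b != 0 by rewrite subr_eq0 eq_sym.
  rewrite /kern; move: a0 b0 ab; move: (w *i) => s a0 b0 ab; field.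
  by rewrite a0 b0 ab.
have sr : size (rem b ls1) = (size ls1).-1 by rewrite size_rem.
have hr : all (fun l => Re l < 0) (rem b ls1).
  by apply/allP => x /mem_rem xl; move/allP: hall; apply.
case: (ltnP 1 (size ls1)) => s2.
- have szs : (size ls1 < m)%N by [].
  have szp : (size ls1).-1.+1 = size ls1 by rewrite prednK // ltnW.
  have Pa : PV (kprod (a :: rem b ls1)) 0 by apply: IH; rewrite /= ?ha ?sr ?szp.
  have Pb : PV (kprod (b :: rem b ls1)) 0 by apply: IH; rewrite /= ?hb ?sr ?szp.
  by apply: eq_PV (PVD (PVZ (a - b)^-1 Pa) (PVZ (- (a - b)^-1) Pb)); [move=> w; rewrite E|rewrite !mulr0 addr0].
(* with two poles in all, the two integrals are equal and cancel *)
- have s11 : size ls1 = 1%N by apply/eqP; rewrite eqn_leq s2; case: (ls1) bl.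
  have r0 : rem b ls1 = [::] by apply: size0nil; rewrite sr s11.
  have kk c : kprod [:: c] =1 kern c by move=> w; rewrite kprod_cons /kprod big_nil mulr1.
  apply: eq_PV (PVD (PVZ (a - b)^-1 (PV_kern ha)) (PVZ (- (a - b)^-1) (PV_kern hb))).
    by move=> w; rewrite E r0 !kk.
  by rewrite mulNr subrr.
Qed.

(** One step of Newton interpolation: the remainder of the division of the
    numerator by X - a is a constant. *)
Lemma frac_step (N : {poly C}) a ls : Re a != 0 -> (size N <= (size ls).+1)%N ->
  exists q : {poly C}, [/\ (size q <= size ls)%N, N = q * ('X - a%:P) + N.[a]%:P &
    forall w, N.[w *i] * kprod (a :: ls) w = q.[w *i] * kprod ls w + N.[a] * kprod (a :: ls) w].
Proof.
move=> a0 sN; have [q Nq] : exists q : {poly C}, N = q * ('X - a%:P) + N.[a]%:P.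
  have /factor_theorem [q Hq] : root (N - N.[a]%:P) a by rewrite rootE !hornerE subrr.
  by exists q; rewrite -Hq subrK.
exists q; split=> // [|w].
  have [->|q0] := eqVneq q 0; first by rewrite size_poly0.
  have szq : size (q * ('X - a%:P)) = (size q).+1.
    by rewrite size_Mmonic ?monicXsubC // size_XsubC addn2.
  rewrite -ltnS -szq (_ : q * _ = N - N.[a]%:P); last by rewrite {1}Nq addrK.
  apply: leq_trans (size_polyD _ _) _; rewrite geq_max sN size_polyN.
  by apply: leq_trans (size_polyC_leq1 _) _.
rewrite {1}Nq hornerD hornerC mulrDl; congr (_ + _).
rewrite hornerM hornerXsubC kprod_cons -mulrA; congr (_ * _).
by rewrite mulrA mulfV ?mul1r // iw_subr_neq0.
Qed.

(** Newton interpolation at the poles reduces a proper fraction to the products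
    of kernels; only the leading coefficient survives in the integral. *)
Lemma PV_frac (N : {poly C}) ls : all (fun l => Re l < 0) ls ->
  (size N <= size ls)%N ->
  PV (fun w => N.[w *i] * kprod ls w) ((pi : R)%:C * N`_(size ls).-1).
Proof.
elim: ls N => [|a ls IH] N /=.
  rewrite leqn0 size_poly_eq0 => _ /eqP ->; apply: eq_PV (PV0 R).
    by move=> w; rewrite horner0 mul0r.
  by rewrite coef0 mulr0.
case/andP => ha hall sN.
have [q [sq Nq E]] := frac_step (negbT (lt_eqF ha)) sN.
have kk c : kprod [:: c] =1 kern c by move=> w; rewrite kprod_cons /kprod big_nil mulr1.
case: ls => [|b ls] in IH hall sN sq E *.
  apply: eq_PV (PVZ N`_0 (PV_kern ha)); last by rewrite mulrC.
  by move=> w; rewrite kk [in RHS](size1_polyC sN) hornerC.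
have Pk : PV (kprod (a :: b :: ls)) 0 by apply: PV_kprod => //=; rewrite ha.
apply: eq_PV (PVD (IH q hall sq) (PVZ N.[a] Pk)); first by move=> w; rewrite E.
rewrite mulr0 addr0 [in RHS]Nq coefD coefC /= addr0 mulrBr coefB coefMX /= coefMC.
by rewrite [q`_(size ls).+1]nth_default // mul0r subr0.
Qed.

Lemma kern_decay l : Re l != 0 -> exists2 c : R, 0 < c &
  forall w, Re (kern l w) ^+ 2 + Im (kern l w) ^+ 2 <= c / (1 + w ^+ 2).
Proof.
move=> l0.
(* with l = a + ib one has |iw - l|^2 = (w - b)^2 + a^2 >= a^2, and
   1 + w^2 <= 2 (w - b)^2 + (1 + 2 b^2), whence the constant *)
pose a := Re l; pose b := Im l.
have a2 : 0 < a ^+ 2 by rewrite lt_def sqrf_eq0 l0 sqr_ge0.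
exists (2 + (1 + 2 * b ^+ 2) / a ^+ 2).
  by rewrite ltr_pwDl // divr_ge0 ?(ltW a2) // addr_ge0 // mulr_ge0 // sqr_ge0.
move=> w; have n0 := nsq_kern_gt0 w l0; rewrite -/a -/b in n0.
have -> : Re (kern l w) ^+ 2 + Im (kern l w) ^+ 2 = ((w - b) ^+ 2 + a ^+ 2)^-1.
  rewrite Re_kern Im_kern -/a -/b; move: n0; move: (w - b) => u /lt0r_neq0 n0.
  by field.
have w0 : 0 < 1 + w ^+ 2 by rewrite ltr_pwDl ?sqr_ge0.
rewrite ler_pdivlMr // mulrC ler_pdivrMr //.
have -> : (2 + (1 + 2 * b ^+ 2) / a ^+ 2) * ((w - b) ^+ 2 + a ^+ 2) =
   2 * (w - b) ^+ 2 + 2 * a ^+ 2 + (1 + 2 * b ^+ 2) + (1 + 2 * b ^+ 2) / a ^+ 2 * (w - b) ^+ 2.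
  by field; rewrite -sqrf_eq0 lt0r_neq0.
have h : 0 <= (1 + 2 * b ^+ 2) / a ^+ 2 * (w - b) ^+ 2.
  by rewrite mulr_ge0 ?sqr_ge0 // divr_ge0 ?(ltW a2) // addr_ge0 // mulr_ge0 // sqr_ge0.
have h2 : 0 <= (w - b - b) ^+ 2 by exact: sqr_ge0.
have h3 := ltW a2.
by move: h; set t := _ / _ * _ => h; nra.
Qed.

End PrincipalValues.

(** * Stable rational functions and Poisson's formula *)

Section StableFractions.
Variable R : realType.
Notation C := R[i].
Notation Re := (@complex.Re R).
Notation Im := (@complex.Im R).
Implicit Types (z c l : C) (ls : seq C) (N D : {poly C}).

Definition nsq z : R := Re z ^+ 2 + Im z ^+ 2.

Lemma nsq_ge0 z : 0 <= nsq z.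
Proof. by rewrite addr_ge0 ?sqr_ge0. Qed.

Lemma nsqM z c : nsq (z * c) = nsq z * nsq c.
Proof. rewrite /nsq cReM cImM; ring. Qed.

Lemma nsqD_le z c : nsq (z + c) <= 2 * (nsq z + nsq c).
Proof.
rewrite /nsq cReD cImD; move: (Re z) (Im z) (Re c) (Im c) => x y u v.
have := sqr_ge0 (x - u); have := sqr_ge0 (y - v); nra.
Qed.

Lemma nsqE z : (nsq z)%:C = z * conjc z.
Proof. by case: z => a b; apply: complex_ext; rewrite /nsq /=; ring. Qed.

Lemma nsqJ z : nsq (conjc z) = nsq z.
Proof. by rewrite /nsq cReJ cImJ sqrrN. Qed.

Lemma nsq0 : nsq 0 = 0. Proof. by rewrite /nsq /= expr0n addr0. Qed.

Lemma nsq_eq0 z : (nsq z == 0) = (z == 0).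
Proof.
have [->|z0] := eqVneq z 0; first by rewrite nsq0 eqxx.
by apply/negbTE/lt0r_neq0/nsq_gt0.
Qed.

Lemma ratio_le (c w : R) : 0 <= c -> c / (1 + w ^+ 2) <= c.
Proof.
move=> c0; rewrite ler_pdivrMr; last by rewrite ltr_pwDl ?sqr_ge0.
by rewrite ler_peMr // lerDl sqr_ge0.
Qed.

Lemma kprod_bound ls : all (fun l => Re l < 0) ls ->
  exists2 c : R, 0 <= c & forall w, nsq (kprod ls w) <= c.
Proof.
elim: ls => [_|a ls IH /= /andP[a0 /IH[c c0 hc]]].
  by exists 1 => // w; rewrite /kprod big_nil /nsq /= expr1n expr0n addr0.
have [d d0 hd] := kern_decay (negbT (lt_eqF a0)).
exists (d * c); first by rewrite mulr_ge0 // ltW.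
move=> w; rewrite kprod_cons nsqM ler_pM ?nsq_ge0 //.
exact: le_trans (hd w) (ratio_le _ (ltW d0)).
Qed.

(** The same interpolation as for the principal values, now with bounds. *)
Lemma frac_bound N ls : all (fun l => Re l < 0) ls -> (size N <= size ls)%N ->
  exists2 c : R, 0 <= c & forall w, nsq (N.[w *i] * kprod ls w) <= c / (1 + w ^+ 2).
Proof.
elim: ls N => [|a ls IH] N /=.
  rewrite leqn0 size_poly_eq0 => _ /eqP ->; exists 0 => // w.
  by rewrite horner0 mul0r nsq0 mul0r.
case/andP => ha hall sN.
have [q [sq Nq E]] := frac_step (negbT (lt_eqF ha)) sN.
have [c c0 hc] := IH q hall sq.
have [d d0 hd] := kern_decay (negbT (lt_eqF ha)).
have [e e0 he] := kprod_bound hall.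
exists (2 * (c + nsq N.[a] * (d * e))).
  by rewrite mulr_ge0 // addr_ge0 // mulr_ge0 ?nsq_ge0 // mulr_ge0 // ltW.
move=> w; rewrite E; apply: le_trans (nsqD_le _ _) _.
rewrite -mulrA ler_wpM2l // mulrDl lerD //.
rewrite nsqM -[leRHS]mulrA ler_wpM2l ?nsq_ge0 // kprod_cons nsqM.
by rewrite [leRHS]mulrAC ler_pM ?nsq_ge0 ?he //; exact: hd.
Qed.

(** The polynomials whose inverses are stable. *)
Definition hurwitz_poly D := D != 0 /\ forall s, root D s -> Re s < 0.

(** Over the algebraically closed field [R[i]] a fraction with stable denominator
    is a numerator times a product of kernels. *)
Lemma hurwitz_polyP D : hurwitz_poly D -> exists ls,
  [/\ all (fun l => Re l < 0) ls, size D = (size ls).+1, lead_coef D != 0 &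
   forall N w, N.[w *i] / D.[w *i] = (lead_coef D)^-1 * (N.[w *i] * kprod ls w)].
Proof.
case=> D0 hD; have [ls Dls] := closed_field_poly_normal D.
have lc0 : lead_coef D != 0 by rewrite lead_coef_eq0.
exists ls; split=> //.
- apply/allP => l lls; apply: hD; rewrite Dls rootZ //.
  by rewrite root_prod_XsubC.
- by rewrite Dls size_scale // size_prod_XsubC.
- move=> N w; rewrite {1}Dls hornerZ invfM mulrCA; congr (_ * (_ * _)).
  rewrite horner_prod /kprod -prodfV; apply: eq_bigr => l _.
  by rewrite hornerXsubC.
Qed.

Lemma PV_hurwitz N D : hurwitz_poly D -> (size N < size D)%N ->
  PV (fun w => N.[w *i] / D.[w *i])
     ((pi : R)%:C * (N`_(size D).-2 / lead_coef D)).
Proof.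
move=> /hurwitz_polyP [ls [hls sD lc0 E]] sN.
have := PVZ (lead_coef D)^-1 (PV_frac (N := N) hls _).
rewrite sD /= -ltnS -sD => /(_ sN); apply: eq_PV; first by move=> w; rewrite E.
by rewrite mulrCA [X in _ * X]mulrC.
Qed.

Lemma bound_hurwitz N D : hurwitz_poly D -> (size N < size D)%N ->
  exists2 c : R, 0 <= c & forall w, nsq (N.[w *i] / D.[w *i]) <= c / (1 + w ^+ 2).
Proof.
move=> /hurwitz_polyP [ls [hls sD lc0 E]] sN.
have [|c c0 hc] := frac_bound (N := N) hls; first by rewrite -ltnS -sD.
exists (nsq (lead_coef D)^-1 * c); first by rewrite mulr_ge0 ?nsq_ge0.
by move=> w; rewrite E nsqM -mulrA ler_wpM2l ?nsq_ge0.
Qed.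

Lemma hurwitz_poly_neq0 D s : hurwitz_poly D -> 0 <= Re s -> D.[s] != 0.
Proof. by move=> [_ hD] s0; apply/negP => /hD; rewrite ltNge s0. Qed.

Lemma hurwitz_polyM_XsubC D l : hurwitz_poly D -> Re l < 0 ->
  hurwitz_poly (D * ('X - l%:P)).
Proof.
move=> [D0 hD] l0; split; first by rewrite mulf_neq0 ?polyXsubC_eq0.
by move=> s; rewrite rootM root_XsubC => /orP[/hD|/eqP ->].
Qed.

Definition poisson (s : C) (w : R) : R := 2 * Re s / nsq (w *i - s).

Lemma poisson_ge0 s w : 0 < Re s -> 0 <= poisson s w.
Proof. by move=> s0; rewrite divr_ge0 ?nsq_ge0 // mulr_ge0 // ltW. Qed.

(** The Poisson kernel is twice the real part of a first-order kernel with pole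
    at the mirror image of s, which is stable. *)
Lemma poissonE s w : 0 < Re s ->
  (poisson s w)%:C = kern (- conjc s) w + conjc (kern (- conjc s) w).
Proof.
move=> s0; have h : w *i - - conjc s != 0.
  by apply: iw_subr_neq0; rewrite cReN cReJ oppr_eq0 lt0r_neq0.
rewrite addcJ; have -> : (2%:R : C) = ((2 : R)%:C) by rewrite rmorph_nat.
rewrite -rmorphM /=; congr (_%:C).
rewrite Re_kern cReN cImN cReJ cImJ !opprK /poisson /nsq cReD cImD cReN cImN /=.
by rewrite add0r sqrrN addrC mulrA.
Qed.

Lemma PV_poisson s : 0 < Re s -> PV (fun w => (poisson s w)%:C) (2 * pi : R)%:C.
Proof.
move=> s0; have h : Re (- conjc s) < 0 by rewrite cReN cReJ oppr_lt0.
apply: eq_PV (PVD (PV_kern h) (PVJ (PV_kern h))); first by move=> w; rewrite poissonE.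
by rewrite conjc_real -rmorphD /=; congr (_%:C); ring.
Qed.

(** Poisson's formula for the right half-plane: both terms of the kernel are
    evaluated by the leading coefficient of a stable fraction. *)
Lemma PV_poisson_frac N D s : hurwitz_poly D -> (size N < size D)%N -> 0 < Re s ->
  PV (fun w => N.[w *i] / D.[w *i] * (poisson s w)%:C)
     ((2 * pi : R)%:C * (N.[s] / D.[s])).
Proof.
move=> hD sN s0; have h : Re (- conjc s) < 0 by rewrite cReN cReJ oppr_lt0.
have D0 : D != 0 by case: hD.
have Ds : D.[s] != 0 by apply: hurwitz_poly_neq0 => //; exact: ltW.
have sD2 : (size (D * ('X - (- conjc s)%:P))) = (size D).+1.
  by rewrite size_Mmonic ?monicXsubC // size_XsubC addn2.
have sN2 : (size N < size (D * ('X - (- conjc s)%:P))%R)%N by rewrite sD2 ltnS ltnW.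
have P1 := PV_hurwitz (hurwitz_polyM_XsubC hD h) sN2.
rewrite sD2 /= [N`__]nth_default in P1; last by case: (size D) sN.
(* B vanishes at s, so that q = B / (X - s) removes the unstable pole s of the
   conjugate of the kernel *)
pose B := D.[s] *: N - N.[s] *: D.
have [q Bq] : exists q : {poly C}, B = q * ('X - s%:P).
  by apply/factor_theorem; rewrite rootE !hornerE mulrC subrr.
have sB : (size B <= size D)%N.
  apply: leq_trans (size_polyD _ _) _; rewrite size_polyN geq_max.
  by rewrite (leq_trans (size_scale_leq _ _)) ?(leq_trans (size_scale_leq _ _)) // ltnW.
have sq : (size q < size D)%N.
  have [->|q0] := eqVneq q 0; first by rewrite size_poly0 size_poly_gt0.
  apply: leq_trans sB; rewrite Bq size_Mmonic ?monicXsubC // size_XsubC addn2 //.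
have P2 := PVZ (- D.[s]^-1) (PV_hurwitz hD sq).
have P3 := PVZ (N.[s] / D.[s]) (PVJ (PV_kern h)).
apply: eq_PV (PVD P1 (PVD P2 P3)).
- move=> w; rewrite poissonE // hornerM hornerXsubC [RHS]mulrDr.
  have Dw : D.[w *i] != 0 by apply: hurwitz_poly_neq0.
  have ws : w *i - s != 0 by apply: iw_subr_neq0; rewrite lt0r_neq0.
  congr (_ + _); first by rewrite /kern invfM mulrA.
  have -> : conjc (kern (- conjc s) w) = (s - w *i)^-1.
    rewrite /kern conjc_inv; congr (_^-1).
    by case: (s) => a b; apply: complex_ext => /=; ring.
  have Hq : D.[s] * N.[w *i] - N.[s] * D.[w *i] = q.[w *i] * (w *i - s).
    by have /(congr1 (fun p : {poly C} => p.[w *i])) := Bq; rewrite /B !hornerE.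
  have sw : s - w *i != 0 by rewrite -opprB oppr_eq0.
  have -> : N.[w *i] = (N.[s] * D.[w *i] + q.[w *i] * (w *i - s)) / D.[s].
    by rewrite -Hq; field.
  move: Dw sw Ds; move: D.[s] D.[w *i] q.[w *i] N.[s] (w *i) => a b c d e h1 h2 h3.
  by field; rewrite h1 h2 h3.
- have E : q`_(size D).-2 = - N.[s] * lead_coef D.
    have := congr1 (fun p : {poly C} => p`_(size D).-1) Bq.
    rewrite /B coefB !coefZ -lead_coefE [N`__]nth_default; last by case: (size D) sN.
    rewrite mulr0 sub0r mulrBr coefB coefMC [q`_(size D).-1]nth_default; last by case: (size D) sq.
    rewrite mul0r subr0 coefMX mulNr => ->.
    case: (size D) sN D0 sq => // -[|k] //=; rewrite !ltnS !leqn0 size_poly_eq0.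
    by move=> _ _; rewrite size_poly_eq0 => /eqP ->; rewrite coef0.
  rewrite E mul0r mulr0 add0r conjc_real.
  have lc0 : lead_coef D != 0 by rewrite lead_coef_eq0.
  rewrite rmorphM /= (_ : (2 : R)%:C = 2%:R); last by rewrite rmorph_nat.
  by move: lc0 Ds; move: (lead_coef D) D.[s] => a b h1 h2; field; rewrite h1 h2.
Qed.

End StableFractions.

(** * Resolvents and the Lyapunov equation *)

Section Adjugate.
Variable F : fieldType.

(** Comparing both sides of adj (X - A) * (X - A) = char_poly A * I as
    polynomials with matrix coefficients: the adjugate has degree n - 1 and
    leading coefficient I. *)
Lemma adj_char_poly_mx n (A : 'M[F]_n) i j :
  (size (\adj (char_poly_mx A) i j) <= n)%N /\
  (\adj (char_poly_mx A) i j)`_n.-1 = (i == j)%:R.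
Proof.
case: n => [|n'] in A i j *; first by case: i.
have [phi [_ phiZ phiC coef_phi]] := mx_poly_ring_isom F n'.
set Q := phi (\adj (char_poly_mx A)).
have QE : Q * ('X - A%:P) = map_poly scalar_mx (char_poly A).
  rewrite -phiZ -mul_adj_mx rmorphM /= -/Q; congr (_ * _).
  by rewrite rmorphB phiC phiZ map_polyX.
have lc : scalar_mx (lead_coef (char_poly A)) != 0 :> 'M[F]_n'.+1.
  by rewrite (monicP (char_poly_monic A)) oner_neq0.
have szR : size (map_poly scalar_mx (char_poly A) : {poly 'M[F]_n'.+1}) = n'.+2.
  by rewrite size_map_poly_id0 // size_char_poly.
have Q0 : Q != 0.
  by apply: contra_eq_neq QE => ->; rewrite mul0r eq_sym -size_poly_eq0 szR.
have szQ : size Q = n'.+1.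
  have := congr1 (fun p : {poly _} => size p) QE.
  by rewrite szR size_Mmonic ?monicXsubC // size_XsubC addn2 => -[].
have lQ : lead_coef Q = 1.
  rewrite -(lead_coef_Mmonic Q (monicXsubC A)) QE lead_coef_map_id0 ?raddf0 //.
  by rewrite (monicP (char_poly_monic A)).
split.
- apply/leq_sizeP => k nk; rewrite -coef_phi -/Q nth_default ?mxE //.
  by rewrite szQ.
- have Qn : Q`_n' = 1 by rewrite -lQ lead_coefE szQ.
  by rewrite -coef_phi -/Q /= Qn mxE.
Qed.

Lemma map_horner_char_poly_mx n (A : 'M[F]_n) s :
  map_mx (horner_eval s) (char_poly_mx A) = s%:M - A.
Proof.
by apply/matrixP => i j; rewrite !mxE /horner_eval /= !(hornerE, hornerMn).
Qed.

Lemma det_scalar_subr n (A : 'M[F]_n) s : \det (s%:M - A) = (char_poly A).[s].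
Proof. by rewrite -map_horner_char_poly_mx det_map_mx. Qed.

(** Cramer's rule: the entries of the resolvent are strictly proper fractions
    with the characteristic polynomial as denominator. *)
Lemma invmx_scalar_subr n (A : 'M[F]_n) s i j : (char_poly A).[s] != 0 ->
  invmx (s%:M - A) i j = (\adj (char_poly_mx A) i j).[s] / (char_poly A).[s].
Proof.
move=> h; rewrite /invmx unitmxE det_scalar_subr unitfE h mxE mulrC; congr (_ / _).
by rewrite -map_horner_char_poly_mx -map_mx_adj mxE.
Qed.

End Adjugate.

Section Resolvent.
Variable R : realType.
Notation C := R[i].
Notation Re := (@complex.Re R).
Notation Im := (@complex.Im R).

Definition cmx m n (A : 'M[R]_(m, n)) : 'M[C]_(m, n) := map_mx (@toC R) A.
Definition remx m n (A : 'M[C]_(m, n)) : 'M[R]_(m, n) := map_mx Re A.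
Definition immx m n (A : 'M[C]_(m, n)) : 'M[R]_(m, n) := map_mx Im A.

Lemma Re_sum (I : Type) (r : seq I) (F : I -> C) :
  Re (\sum_(i <- r) F i) = \sum_(i <- r) Re (F i).
Proof. by elim/big_ind2: _ => // x a y b <- <-; rewrite cReD. Qed.

Lemma Im_sum (I : Type) (r : seq I) (F : I -> C) :
  Im (\sum_(i <- r) F i) = \sum_(i <- r) Im (F i).
Proof. by elim/big_ind2: _ => // x a y b <- <-; rewrite cImD. Qed.

Lemma remx_cmxMl m n p (A : 'M[R]_(m, n)) (B : 'M[C]_(n, p)) :
  remx (cmx A *m B) = A *m remx B.
Proof.
apply/matrixP => i j; rewrite !mxE Re_sum; apply: eq_bigr => k _.
by rewrite !mxE cReM /= mul0r subr0.
Qed.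

Lemma immx_cmxMl m n p (A : 'M[R]_(m, n)) (B : 'M[C]_(n, p)) :
  immx (cmx A *m B) = A *m immx B.
Proof.
apply/matrixP => i j; rewrite !mxE Im_sum; apply: eq_bigr => k _.
by rewrite !mxE cImM /= mul0r addr0.
Qed.

Lemma remx_cmxMr m n p (A : 'M[C]_(m, n)) (B : 'M[R]_(n, p)) :
  remx (A *m cmx B) = remx A *m B.
Proof.
apply/matrixP => i j; rewrite !mxE Re_sum; apply: eq_bigr => k _.
by rewrite !mxE cReM /= mulr0 subr0.
Qed.

Lemma immx_cmxMr m n p (A : 'M[C]_(m, n)) (B : 'M[R]_(n, p)) :
  immx (A *m cmx B) = immx A *m B.
Proof.
apply/matrixP => i j; rewrite !mxE Im_sum; apply: eq_bigr => k _.
by rewrite !mxE cImM /= mulr0 add0r.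
Qed.

Variables (n : nat) (M : 'M[R]_n).

Definition resolvent (s : C) : 'M[C]_n := invmx (s%:M - cmx M).

Hypothesis hM : hurwitz M.

Lemma hurwitz_char_poly : hurwitz_poly (char_poly (cmx M)).
Proof.
split; first exact/monic_neq0/char_poly_monic.
by move=> s; rewrite -eigenvalue_root_char; exact: hM.
Qed.

Lemma resolvent_unit s : 0 <= Re s -> s%:M - cmx M \in unitmx.
Proof.
move=> s0; rewrite unitmxE det_scalar_subr unitfE.
exact: hurwitz_poly_neq0 hurwitz_char_poly s0.
Qed.

Lemma resolventE w i j : resolvent (w *i) i j =
  (\adj (char_poly_mx (cmx M)) i j).[w *i] / (char_poly (cmx M)).[w *i].
Proof.
by rewrite /resolvent invmx_scalar_subr //; exact: hurwitz_poly_neq0 hurwitz_char_poly _.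
Qed.

Lemma size_adj_lt i j :
  (size (\adj (char_poly_mx (cmx M)) i j) < size (char_poly (cmx M)))%N.
Proof. by rewrite size_char_poly ltnS; case: (adj_char_poly_mx (cmx M) i j). Qed.

(** The scalar core of Parseval's identity. *)
Lemma PV_resolvent i j :
  PV (fun w => resolvent (w *i) i j) ((pi : R)%:C * (i == j)%:R).
Proof.
apply: eq_PV (PV_hurwitz hurwitz_char_poly (size_adj_lt i j)).
  by move=> w; rewrite resolventE.
rewrite (monicP (char_poly_monic _)) divr1 size_char_poly /=.
by case: (adj_char_poly_mx (cmx M) i j) => _ ->.
Qed.

Notation A w := (remx (resolvent (w *i))).
Notation B w := (immx (resolvent (w *i))).

(** The real and imaginary parts of (iw - M) R = I. Real matrices are used below
    because Q, Pi and M are real and the principal values are taken of real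
    functions. *)
Lemma resolvent_reim w : M *m A w = - 1%:M - w *: B w /\ M *m B w = w *: A w.
Proof.
have /mulmxV : (w *i)%:M - cmx M \in unitmx by apply: resolvent_unit.
rewrite -/(resolvent _) mulmxBl mul_scalar_mx => E.
have {}E : cmx M *m resolvent (w *i) = (w *i) *: resolvent (w *i) - 1%:M.
  by rewrite -E opprB addrC subrK.
split.
- rewrite -remx_cmxMl E; apply/matrixP => i j; rewrite !mxE cReD cReN cReM /=.
  by rewrite mul0r sub0r addrC; case: eqP => _ /=; rewrite ?oppr0.
- rewrite -immx_cmxMl E; apply/matrixP => i j; rewrite !mxE cImD cImN cImM /=.
  by rewrite mul0r add0r; case: eqP => _ /=; rewrite subr0.
Qed.

(** Lyapunov's equation, in the frequency domain: with S = iw - M one has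
    S^* Pi + Pi S = - (M^T Pi + Pi M), and it remains to multiply by the
    inverses of S^* and S on the two sides. *)
Lemma lyapunov_resolvent (Pi Q : 'M[R]_n) w : M^T *m Pi + Pi *m M = - Q ->
  (A w)^T *m Q *m A w + (B w)^T *m Q *m B w = Pi *m A w + (A w)^T *m Pi.
Proof.
have [EA EB] := resolvent_reim w; move=> EQ.
have -> : Q = - (M^T *m Pi + Pi *m M) by rewrite EQ opprK.
have quad (X : 'M[R]_n) : X^T *m - (M^T *m Pi + Pi *m M) *m X =
   - ((M *m X)^T *m Pi *m X + X^T *m Pi *m (M *m X)).
  by rewrite trmx_mul mulmxN mulNmx mulmxDr mulmxDl !mulmxA.
have tr1 (X : 'M[R]_n) : (- 1%:M - w *: X)^T = - 1%:M - w *: X^T.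
  by apply/matrixP => i j; rewrite !mxE eq_sym.
have tr2 (X : 'M[R]_n) : (w *: X)^T = w *: X^T by apply/matrixP => i j; rewrite !mxE.
rewrite !quad EA EB tr1 tr2 !mulmxDl !mulmxDr !mulNmx !mulmxN !mul1mx !mulmx1.
rewrite -!scalemxAl -!scalemxAr.
move: ((B w)^T *m Pi *m A w) ((A w)^T *m Pi *m B w) (Pi *m A w) => X Y Z.
move: ((A w)^T *m Pi) => T.
apply/matrixP => i j; rewrite !mxE; ring.
Qed.

Lemma PVr_reA i j : PVr (fun w => A w i j) ((pi : R) * (i == j)%:R).
Proof.
have [+ _] := PV_resolvent i j; apply: eq_PVr; first by move=> w /=; rewrite mxE.
by case: (i == j); rewrite ?mulr1 ?mulr0.
Qed.

Lemma PVr_sum (I : Type) (r : seq I) (F : I -> R -> R) (a : I -> R) :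
  (forall i, PVr (F i) (a i)) ->
  PVr (fun w => \sum_(i <- r) F i w) (\sum_(i <- r) a i).
Proof.
move=> cF; elim: r => [|i r IH].
  by apply: eq_PVr (PVr0 R); [move=> w|]; rewrite big_nil.
by apply: eq_PVr (PVrD (cF i) IH); [move=> w|]; rewrite big_cons.
Qed.

Lemma PVr_mulA p q (P : 'M[R]_(p, n)) (L : 'M[R]_(n, q)) i j :
  PVr (fun w => (P *m A w *m L) i j) (pi * (P *m L) i j).
Proof.
apply: eq_PVr (PVr_sum (index_enum 'I_n) (fun k =>
   PVrZ (L k j) (PVr_sum (index_enum 'I_n) (fun l => PVrZ (P i l) (PVr_reA l k))))).
- move=> w; rewrite mxE; apply: eq_bigr => k _; rewrite mulrC; congr (_ * _).
  by rewrite mxE.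
- rewrite mxE mulr_sumr; apply: eq_bigr => k _.
  rewrite (bigD1 k) //= big1 ?addr0; last by move=> l /negbTE ->; rewrite !mulr0.
  by rewrite eqxx mulr1; ring.
Qed.

(** Parseval's identity: the energy of the resolvent seen through Q is the
    Lyapunov form. *)
Lemma PVr_lyapunov q (Pi Q : 'M[R]_n) (L : 'M[R]_(n, q)) i j :
  M^T *m Pi + Pi *m M = - Q ->
  PVr (fun w => (L^T *m ((A w)^T *m Q *m A w + (B w)^T *m Q *m B w) *m L) i j)
      (2 * pi * (L^T *m Pi *m L) i j).
Proof.
have tr (X : 'M[R]_q) : X j i = X^T i j by rewrite mxE.
move=> EQ; apply: eq_PVr (PVrD (PVr_mulA (L^T *m Pi) L i j)
   (PVr_mulA (L^T *m Pi^T) L j i)).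
- move=> w; rewrite (lyapunov_resolvent _ EQ) mulmxDr mulmxDl [RHS]mxE !mulmxA.
  by congr (_ + _); rewrite tr !trmx_mul !trmxK !mulmxA.
- rewrite tr !trmx_mul !trmxK !mulmxA; move: ((_ *m L) i j) => x; ring.
Qed.

(** By Parseval's identity with Q = 0. *)
Lemma lyapunov_inj (Pi : 'M[R]_n) : M^T *m Pi + Pi *m M = 0 -> Pi = 0.
Proof.
move=> E; apply/matrixP => i j; rewrite mxE.
have E0 : M^T *m Pi + Pi *m M = - 0 by rewrite oppr0.
have := PV_uniq (PVr_lyapunov 1%:M i j E0) _ => /(_ 0).
rewrite trmx1 mul1mx mulmx1 => h; have /eqP : 2 * pi * Pi i j = 0.
  apply: h; apply: eq_PVr (PVr0 R) => // w.
  by rewrite !mulmx0 !mul0mx addr0 mulmx0 mul0mx mxE.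
by rewrite mulf_eq0 mulf_eq0 pnatr_eq0 /= gt_eqF ?pi_gt0 //= => /eqP.
Qed.

(** A linear endomorphism of a finite-dimensional space that is injective is
    surjective. *)
Lemma lyapunov_exists (Q : 'M[R]_n) : exists Pi, M^T *m Pi + Pi *m M = - Q.
Proof.
pose F : {linear 'M[R]_n -> 'M[R]_n} := mulmx M^T \+ mulmxr M.
have free : row_free (lin_mx F).
  rewrite -kermx_eq0; apply/eqP/row_matrixP => i; rewrite row0.
  have /(congr1 (row i)) := mulmx_ker (lin_mx F); rewrite row_mul row0 => h.
  have : F (vec_mx (row i (kermx (lin_mx F)))) = 0.
    by apply: (can_inj mxvecK); rewrite -mul_vec_lin vec_mxK h linear0.
  by move=> /lyapunov_inj /(congr1 mxvec); rewrite vec_mxK linear0.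
have un : lin_mx F \in unitmx by rewrite -row_free_unit.
exists (vec_mx (mxvec (- Q) *m invmx (lin_mx F))).
apply: (can_inj mxvecK); rewrite -[LHS]/(mxvec (F _)) -mul_vec_lin vec_mxK.
by rewrite mulmxKV.
Qed.

Definition psd_mx (Q : 'M[R]_n) := forall v : 'cV[R]_n, 0 <= (v^T *m Q *m v) 0 0.

(** Parseval's identity represents v^T Pi v as the integral of a nonnegative
    function. *)
Lemma lyapunov_psd (Pi Q : 'M[R]_n) : M^T *m Pi + Pi *m M = - Q ->
  psd_mx Q -> psd_mx Pi.
Proof.
move=> EQ hQ v.
have h := le_PVr (PVr0 R) (PVr_lyapunov v 0 0 EQ).
rewrite -(@pmulr_rge0 _ (2 * pi)) ?mulr_gt0 ?pi_gt0 //; apply: h => w.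
rewrite mulmxDr mulmxDl mxE addr_ge0 //.
- by have := hQ (A w *m v); rewrite trmx_mul !mulmxA.
- by have := hQ (B w *m v); rewrite trmx_mul !mulmxA.
Qed.

End Resolvent.

(** * The Frobenius norm and the largest singular value *)

Section FrobeniusAndSigma.
Variable R : realType.
Notation C := R[i].
Notation Re := (@complex.Re R).
Notation Im := (@complex.Im R).

(** The sharp form of the triangle inequality is recovered from the weighted
    inequalities |x + y|^2 <= (1 + t) |x|^2 + (1 + 1/t) |y|^2, which, unlike
    it, are stable under sums and integrals. *)
Lemma sqrD_weighted (f a b : R) : 0 <= a -> 0 <= b ->
  (forall t, 0 < t -> f <= (1 + t) * a ^+ 2 + (1 + t^-1) * b ^+ 2) ->
  f <= (a + b) ^+ 2.
Proof.
rewrite le_eqVlt => /predU1P[<-|a0].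
  rewrite le_eqVlt => /predU1P[<-|b0] h.
    by have := h 1 ltr01; rewrite !expr0n /= !mulr0 addr0 expr0n.
  rewrite add0r; apply/ler_addgt0Pr => e e0.
  have t0 : 0 < b ^+ 2 / e by rewrite divr_gt0 // exprn_gt0.
  have := h _ t0; rewrite expr0n mulr0 add0r invfM invrK mulrDl mul1r.
  by rewrite mulrAC mulVf ?mul1r // expf_neq0 // gt_eqF.
rewrite le_eqVlt => /predU1P[<-|b0] h.
  rewrite addr0; apply/ler_addgt0Pr => e e0.
  have t0 : 0 < e / a ^+ 2 by rewrite divr_gt0 // exprn_gt0.
  have := h _ t0; rewrite expr0n mulr0 addr0 mulrDl mul1r.
  by rewrite mulfVK // expf_neq0 // gt_eqF.
(* this weight minimizes the right-hand side *)
have t0 : 0 < b / a by rewrite divr_gt0.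
have := h _ t0; congr (_ <= _).
by have := lt0r_neq0 a0; have := lt0r_neq0 b0; move=> h1 h2; field; rewrite h1 h2.
Qed.

(** The Frobenius norm bridges the two norms of the theorem: its square integrates
    to the squared H2 norm, and it is submultiplicative with respect to the
    largest singular value. *)
Definition frob2 m n (F : 'M[C]_(m, n)) : R := \sum_i \sum_j nsq (F i j).
Definition hct m n (F : 'M[C]_(m, n)) : 'M[C]_(n, m) := (map_mx Num.conj F)^T.

Lemma frob2_ge0 m n (F : 'M[C]_(m, n)) : 0 <= frob2 F.
Proof. by apply: sumr_ge0 => i _; apply: sumr_ge0 => j _; exact: nsq_ge0. Qed.

Lemma frob2_reim m n (F : 'M[C]_(m, n)) :
  frob2 F = \tr ((remx F)^T *m remx F + (immx F)^T *m immx F).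
Proof.
rewrite mxtraceD /mxtrace -big_split /= /frob2 exchange_big /=; apply: eq_bigr => j _.
by rewrite !mxE -big_split /=; apply: eq_bigr => i _; rewrite !mxE -!expr2.
Qed.

Lemma frob2E m n (F : 'M[C]_(m, n)) : (frob2 F)%:C = \tr (hct F *m F).
Proof.
rewrite /frob2 exchange_big /= rmorph_sum; apply: eq_bigr => j _.
rewrite rmorph_sum mxE; apply: eq_bigr => i _.
by rewrite /= nsqE !mxE mulrC.
Qed.

Lemma hctM m n p (F : 'M[C]_(m, n)) (G : 'M[C]_(n, p)) : hct (F *m G) = hct G *m hct F.
Proof. by rewrite /hct map_mxM trmx_mul. Qed.

Lemma hctK m n (F : 'M[C]_(m, n)) : hct (hct F) = F.
Proof. by apply/matrixP => i j; rewrite !mxE conjCK. Qed.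

Lemma frob2_hct m n (F : 'M[C]_(m, n)) : frob2 (hct F) = frob2 F.
Proof.
rewrite /frob2 exchange_big /=; apply: eq_bigr => i _; apply: eq_bigr => j _.
by rewrite !mxE; exact: nsqJ.
Qed.

Lemma nsqD_weighted (x y : C) (t : R) : 0 < t ->
  nsq (x + y) <= (1 + t) * nsq x + (1 + t^-1) * nsq y.
Proof.
have L (a b : R) : 0 < t -> (a + b) ^+ 2 <= (1 + t) * a ^+ 2 + (1 + t^-1) * b ^+ 2.
  move=> t0; rewrite -subr_ge0.
  have -> : (1 + t) * a ^+ 2 + (1 + t^-1) * b ^+ 2 - (a + b) ^+ 2 = (t * a - b) ^+ 2 / t.
    by field; rewrite gt_eqF.
  by rewrite divr_ge0 ?sqr_ge0 // ltW.
move=> t0; rewrite /nsq cReD cImD; have := L (Re x) (Re y) t0; have := L (Im x) (Im y) t0.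
move: (t^-1) => s; lra.
Qed.

Lemma frob2D_weighted m n (F G : 'M[C]_(m, n)) (t : R) : 0 < t ->
  frob2 (F + G) <= (1 + t) * frob2 F + (1 + t^-1) * frob2 G.
Proof.
move=> t0; rewrite /frob2 !mulr_sumr -big_split; apply: ler_sum => i _ /=.
rewrite !mulr_sumr -big_split; apply: ler_sum => j _ /=.
by rewrite mxE nsqD_weighted.
Qed.

Definition frob m n (F : 'M[C]_(m, n)) : R := Num.sqrt (frob2 F).

Lemma frob_ge0 m n (F : 'M[C]_(m, n)) : 0 <= frob F.
Proof. exact: sqrtr_ge0. Qed.

Lemma frob_sqr m n (F : 'M[C]_(m, n)) : frob F ^+ 2 = frob2 F.
Proof. by rewrite sqr_sqrtr // frob2_ge0. Qed.

Lemma frobD m n (F G : 'M[C]_(m, n)) : frob (F + G) <= frob F + frob G.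
Proof.
rewrite -(@ler_pXn2r _ 2) // ?nnegrE ?addr_ge0 ?frob_ge0 // frob_sqr.
apply: sqrD_weighted; rewrite ?frob_ge0 // => t t0; rewrite !frob_sqr.
exact: frob2D_weighted.
Qed.

Section SingularValues.
Variables (m n : nat) (F : 'M[C]_(m, n)).

Lemma gram_diagonalization : exists (P : 'M[C]_n) (d : 'rV[C]_n),
  [/\ P *m hct P = 1%:M, hct P *m P = 1%:M &
      hct F *m F = hct P *m diag_mx d *m P].
Proof.
set H := hct F *m F.
have Hn : H \is normalmx.
  have HH : hct H = H by rewrite /H hctM hctK.
  by apply/normalmxP; rewrite -map_trmx -/(hct H) HH.
have hctE : hct (spectralmx H) = map_mx Num.conj (spectralmx H)^T by rewrite /hct map_trmx.
have PhP : spectralmx H *m hct (spectralmx H) = 1%:M.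
  by rewrite hctE; apply/unitarymxP; exact: spectral_unitarymx.
exists (spectralmx H), (spectral_diag H); split=> //; first exact: mulmx1C PhP.
move/orthomx_spectralP: Hn => {1}->.
by rewrite hctE invmx_unitary ?spectral_unitarymx.
Qed.

(** Each eigenvalue of F^* F is the squared norm of the image under F of a unit
    vector, hence a nonnegative real number. *)
Lemma gram_eigenvalues : exists (P : 'M[C]_n) (e : 'I_n -> R),
  [/\ P *m hct P = 1%:M, hct P *m P = 1%:M, forall i, 0 <= e i &
      hct F *m F = hct P *m diag_mx (\row_i (e i)%:C) *m P].
Proof.
have [P [d [PhP hPP HE]]] := gram_diagonalization.
have e_row i : d 0 i = (frob2 (F *m hct (row i P)))%:C.
  have PHP : P *m (hct F *m F) *m hct P = diag_mx d.
    by rewrite HE !mulmxA PhP mul1mx -mulmxA PhP mulmx1.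
  rewrite frob2E hctM hctK -mulmxA [hct F *m _]mulmxA.
  rewrite /mxtrace big_ord1.
  have -> : (row i P *m (hct F *m F *m hct (row i P))) 0 0 = (P *m (hct F *m F) *m hct P) i i.
    rewrite -[RHS]/((_ *m _) i i) -[in RHS]mulmxA mxE [RHS]mxE; apply: eq_bigr => k _.
    rewrite mxE; congr (_ * _); rewrite mxE [RHS]mxE; apply: eq_bigr => l _.
    by rewrite !mxE.
  by rewrite PHP mxE eqxx.
exists P, (fun i => frob2 (F *m hct (row i P))).
split; [exact: PhP|exact: hPP|by move=> i; exact: frob2_ge0|].
rewrite HE; congr (_ *m diag_mx _ *m _).
by apply/rowP => i; rewrite mxE -e_row.
Qed.

Let sv := [set s | is_singular_value F s].

Lemma singular_valueP (P : 'M[C]_n) (e : 'I_n -> R) :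
  P *m hct P = 1%:M -> hct P *m P = 1%:M ->
  hct F *m F = hct P *m diag_mx (\row_i (e i)%:C) *m P ->
  forall s, is_singular_value F s <-> 0 <= s /\ exists i, s ^+ 2 = e i.
Proof.
move=> PhP hPP HE s; rewrite /is_singular_value -/(hct F) HE; split.
- case=> s0 /eigenvalueP [v vE v0]; split=> //.
  pose w := v *m hct P.
  have w0 : w != 0.
    by apply: contra_neq v0 => w0; rewrite -[v]mulmx1 -hPP mulmxA -/w w0 mul0mx.
  have [i wi] : exists i, w 0 i != 0.
    apply/existsP; move: w0; apply: contraNT; rewrite negb_exists => /forallP h.
    by apply/eqP/rowP => i; rewrite [RHS]mxE; apply/eqP/negPn/h.
  exists i; apply: (@complexI R); apply: (mulIf wi).
  have : w *m diag_mx (\row_i (e i)%:C) = (s ^+ 2)%:C *: w.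
    by rewrite /w scalemxAl -vE !mulmxA -[in RHS](mulmxA _ P) PhP mulmx1.
  move=> /(congr1 (fun x : 'rV[C]_n => x 0 i)); rewrite [RHS]mxE => <-.
  rewrite mul_mx_diag !mxE mulrC; congr (_ * _).
- case=> s0 [i si]; split=> //; apply/eigenvalueP; exists (row i P).
    rewrite -row_mul !mulmxA PhP mul1mx row_mul row_diag_mx -scalemxAl -rowE mxE si.
    by [].
  apply: contraTneq (oner_neq0 C) => ri.
  have := congr1 (fun X : 'M[C]_n => X i i) PhP; rewrite !mxE eqxx mulr1n => <-.
  rewrite big1 ?eqxx // => k _.
  by have := congr1 (fun X : 'rV[C]_n => X 0 k) ri; rewrite !mxE => ->; rewrite mul0r.
Qed.

Lemma sigma_max_ge0 : 0 <= sigma_max F.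
Proof.
rewrite /sigma_max; have [sv0|] := pselect (sv !=set0); last first.
  by move=> /nonemptyPn; rewrite /sv => ->; rewrite sup0.
have [P [e [PhP hPP e0 HE]]] := gram_eigenvalues.
have [s [s0 es]] := sv0.
apply: le_trans (s0) _; apply: ub_le_sup => //.
exists (Num.sqrt (\sum_i e i)) => t /(singular_valueP PhP hPP HE) [t0 [i ti]].
rewrite -(ler_sqr (x := t)) ?nnegrE ?sqrtr_ge0 // sqr_sqrtr ?sumr_ge0 //.
by rewrite ti (bigD1 i) //= lerDl sumr_ge0.
Qed.

Lemma sigma_max_eigen (P : 'M[C]_n) (e : 'I_n -> R) :
  P *m hct P = 1%:M -> hct P *m P = 1%:M -> (forall i, 0 <= e i) ->
  hct F *m F = hct P *m diag_mx (\row_i (e i)%:C) *m P ->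
  (forall i, e i <= sigma_max F ^+ 2) /\ sigma_max F ^+ 2 <= \sum_i e i.
Proof.
move=> PhP hPP e0 HE; have svP := singular_valueP PhP hPP HE.
have ub t : is_singular_value F t -> t <= Num.sqrt (\sum_i e i).
  move=> /svP [t0 [i ti]].
  rewrite -(ler_sqr (x := t)) ?nnegrE ?sqrtr_ge0 // sqr_sqrtr ?sumr_ge0 //.
  by rewrite ti (bigD1 i) //= lerDl sumr_ge0.
split.
- move=> i; rewrite -(sqr_sqrtr (e0 i)) ler_sqr ?nnegrE ?sqrtr_ge0 ?sigma_max_ge0 //.
  apply: ub_le_sup; first by exists (Num.sqrt (\sum_i e i)) => t /ub.
  by apply/svP; rewrite sqrtr_ge0; split=> //; exists i; rewrite sqr_sqrtr.
- rewrite -[leRHS]sqr_sqrtr ?sumr_ge0 // ler_sqr ?nnegrE ?sqrtr_ge0 ?sigma_max_ge0 //.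
  rewrite /sigma_max; have [sv0|] := pselect (sv !=set0); last first.
    by move=> /nonemptyPn; rewrite /sv => ->; rewrite sup0 sqrtr_ge0.
  by apply: ge_sup => // t /ub.
Qed.

(** In an orthonormal basis of eigenvectors of F^* F, the squared norm of F B is a
    sum of eigenvalues times squared norms of the rows of B. *)
Lemma frob2_mulmx_sigma p (B : 'M[C]_(n, p)) :
  frob2 (F *m B) <= sigma_max F ^+ 2 * frob2 B.
Proof.
have [P [e [PhP hPP e0 HE]]] := gram_eigenvalues.
have [es _] := sigma_max_eigen PhP hPP e0 HE.
have EF : frob2 (F *m B) = \sum_i e i * \sum_j nsq ((P *m B) i j).
  apply: (@complexI R); rewrite frob2E hctM mulmxA -[_ *m hct F *m F]mulmxA HE.
  rewrite !mulmxA -hctM -mulmxA mxtrace_mulC mulmxA mul_mx_diag.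
  rewrite /mxtrace rmorph_sum; apply: eq_bigr => i _.
  rewrite rmorphM /= rmorph_sum !mxE mulrC; congr (_ * _); apply: eq_bigr => j _.
  by rewrite /= nsqE [in RHS]mxE [hct _ _ _]mxE !mxE.
have EB : frob2 B = \sum_i \sum_j nsq ((P *m B) i j).
  apply: (@complexI R); rewrite -/(frob2 (P *m B)) !frob2E hctM mulmxA.
  by rewrite -[_ *m hct P *m P]mulmxA hPP mulmx1.
rewrite EF EB mulr_sumr; apply: ler_sum => i _.
by apply: ler_wpM2r (es i); apply: sumr_ge0 => j _; exact: nsq_ge0.
Qed.

Lemma sigma_max_le_frob2 : sigma_max F ^+ 2 <= frob2 F.
Proof.
have [P [e [PhP hPP e0 HE]]] := gram_eigenvalues.
have [_ /le_trans] := sigma_max_eigen PhP hPP e0 HE; apply.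
rewrite -lecR frob2E HE mxtrace_mulC mulmxA PhP mul1mx mxtrace_diag rmorph_sum.
by rewrite le_eqVlt; apply/orP; left; apply/eqP/eq_bigr => i _; rewrite mxE.
Qed.

Lemma frob_mulmx_sigmal p (B : 'M[C]_(n, p)) :
  frob (F *m B) <= sigma_max F * frob B.
Proof.
rewrite -(@ler_pXn2r _ 2) // ?nnegrE ?mulr_ge0 ?frob_ge0 ?sigma_max_ge0 //.
by rewrite exprMn !frob_sqr frob2_mulmx_sigma.
Qed.

(** The Cauchy-Schwarz inequality, in the weighted form that needs no root. *)
Lemma frob_inner_le p q (X Y : 'M[C]_(p, q)) (t : R) : 0 < t ->
  2 * Re (\tr (hct X *m Y)) <= t * frob2 X + t^-1 * frob2 Y.
Proof.
move=> t0; have -> : \tr (hct X *m Y) = \sum_i \sum_j conjc (X i j) * Y i j.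
  rewrite exchange_big; apply: eq_bigr => j _; rewrite mxE; apply: eq_bigr => i _.
  by rewrite !mxE.
rewrite Re_sum !mulr_sumr -big_split /=; apply: ler_sum => i _.
rewrite Re_sum !mulr_sumr -big_split /=; apply: ler_sum => j _.
rewrite cReM cReJ cImJ /nsq; move: (Re (X i j)) (Im (X i j)) (Re (Y i j)) (Im (Y i j)) => a b c d.
rewrite -subr_ge0.
have -> : t * (a ^+ 2 + b ^+ 2) + t^-1 * (c ^+ 2 + d ^+ 2) - 2 * (a * c - - b * d) =
   ((t * a - c) ^+ 2 + (t * b - d) ^+ 2) / t by field; rewrite gt_eqF.
by rewrite divr_ge0 ?(ltW t0) // addr_ge0 ?sqr_ge0.
Qed.

(** With D = (B F)^*, one has |D|^2 = Re tr (B F D) <= |B| |F D|, hence the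
    bound for multiplication on the other side. *)
Lemma frob_mulmx_sigmar p (B : 'M[C]_(p, m)) :
  frob (B *m F) <= sigma_max F * frob B.
Proof.
pose D := hct (B *m F); pose s := sigma_max F ^+ 2.
have key t : 0 < t -> 2 * frob2 (B *m F) <= t * frob2 B + t^-1 * frob2 (F *m D).
  move=> t0; have := frob_inner_le (hct B) (F *m D) t0.
  by rewrite hctK mulmxA -{1}[B *m F]hctK -/D -frob2E /= !frob2_hct.
rewrite -(@ler_pXn2r _ 2) // ?nnegrE ?mulr_ge0 ?frob_ge0 ?sigma_max_ge0 //.
rewrite exprMn !frob_sqr -/s; apply/ler_addgt0Pr => e e0.
have b1 : 0 < frob2 B + 1 by rewrite ltr_wpDl ?frob2_ge0.
have s0 : 0 <= s by exact: sqr_ge0.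
(* the optimal weight s may vanish, so it is slightly enlarged *)
have t0 : 0 < s + e / (frob2 B + 1) by rewrite ltr_wpDl // divr_gt0.
have h1 := key _ t0; have h2 := frob2_mulmx_sigma D.
have h3 : (s + e / (frob2 B + 1))^-1 * frob2 (F *m D) <= frob2 (B *m F).
  rewrite ler_pdivrMl //; apply: le_trans h2 _; rewrite frob2_hct -/s.
  by rewrite ler_wpM2r ?frob2_ge0 // lerDl divr_ge0 // ltW.
have h4 : (s + e / (frob2 B + 1)) * frob2 B <= s * frob2 B + e.
  rewrite mulrDl lerD2l mulrAC ler_pdivrMr // ler_wpM2l ?(ltW e0) //.
  by rewrite lerDl.
move: h1 h3 h4; move: (_ * frob2 B) (_ * frob2 (F *m D)) (s * _) (frob2 _) => x y z w; lra.
Qed.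

End SingularValues.
End FrobeniusAndSigma.

(** * Evaluation of rational functions at complex points *)

Section Evaluation.
Variable R : realType.
Notation C := R[i].
Notation tofrac := (@FracField.tofrac {poly R}).
Notation RF := (ratfun R).
Notation pC := (map_poly (@toC R)).
Implicit Types (f g : RF) (a b : {poly R}) (s : C).

Lemma pCE : pC = map_poly (real_complex R). Proof. by []. Qed.
Lemma pCM a b : pC (a * b) = pC a * pC b.
Proof. by rewrite pCE rmorphM. Qed.
Lemma pCD a b : pC (a + b) = pC a + pC b.
Proof. by rewrite pCE rmorphD. Qed.
Lemma pC1 : pC 1 = 1. Proof. by rewrite pCE rmorph1. Qed.
Lemma pC_eq0 a : (pC a == 0) = (a == 0).
Proof. by rewrite pCE map_poly_eq0. Qed.
Lemma size_pC a : size (pC a) = size a.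
Proof. by rewrite pCE size_map_poly. Qed.

Lemma ratfun_repr f : (frac (repr f)).2 != 0 /\
  f = tofrac (frac (repr f)).1 / tofrac (frac (repr f)).2.
Proof.
set x := repr f; have d0 : (frac x).2 != 0 by exact: denom_ratioP.
split=> //; apply: (canRL (mulfK _)); first by rewrite tofrac_eq0.
rewrite -[f]reprK -/x; unlock FracField.tofrac.
rewrite -[LHS]FracField.pi_mul; apply/eqP; rewrite FracField.equivf_def.
by rewrite /FracField.mulf /= !numden_Ratio ?(oner_neq0, mulf_neq0, mulr1) // mulrC.
Qed.

Lemma rnum_rden f : [/\ rden f != 0, f = tofrac (rnum f) / tofrac (rden f) &
  coprimep (rnum f) (rden f)].
Proof.
have [d0 fE] := ratfun_repr f.
rewrite /rnum /rden; set p := (frac (repr f)).1 in fE *; set q := (frac (repr f)).2 in d0 fE *.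
set g := gcdp p q.
have g0 : g != 0 by rewrite /g gcdp_eq0 negb_and d0 orbT.
have pE : p = p %/ g * g by rewrite divpK // dvdp_gcdl.
have qE : q = q %/ g * g by rewrite divpK // dvdp_gcdr.
have dg : q %/ g != 0 by apply: contra_neq d0 => h; rewrite qE h mul0r.
split=> //.
- rewrite fE {1}pE {1}qE !rmorphM /= invfM mulrACA divff ?mulr1 //.
  by rewrite tofrac_eq0.
- by rewrite coprimep_div_gcd // d0 orbT.
Qed.

Lemma eq_frac a b c d : b != 0 -> d != 0 ->
  tofrac a / tofrac b = tofrac c / tofrac d -> a * d = c * b.
Proof.
move=> b0 d0 /eqP; rewrite eqr_div ?tofrac_eq0 // -!rmorphM /= tofrac_eq.
by move/eqP.
Qed.

Definition regular s f := ~~ is_pole f s.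

(** Evaluation may be computed from any representative whose denominator does
    not vanish: by coprimality the reduced one does not vanish either. *)
Lemma reval_frac a b s f : (pC b).[s] != 0 -> f = tofrac a / tofrac b ->
  regular s f /\ reval f s = (pC a).[s] / (pC b).[s].
Proof.
move=> bs fE; have [d0 rE cop] := rnum_rden f.
have b0 : b != 0 by apply: contra_neq bs => ->; rewrite pCE rmorph0 horner0.
have E : rnum f * b = a * rden f by apply: eq_frac => //; rewrite -rE.
have Es : (pC (rnum f)).[s] * (pC b).[s] = (pC a).[s] * (pC (rden f)).[s].
  by rewrite -!hornerM -!pCM E.
have ds : (pC (rden f)).[s] != 0.
  apply/negP => /eqP h; move: Es; rewrite h mulr0 => /eqP.
  rewrite mulf_eq0 (negbTE bs) orbF => /eqP ns.
  have /Bezout_coprimepP [[u v] /= /eqpP [[k1 k2] /= /andP[k10 k20] uv]] := cop.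
  have := congr1 (fun p => (pC p).[s]) uv.
  rewrite -!mul_polyC !pCM pCD !pCM !hornerM hornerD !hornerM ns h !mulr0 addr0 mulr0.
  rewrite pC1 hornerC mulr1 pCE map_polyC hornerC /= => /esym /eqP.
  by rewrite fmorph_eq0 (negbTE k20).
by split=> //; apply/eqP; rewrite eqr_div // Es.
Qed.

Lemma regularP s f : regular s f -> exists a b, (pC b).[s] != 0 /\ f = tofrac a / tofrac b.
Proof. by move=> h; exists (rnum f), (rden f); have [] := rnum_rden f. Qed.

Lemma reval_tofrac a s : regular s (tofrac a) /\ reval (tofrac a) s = (pC a).[s].
Proof.
have h1 : (pC 1).[s] != 0 by rewrite pC1 hornerC oner_neq0.
have h2 : tofrac a = tofrac a / tofrac 1 by rewrite rmorph1 divr1.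
have [h3 ->] := reval_frac h1 h2; split=> //.
by rewrite pC1 hornerC divr1.
Qed.

Lemma revalD s f g : regular s f -> regular s g ->
  regular s (f + g) /\ reval (f + g) s = reval f s + reval g s.
Proof.
move=> /regularP [a [b [b0 fE]]] /regularP [c [d [d0 gE]]].
have [_ ->] := reval_frac b0 fE; have [_ ->] := reval_frac d0 gE.
rewrite addf_div // -!hornerM -!pCM -hornerD -pCD.
apply: reval_frac; first by rewrite pCM hornerM mulf_neq0.
have bn : b != 0 by apply: contra_neq b0 => ->; rewrite pCE rmorph0 horner0.
have dn : d != 0 by apply: contra_neq d0 => ->; rewrite pCE rmorph0 horner0.
by rewrite fE gE addf_div ?tofrac_eq0 // -!rmorphM -rmorphD.
Qed.

Lemma revalM s f g : regular s f -> regular s g ->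
  regular s (f * g) /\ reval (f * g) s = reval f s * reval g s.
Proof.
move=> /regularP [a [b [b0 fE]]] /regularP [c [d [d0 gE]]].
have [_ ->] := reval_frac b0 fE; have [_ ->] := reval_frac d0 gE.
rewrite mulf_div -!hornerM -!pCM.
apply: reval_frac; first by rewrite pCM hornerM mulf_neq0.
by rewrite fE gE mulf_div -!rmorphM.
Qed.

Lemma revalV s f : regular s f -> reval f s != 0 ->
  regular s f^-1 /\ reval f^-1 s = (reval f s)^-1.
Proof.
move=> /regularP [a [b [b0 fE]]]; have [_ ->] := reval_frac b0 fE.
rewrite mulf_eq0 negb_or => /andP[a0 _]; rewrite invf_div.
by apply: reval_frac => //; rewrite fE invf_div.
Qed.

Lemma reval_cst s (x : R) : regular s (cst_rat x) /\ reval (cst_rat x) s = x%:C.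
Proof.
have [h ->] := reval_tofrac x%:P s; split=> //.
by rewrite pCE map_polyC hornerC.
Qed.

Lemma reval_X s : regular s (tofrac 'X) /\ reval (tofrac 'X) s = s.
Proof.
have [h ->] := reval_tofrac 'X s; split=> //.
by rewrite pCE map_polyX hornerX.
Qed.

Lemma cst_rat0 : cst_rat 0 = 0 :> RF. Proof. by rewrite /cst_rat !rmorph0. Qed.
Lemma cst_rat1 : cst_rat 1 = 1 :> RF. Proof. by rewrite /cst_rat !rmorph1. Qed.

Lemma reval0 s : regular s 0 /\ reval 0 s = 0.
Proof. by rewrite -cst_rat0; have := reval_cst s 0. Qed.
Lemma reval1 s : regular s 1 /\ reval 1 s = 1.
Proof. by rewrite -cst_rat1; have := reval_cst s 1. Qed.

Lemma revalN s f : regular s f -> regular s (- f) /\ reval (- f) s = - reval f s.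
Proof.
move=> hf; have [h1 h2] := reval_cst s (-1).
have [h3 h4] := revalM h1 hf.
have E : cst_rat (-1) * f = - f by rewrite /cst_rat !rmorphN !rmorph1 mulN1r.
by rewrite -E; split=> //; rewrite h4 h2 rmorphN rmorph1 mulN1r.
Qed.

Lemma reval_sum s (I : Type) (r : seq I) (F : I -> RF) :
  (forall i, regular s (F i)) ->
  regular s (\sum_(i <- r) F i) /\
  reval (\sum_(i <- r) F i) s = \sum_(i <- r) reval (F i) s.
Proof.
move=> hF; elim: r => [|i r [h1 h2]]; first by rewrite !big_nil; exact: reval0.
by rewrite !big_cons -h2; exact: revalD.
Qed.

Lemma reval_prod s (I : Type) (r : seq I) (F : I -> RF) :
  (forall i, regular s (F i)) ->
  regular s (\prod_(i <- r) F i) /\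
  reval (\prod_(i <- r) F i) s = \prod_(i <- r) reval (F i) s.
Proof.
move=> hF; elim: r => [|i r [h1 h2]]; first by rewrite !big_nil; exact: reval1.
by rewrite !big_cons -h2; exact: revalM.
Qed.

Definition mregular s m n (F : 'M[RF]_(m, n)) := forall i j, regular s (F i j).
Definition meval s m n (F : 'M[RF]_(m, n)) : 'M[C]_(m, n) :=
  map_mx (fun f => reval f s) F.

Lemma mregularD s m n (F G : 'M[RF]_(m, n)) : mregular s F -> mregular s G ->
  mregular s (F + G).
Proof. by move=> hF hG i j; rewrite mxE; case: (revalD (hF i j) (hG i j)). Qed.

Lemma mevalD s m n (F G : 'M[RF]_(m, n)) : mregular s F -> mregular s G ->
  meval s (F + G) = meval s F + meval s G.
Proof.
by move=> hF hG; apply/matrixP => i j; rewrite !mxE; case: (revalD (hF i j) (hG i j)).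
Qed.

Lemma mregularN s m n (F : 'M[RF]_(m, n)) : mregular s F -> mregular s (- F).
Proof. by move=> hF i j; rewrite mxE; case: (revalN (hF i j)). Qed.

Lemma mevalN s m n (F : 'M[RF]_(m, n)) : mregular s F ->
  meval s (- F) = - meval s F.
Proof. by move=> hF; apply/matrixP => i j; rewrite !mxE; case: (revalN (hF i j)). Qed.

Lemma mregularM s m n p (F : 'M[RF]_(m, n)) (G : 'M[RF]_(n, p)) :
  mregular s F -> mregular s G -> mregular s (F *m G).
Proof.
move=> hF hG i j; rewrite mxE.
by case: (@reval_sum s _ (index_enum _) (fun k => F i k * G k j)) => // k;
  case: (revalM (hF i k) (hG k j)).
Qed.

Lemma mevalM s m n p (F : 'M[RF]_(m, n)) (G : 'M[RF]_(n, p)) :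
  mregular s F -> mregular s G -> meval s (F *m G) = meval s F *m meval s G.
Proof.
move=> hF hG; apply/matrixP => i j; rewrite !mxE.
have hk k : regular s (F i k * G k j) by case: (revalM (hF i k) (hG k j)).
have [_ ->] := reval_sum (index_enum 'I_n) hk.
by apply: eq_bigr => k _; rewrite !mxE; case: (revalM (hF i k) (hG k j)).
Qed.

Lemma mregular1 s n : mregular s (1%:M : 'M[RF]_n).
Proof. by move=> i j; rewrite mxE; case: (i == j) => /=; [case: (reval1 s)|case: (reval0 s)]. Qed.

Lemma meval1 s n : meval s (1%:M : 'M[RF]_n) = 1%:M.
Proof.
apply/matrixP => i j; rewrite !mxE; case: (i == j) => /=.
  by case: (reval1 s) => _ ->.
by case: (reval0 s) => _ ->.
Qed.

Definition cstmx m n (A : 'M[R]_(m, n)) : 'M[RF]_(m, n) := map_mx (@cst_rat R) A.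

Lemma cstmxM m n p (A : 'M[R]_(m, n)) (B : 'M[R]_(n, p)) :
  cstmx (A *m B) = cstmx A *m cstmx B.
Proof. exact: (map_mxM (tofrac \o polyC)). Qed.

Lemma cstmxD m n (A B : 'M[R]_(m, n)) : cstmx (A + B) = cstmx A + cstmx B.
Proof. exact: (map_mxD (tofrac \o polyC)). Qed.

Lemma cstmxN m n (A : 'M[R]_(m, n)) : cstmx (- A) = - cstmx A.
Proof. exact: (map_mxN (tofrac \o polyC)). Qed.

Lemma cstmx1 n : cstmx (1%:M : 'M[R]_n) = 1%:M.
Proof. exact: (map_mx1 (tofrac \o polyC)). Qed.

Lemma mregular_cst s m n (A : 'M[R]_(m, n)) : mregular s (cstmx A).
Proof. by move=> i j; rewrite mxE; case: (reval_cst s (A i j)). Qed.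

Lemma meval_cst s m n (A : 'M[R]_(m, n)) : meval s (cstmx A) = cmx A.
Proof. by apply/matrixP => i j; rewrite !mxE; case: (reval_cst s (A i j)). Qed.

Lemma reval_det s n (F : 'M[RF]_n) : mregular s F ->
  regular s (\det F) /\ reval (\det F) s = \det (meval s F).
Proof.
move=> hF; rewrite /determinant.
have hp (t : 'S_n) := reval_prod (index_enum 'I_n) (fun i => hF i (t i)).
have hs (t : 'S_n) : regular s ((-1) ^+ t : RF) /\ reval ((-1) ^+ t : RF) s = (-1) ^+ t.
  case: (t : bool); rewrite ?expr1 ?expr0; last exact: reval1.
  by have [h1 h2] := reval1 s; have [h3 h4] := revalN h1; split=> //; rewrite h4 h2.
have ht (t : 'S_n) := revalM (hs t).1 (hp t).1.
have [h1 h2] := reval_sum (index_enum 'S_n) (fun t => (ht t).1).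
split=> //; rewrite h2; apply: eq_bigr => t _; rewrite (ht t).2 (hs t).2 (hp t).2.
by congr (_ * _); apply: eq_bigr => i _; rewrite mxE.
Qed.

(** By Cramer's rule only the determinant is inverted. *)
Lemma mregular_invmx s n (F : 'M[RF]_n) : mregular s F -> meval s F \in unitmx ->
  F \in unitmx /\ mregular s (invmx F).
Proof.
move=> hF; rewrite unitmxE unitfE => h; have [hd hdE] := reval_det hF.
have d0 : reval (\det F) s != 0 by rewrite hdE.
have uF : F \in unitmx.
  rewrite unitmxE unitfE; apply: contra_neq d0 => ->; by case: (reval0 s).
split=> // i j; rewrite /invmx uF !mxE.
have [h1 _] := revalV hd d0; have h2 : regular s (cofactor F j i).
  rewrite /cofactor; have hF' : mregular s (row' j (col' i F)).
    by move=> k l; rewrite !mxE.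
  have [h3 _] := reval_det hF'.
  have h4 : regular s ((-1) ^+ (j + i) : RF).
    elim: (j + i)%N => [|k IH]; first by rewrite expr0; case: (reval1 s).
    rewrite exprS; case: (revalM (revalN (reval1 s).1).1 IH) => //.
  by case: (revalM h4 h3).
by case: (revalM h1 h2).
Qed.

Lemma meval_invmx s n (F : 'M[RF]_n) : mregular s F -> meval s F \in unitmx ->
  meval s (invmx F) = invmx (meval s F).
Proof.
move=> hF u; have [uF hi] := mregular_invmx hF u.
have := congr1 (meval s (n := n)) (mulmxV uF); rewrite mevalM // meval1 => E.
by rewrite -[LHS]mul1mx -(mulVmx u) -mulmxA E mulmx1.
Qed.

End Evaluation.

(** * Strictly proper transfer matrices and the closed loop *)

Section StrictlyProper.
Variable R : realType.
Notation C := R[i].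
Notation Re := (@complex.Re R).
Notation tofrac := (@FracField.tofrac {poly R}).
Notation RF := (ratfun R).
Notation pC := (map_poly (@toC R)).

(** Existence of some strictly proper representative; unlike a condition on the
    reduced fraction it is obviously stable under the ring operations. *)
Definition sproper (f : RF) := exists a b : {poly R},
  [/\ b != 0, (size a < size b)%N & f = tofrac a / tofrac b].

Lemma sproper0 : sproper 0.
Proof.
by exists 0, 1; rewrite oner_neq0 size_poly0 size_poly1 rmorph0 mul0r.
Qed.

Lemma sproperD f g : sproper f -> sproper g -> sproper (f + g).
Proof.
move=> [a [b [b0 sab ->]]] [c [d [d0 scd ->]]].
exists (a * d + c * b), (b * d); split; first by rewrite mulf_neq0.
- have := b0; have := d0; rewrite -!size_poly_gt0 => d1 b1.
  apply: leq_ltn_trans (size_polyD _ _) _.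
  have L (x y z : nat) : (x < y -> 0 < z -> (x + z).-1 < (y + z).-1)%N by lia.
  rewrite (size_mul b0 d0) gtn_max; apply/andP; split;
    apply: leq_ltn_trans (size_polyMleq _ _) _; first exact: L.
  by rewrite addnC [X in (_ < X.-1)%N]addnC addnC; exact: L.
- by rewrite addf_div ?tofrac_eq0 // -!rmorphM -rmorphD.
Qed.

Lemma sproper_cstM (x : R) f : sproper f -> sproper (cst_rat x * f).
Proof.
move=> [a [b [b0 sab ->]]]; exists (x *: a), b; split=> //.
  exact: leq_ltn_trans (size_scale_leq _ _) _.
by rewrite -mul_polyC rmorphM mulrA.
Qed.

Lemma sproperN f : sproper f -> sproper (- f).
Proof.
move=> [a [b [b0 sab ->]]]; exists (- a), b; split; rewrite ?size_polyN //.
by rewrite rmorphN mulNr.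
Qed.

Lemma sproper_sum (I : Type) (r : seq I) (F : I -> RF) :
  (forall i, sproper (F i)) -> sproper (\sum_(i <- r) F i).
Proof.
by move=> h; elim/big_rec: _ => [|i f _ hf]; [exact: sproper0|exact: sproperD].
Qed.

Lemma sproper_size f : sproper f -> (size (rnum f) < size (rden f))%N.
Proof.
move=> [a [b [b0 sab fE]]]; have [d0 rE _] := rnum_rden f.
have [->|n0] := eqVneq (rnum f) 0; first by rewrite size_poly0 size_poly_gt0.
have E : rnum f * b = a * rden f by apply: eq_frac => //; rewrite -rE.
have a0 : a != 0.
  by apply: contra_neq n0 => a0; move/eqP: E; rewrite a0 mul0r mulf_eq0 (negbTE b0) orbF => /eqP.
have L (x y z t : nat) : (0 < x -> 0 < y -> 0 < t ->
   (t + y).-1 = (z + x).-1 -> z < y -> t < x)%N by lia.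
have := congr1 (fun p : {poly R} => size p) E; rewrite !size_mul //.
by move=> h; apply: L h sab; rewrite size_poly_gt0.
Qed.

Lemma sproper_proper f : sproper f -> Defs.proper f.
Proof. by move=> /sproper_size /ltnW. Qed.

Lemma proper_1D f : sproper f -> Defs.proper (1 + f).
Proof.
move=> [a [b [b0 sab fE]]]; rewrite /Defs.proper; have [d0 rE _] := rnum_rden (1 + f).
have b0' : tofrac b != 0 by rewrite tofrac_eq0.
have E : rnum (1 + f) * b = (b + a) * rden (1 + f).
  apply: eq_frac => //; rewrite -rE fE rmorphD mulrDl divff //.
have sba : size (b + a) = size b by rewrite size_polyDl.
have ba0 : b + a != 0 by rewrite -size_poly_gt0 sba size_poly_gt0.
have := congr1 (fun p : {poly R} => size p) E.
have [->|n0] := eqVneq (rnum (1 + f)) 0; first by rewrite size_poly0.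
have L (x y t : nat) : (0 < x -> 0 < y -> 0 < t ->
   (t + y).-1 = (y + x).-1 -> t <= x)%N by lia.
rewrite !size_mul // sba => h; apply: L h; by rewrite size_poly_gt0.
Qed.

Lemma hurwitz_rden f : (forall s : C, is_pole f s -> Re s < 0) -> hurwitz_poly (pC (rden f)).
Proof. by move=> h; have [d0 _ _] := rnum_rden f; split; rewrite ?pC_eq0. Qed.

Section StableEntry.
Variable f : RF.
Hypotheses (sf : sproper f) (hf : forall s : C, is_pole f s -> Re s < 0).

Let size_pC_lt : (size (pC (rnum f)) < size (pC (rden f)))%N.
Proof. by rewrite !size_pC sproper_size. Qed.

Lemma stable_ccont : ccont (fun w => reval f (w *i)).
Proof.
apply: ccontM; first exact: ccont_horner.
apply: ccontV; first exact: ccont_horner.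
by move=> w; apply: hurwitz_poly_neq0 (hurwitz_rden hf) _.
Qed.

Lemma stable_bound : exists2 c : R, 0 <= c &
  forall w, nsq (reval f (w *i)) <= c / (1 + w ^+ 2).
Proof. exact: bound_hurwitz (hurwitz_rden hf) size_pC_lt. Qed.

Lemma stable_poisson s : 0 < Re s ->
  PV (fun w => reval f (w *i) * (poisson s w)%:C) ((2 * pi : R)%:C * reval f s).
Proof. exact: PV_poisson_frac (hurwitz_rden hf) size_pC_lt. Qed.

End StableEntry.

Definition msproper m n (F : 'M[RF]_(m, n)) := forall i j, sproper (F i j).

Lemma msproperD m n (F G : 'M[RF]_(m, n)) : msproper F -> msproper G -> msproper (F + G).
Proof. by move=> hF hG i j; rewrite mxE; exact: sproperD. Qed.

Lemma msproperN m n (F : 'M[RF]_(m, n)) : msproper F -> msproper (- F).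
Proof. by move=> hF i j; rewrite mxE; exact: sproperN. Qed.

Lemma msproper_cstMl m n p (A : 'M[R]_(m, n)) (F : 'M[RF]_(n, p)) :
  msproper F -> msproper (cstmx A *m F).
Proof.
by move=> hF i j; rewrite mxE; apply: sproper_sum => k; rewrite mxE; exact: sproper_cstM.
Qed.

Lemma msproper_cstMr m n p (F : 'M[RF]_(m, n)) (A : 'M[R]_(n, p)) :
  msproper F -> msproper (F *m cstmx A).
Proof.
by move=> hF i j; rewrite mxE; apply: sproper_sum => k; rewrite mxE mulrC; exact: sproper_cstM.
Qed.

End StrictlyProper.

Section Transfer.
Variable R : realType.
Notation Re := (@complex.Re R).
Notation tofrac := (@FracField.tofrac {poly R}).
Notation RF := (ratfun R).

Definition ratX n (M : 'M[R]_n) : 'M[RF]_n := (tofrac 'X)%:M - cstmx M.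
(** The resolvent as a matrix of rational functions; its value at s is the
    [resolvent] above when s is not an eigenvalue. *)
Definition ratres n (M : 'M[R]_n) : 'M[RF]_n := invmx (ratX M).

Lemma transferE n m p (A : 'M[R]_n) (B : 'M[R]_(n, m)) (Cc : 'M[R]_(p, n)) :
  transfer A B Cc = cstmx Cc *m ratres A *m cstmx B.
Proof. by []. Qed.

Lemma ratX_char n (M : 'M[R]_n) : ratX M = map_mx tofrac (char_poly_mx M).
Proof.
rewrite /ratX /char_poly_mx map_mxB; congr (_ - _); last first.
  by apply/matrixP => i j; rewrite !mxE.
by rewrite map_scalar_mx.
Qed.

Lemma det_ratX n (M : 'M[R]_n) : \det (ratX M) = tofrac (char_poly M).
Proof. by rewrite ratX_char det_map_mx. Qed.

Lemma ratX_unit n (M : 'M[R]_n) : ratX M \in unitmx.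
Proof.
by rewrite unitmxE unitfE det_ratX tofrac_eq0 monic_neq0 ?char_poly_monic.
Qed.

Lemma ratX_ratres n (M : 'M[R]_n) : ratX M *m ratres M = 1%:M.
Proof. exact: mulmxV (ratX_unit M). Qed.
Lemma ratres_ratX n (M : 'M[R]_n) : ratres M *m ratX M = 1%:M.
Proof. exact: mulVmx (ratX_unit M). Qed.

Lemma msproper_ratres n (M : 'M[R]_n) : msproper (ratres M).
Proof.
move=> i j; exists (\adj (char_poly_mx M) i j), (char_poly M); split.
- by rewrite monic_neq0 ?char_poly_monic.
- by rewrite size_char_poly ltnS; case: (adj_char_poly_mx M i j).
- rewrite /ratres /invmx ratX_unit mxE det_ratX mulrC; congr (_ / _).
  by rewrite ratX_char -map_mx_adj mxE.
Qed.

Lemma msproper_transfer n m p (A : 'M[R]_n) (B : 'M[R]_(n, m)) (Cc : 'M[R]_(p, n)) :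
  msproper (transfer A B Cc).
Proof.
by rewrite transferE; apply: msproper_cstMr; apply: msproper_cstMl; exact: msproper_ratres.
Qed.

Lemma mregular_scalar s n (f : RF) : regular s f -> mregular s (f%:M : 'M[RF]_n).
Proof.
by move=> h i j; rewrite mxE; case: (i == j); rewrite ?mulr1n ?mulr0n //; case: (reval0 s).
Qed.

Lemma mregular_ratX s n (M : 'M[R]_n) : mregular s (ratX M).
Proof.
apply: mregularD; first by apply: mregular_scalar; case: (reval_X s).
by apply: mregularN; exact: mregular_cst.
Qed.

Lemma meval_ratX s n (M : 'M[R]_n) : meval s (ratX M) = s%:M - cmx M.
Proof.
rewrite /ratX mevalD; last 2 first.
- by apply: mregular_scalar; case: (reval_X s).
- by apply: mregularN; exact: mregular_cst.
rewrite mevalN ?meval_cst; last exact: mregular_cst.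
congr (_ - _); apply/matrixP => i j; rewrite !mxE; case: (i == j); rewrite ?mulr1n ?mulr0n.
  by case: (reval_X s).
by case: (reval0 s).
Qed.

Section HurwitzTransfer.
Variables (n m p : nat) (M : 'M[R]_n) (B : 'M[R]_(n, m)) (Cc : 'M[R]_(p, n)).
Hypothesis hM : hurwitz M.

Lemma mregular_ratres s : 0 <= Re s -> mregular s (ratres M).
Proof.
move=> s0; apply: (mregular_invmx (mregular_ratX s M) _).2.
by rewrite meval_ratX; exact: resolvent_unit.
Qed.

Lemma meval_ratres s : 0 <= Re s -> meval s (ratres M) = resolvent M s.
Proof.
move=> s0; rewrite /ratres meval_invmx ?meval_ratX //; first exact: mregular_ratX.
exact: resolvent_unit.
Qed.

Lemma mregular_transfer s : 0 <= Re s -> mregular s (transfer M B Cc).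
Proof.
move=> s0; rewrite transferE; apply: mregularM; last exact: mregular_cst.
by apply: mregularM; [exact: mregular_cst|exact: mregular_ratres].
Qed.

Lemma meval_transfer s : 0 <= Re s ->
  meval s (transfer M B Cc) = cmx Cc *m resolvent M s *m cmx B.
Proof.
move=> s0; have h := mregular_ratres s0.
rewrite transferE !mevalM ?meval_cst ?meval_ratres //; do ?exact: mregular_cst.
by apply: mregularM => //; exact: mregular_cst.
Qed.

End HurwitzTransfer.

(** Each block of the resolvent of the closed-loop matrix is obtained by
    substituting one state equation into the other. *)
Section ClosedLoop.
Variables (n m p q : nat) (A : 'M[R]_n) (B : 'M[R]_(n, m)) (Cc : 'M[R]_(p, n)).
Variables (AK : 'M[R]_q) (BK : 'M[R]_(q, p)) (CK : 'M[R]_(m, q)).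

Definition closed_loop_mx := block_mx A (B *m CK) (BK *m Cc) AK.
Definition outG : 'M[R]_(p, n + q) := row_mx Cc 0.
Definition outK : 'M[R]_(m, n + q) := row_mx 0 CK.
Definition inG : 'M[R]_(n + q, m) := col_mx B 0.
Definition inK : 'M[R]_(n + q, p) := col_mx 0 BK.

(** The closed-loop transfer matrices are defined from the state space and are
    named after the products that they turn out to be: X = (I - GK)^-1 G, XK, KX
    and KY = K (I - GK)^-1. *)
Definition loopX := transfer closed_loop_mx inG outG.
Definition loopXK := transfer closed_loop_mx inK outG.
Definition loopKX := transfer closed_loop_mx inG outK.
Definition loopKY := transfer closed_loop_mx inK outK.

Notation G := (transfer A B Cc).
Notation K := (transfer AK BK CK).

Lemma closed_loop_state k (V1 : 'M[RF]_(n, k)) (V2 : 'M[RF]_(q, k))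
    (Z1 : 'M[RF]_(n, k)) (Z2 : 'M[RF]_(q, k)) :
  ratres closed_loop_mx *m col_mx V1 V2 = col_mx Z1 Z2 ->
  Z1 = ratres A *m (V1 + cstmx B *m (cstmx CK *m Z2)) /\
  Z2 = ratres AK *m (V2 + cstmx BK *m (cstmx Cc *m Z1)).
Proof.
move=> /(congr1 (mulmx (ratX closed_loop_mx))); rewrite mulmxA ratX_ratres mul1mx.
have -> : ratX closed_loop_mx = block_mx (ratX A) (- (cstmx B *m cstmx CK))
   (- (cstmx BK *m cstmx Cc)) (ratX AK).
  rewrite /ratX /closed_loop_mx /cstmx map_block_mx -/(cstmx _) -[map_mx _ (B *m CK)]/(cstmx _).
  rewrite -[map_mx _ (BK *m Cc)]/(cstmx _) -[map_mx _ AK]/(cstmx _) !cstmxM.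
  by rewrite scalar_mx_block opp_block_mx add_block_mx !add0r.
rewrite mul_block_col => /eq_col_mx [E1 E2]; split.
- by rewrite E1 mulNmx -addrA mulmxA addNr addr0 mulmxA ratres_ratX mul1mx.
- by rewrite E2 mulNmx addrC addrA mulmxA subrr add0r mulmxA ratres_ratX mul1mx.
Qed.

Let outputs k (V1 : 'M[RF]_(n, k)) (V2 : 'M[RF]_(q, k)) :
  exists (Z1 : 'M[RF]_(n, k)) (Z2 : 'M[RF]_(q, k)),
  [/\ ratres closed_loop_mx *m col_mx V1 V2 = col_mx Z1 Z2,
      cstmx outG *m (ratres closed_loop_mx *m col_mx V1 V2) = cstmx Cc *m Z1 &
      cstmx outK *m (ratres closed_loop_mx *m col_mx V1 V2) = cstmx CK *m Z2].
Proof.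
exists (usubmx (ratres closed_loop_mx *m col_mx V1 V2)), (dsubmx (ratres closed_loop_mx *m col_mx V1 V2)).
have z0 a b : cstmx (0 : 'M[R]_(a, b)) = 0 by apply/matrixP => i j; rewrite !mxE cst_rat0.
rewrite vsubmxK; split=> //.
- rewrite -{1}[ratres closed_loop_mx *m _]vsubmxK /outG /cstmx map_row_mx -/(cstmx _) -/(cstmx _) z0.
  by rewrite mul_row_col mul0mx addr0.
- rewrite -{1}[ratres closed_loop_mx *m _]vsubmxK /outK /cstmx map_row_mx -/(cstmx _) -/(cstmx _) z0.
  by rewrite mul_row_col mul0mx add0r.
Qed.

Let z0 a b : cstmx (0 : 'M[R]_(a, b)) = 0.
Proof. by apply/matrixP => i j; rewrite !mxE cst_rat0. Qed.

Lemma cst_inG : cstmx inG = col_mx (cstmx B) 0.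
Proof. by rewrite /cstmx /inG map_col_mx -/(cstmx _) -/(cstmx _) z0. Qed.
Lemma cst_inK : cstmx inK = col_mx 0 (cstmx BK).
Proof. by rewrite /cstmx /inK map_col_mx -/(cstmx _) -/(cstmx _) z0. Qed.

(** The loop equations, read off the block structure of the resolvent. *)
Lemma loopX_eq : loopX = G + G *m loopKX /\ loopKX = K *m loopX.
Proof.
rewrite /loopX /loopKX !transferE cst_inG -!mulmxA.
have [Z1 [Z2 [EZ -> ->]]] := outputs (cstmx B) 0.
have [E1 E2] := closed_loop_state EZ; rewrite add0r in E2; split.
- by rewrite {1}E1 !mulmxDr !mulmxA.
- by rewrite {1}E2 !mulmxA.
Qed.

Lemma loopKY_eq : loopXK = G *m loopKY /\ loopKY = K + K *m loopXK.
Proof.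
rewrite /loopXK /loopKY !transferE cst_inK -!mulmxA.
have [Z1 [Z2 [EZ -> ->]]] := outputs 0 (cstmx BK).
have [E1 E2] := closed_loop_state EZ; rewrite add0r in E1; split.
- by rewrite {1}E1 !mulmxA.
- by rewrite {1}E2 !mulmxDr !mulmxA.
Qed.

(** Since XK = G KY and KY = K + K XK, one has (I - GK) XK = GK. *)
Lemma sensitivity_inv : (1%:M - G *m K) *m (1%:M + loopXK) = 1%:M.
Proof.
have [E1 E2] := loopKY_eq.
rewrite mulmxDr mulmx1 mulmxBl mul1mx -(mulmxA G K).
have -> : K *m loopXK = loopKY - K by rewrite E2 addrC addKr.
by rewrite mulmxBr -E1 opprB [loopXK + _]addrC subrK subrK.
Qed.

Lemma sensitivity_unit : 1%:M - G *m K \in unitmx.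
Proof. exact: (mulmx1_unit sensitivity_inv).1. Qed.

Let invmx_eq a b (S : 'M[RF]_a) (X Z : 'M[RF]_(a, b)) : S \in unitmx ->
  S *m X = Z -> X = invmx S *m Z.
Proof. by move=> u <-; rewrite mulmxA mulVmx // mul1mx. Qed.

Lemma sensitivityE : invmx (1%:M - G *m K) = 1%:M + loopXK.
Proof. by rewrite [RHS](invmx_eq sensitivity_unit sensitivity_inv) mulmx1. Qed.

Lemma sensitivityG : invmx (1%:M - G *m K) *m G = loopX.
Proof.
have [E1 E2] := loopX_eq; apply/esym/(invmx_eq sensitivity_unit).
by rewrite mulmxBl mul1mx -(mulmxA G K) -E2 {1}E1 addrK.
Qed.

Lemma sensitivityGK : invmx (1%:M - G *m K) *m G *m K = loopXK.
Proof.
have E : loopXK = (1%:M + loopXK) - 1%:M by rewrite addrC addKr.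
rewrite [RHS]E -sensitivityE -(mulmxA _ G K).
have := mulVmx sensitivity_unit; rewrite mulmxBr mulmx1 => h.
by rewrite -[X in _ = _ - X]h subKr.
Qed.

End ClosedLoop.

End Transfer.

(** * Perturbation identities and the small gain theorem *)

Section Perturbation.
Variable R : realType.
Notation C := R[i].
Notation Re := (@complex.Re R).
Notation RF := (ratfun R).

Section Identities.
Variables (n m p q qr : nat).
Variables (A : 'M[R]_n) (B : 'M[R]_(n, m)) (Cc : 'M[R]_(p, n)).
Variables (AK : 'M[R]_q) (BK : 'M[R]_(q, p)) (CK : 'M[R]_(m, q)).
Variables (AKr : 'M[R]_qr) (BKr : 'M[R]_(qr, p)) (CKr : 'M[R]_(m, qr)).

Notation G := (transfer A B Cc).
Notation K := (transfer AK BK CK).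
Notation Kr := (transfer AKr BKr CKr).
Notation Delta := (Kr - K).
Notation X := (loopX A B Cc AK BK CK).
Notation XK := (loopXK A B Cc AK BK CK).
Notation KX := (loopKX A B Cc AK BK CK).
Notation KY := (loopKY A B Cc AK BK CK).
Notation Xr := (loopX A B Cc AKr BKr CKr).
Notation XKr := (loopXK A B Cc AKr BKr CKr).
Notation KXr := (loopKX A B Cc AKr BKr CKr).
Notation KYr := (loopKY A B Cc AKr BKr CKr).

(** Multiply I - G Kr = (I - G K) - G Delta by (I - GK)^-1 on the left and by
    (I - G Kr)^-1 on the right. *)
Lemma perturbed_sensitivity : 1%:M + XKr = 1%:M + XK + X *m Delta *m (1%:M + XKr).
Proof.
have E1 := sensitivity_inv A B Cc AK BK CK.
have E2 := sensitivity_inv A B Cc AKr BKr CKr.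
have E3 := mulmx1C E1.
have EX := sensitivityG A B Cc AK BK CK; rewrite sensitivityE in EX.
move: E1 E2 E3 EX; move: X XK XKr G K Kr => x xk xkr g k kr E1 E2 E3 EX.
have E : 1%:M - g *m kr = (1%:M - g *m k) - g *m (kr - k).
  by rewrite mulmxBr opprB addrA subrK.
have H : 1%:M + xkr - x *m (kr - k) *m (1%:M + xkr) = 1%:M + xk.
  transitivity ((1%:M + xk) *m ((1%:M - g *m kr) *m (1%:M + xkr))).
    have F : (1%:M + xk) *m (1%:M - g *m kr) = 1%:M - x *m (kr - k).
      by rewrite E [LHS]mulmxBr E3 mulmxA EX.
    by rewrite [RHS]mulmxA F [RHS]mulmxBl mul1mx.
  by rewrite E2 mulmx1.
by rewrite -[X in _ = X + _]H subrK.
Qed.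

Lemma perturbed_XK : XKr = XK + X *m Delta *m (1%:M + XKr).
Proof. by apply: (@addrI _ 1%:M); rewrite addrA -perturbed_sensitivity. Qed.

Lemma perturbed_X : Xr = X + X *m Delta *m Xr.
Proof.
rewrite -(sensitivityG A B Cc AKr BKr CKr) sensitivityE {1}perturbed_sensitivity.
have EX := sensitivityG A B Cc AK BK CK; rewrite sensitivityE in EX.
by rewrite [LHS]mulmxDl EX -(mulmxA (X *m Delta)).
Qed.

(** Kr (I + Xr Kr) = Delta (I + Xr Kr) + K (I + Xr Kr), and the last term is
    expanded once more with the identity for I + Xr Kr. *)
Lemma perturbed_KY : KYr = KY + (1%:M + KX) *m (Delta *m (1%:M + XKr)).
Proof.
have [_ E1] := loopKY_eq A B Cc AK BK CK; have [_ E2] := loopKY_eq A B Cc AKr BKr CKr.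
have [_ E3] := loopX_eq A B Cc AK BK CK; have E4 := perturbed_sensitivity.
move: E1 E2 E3 E4; move: X XK KX KY XKr KYr K Kr => x xk kx ky xkr kyr k kr E1 E2 E3 E4.
have -> : kyr = kr *m (1%:M + xkr) by rewrite mulmxDr mulmx1.
have -> : ky = k *m (1%:M + xk) by rewrite mulmxDr mulmx1.
have {1}-> : kr = k + (kr - k) by rewrite addrC subrK.
have E5 : k *m (1%:M + xkr) = k *m (1%:M + xk) + k *m (x *m (kr - k) *m (1%:M + xkr)).
  by rewrite -mulmxDr -E4.
rewrite [LHS]mulmxDl E5 -[LHS]addrA; congr (_ + _).
by rewrite mulmxDl mul1mx E3 !mulmxA addrC.
Qed.

Lemma perturbed_KX : KXr = KX + (1%:M + KX) *m (Delta *m Xr).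
Proof.
have [_ E1] := loopX_eq A B Cc AK BK CK; have [_ E2] := loopX_eq A B Cc AKr BKr CKr.
have E4 := perturbed_X.
move: E1 E2 E4; move: X KX Xr KXr K Kr => x kx xr kxr k kr E1 E2 E4.
rewrite E2 {1}[kr](_ : _ = k + (kr - k)); last by rewrite addrC subrK.
have E5 : k *m xr = k *m x + k *m (x *m (kr - k) *m xr) by rewrite -mulmxDr -E4.
rewrite [LHS]mulmxDl E5 -E1 -[LHS]addrA; congr (_ + _).
by rewrite [RHS]mulmxDl mul1mx E1 !mulmxA addrC.
Qed.

End Identities.

Section SmallGain.
Variables (p : nat) (F : 'M[RF]_p).
Hypothesis sF : msproper F.
Hypothesis hF : forall i j (s : C), is_pole (F i j) s -> Re s < 0.
Variable g : R.
Hypotheses (g0 : 0 <= g) (g1 : g < 1).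
Hypothesis gF : forall w k (B : 'M[C]_(p, k)), frob (meval (w *i) F *m B) <= g * frob B.

(** The numerical range of F is bounded on the imaginary axis by the gain,
    hence everywhere in the right half-plane by Poisson's formula; so 1 is not
    an eigenvalue of F(s). *)
Lemma small_gain s : 0 <= Re s -> 1%:M - meval s F \in unitmx.
Proof.
move=> s0; rewrite unitmxE unitfE; apply/det0P => -[v v0].
rewrite mulmxBr mulmx1 => /eqP; rewrite subr_eq0 => /eqP vE.
(* v is a left eigenvector of F(s) for the eigenvalue 1, so f(s) = |v|^2 *)
pose h := hct v; pose f (z : C) := (v *m meval z F *m h) 0 0.
have fs : Re (f s) = frob2 h.
  rewrite /f -vE; have := frob2E h; rewrite hctK /mxtrace big_ord1 => <-.
  by [].
have h0 : 0 < frob2 h.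
  rewrite lt_def frob2_ge0 andbT; apply: contra_neq v0 => h0.
  apply/rowP => i; rewrite mxE; apply/eqP; rewrite -nsq_eq0.
  move/eqP: h0; rewrite frob2_hct /frob2 big_ord1 psumr_eq0; last by move=> j _; exact: nsq_ge0.
  by move=> /allP /(_ i (mem_index_enum _)).
(* a ratio strictly between g and 1 is positive even when g = 0, so it can
   serve as a weight in the Cauchy-Schwarz inequality *)
pose t := (1 + g) / 2.
have t0 : 0 < t by have := g0; have := g1; rewrite /t; lra.
have t1 : t < 1 by have := g0; have := g1; rewrite /t; lra.
have gt : g <= t by have := g0; have := g1; rewrite /t; lra.
have ub w : Re (f (w *i)) <= t * frob2 h.
  have := frob_inner_le h (meval (w *i) F *m h) t0.
  rewrite hctK mulmxA /mxtrace big_ord1 -/(f _) => H.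
  have H2 : t^-1 * frob2 (meval (w *i) F *m h) <= t * frob2 h.
    rewrite ler_pdivrMl // mulrA -expr2 -!frob_sqr -exprMn.
    have th : 0 <= t * frob h by apply: mulr_ge0; [exact: ltW|exact: frob_ge0].
    rewrite ler_pXn2r ?nnegrE ?frob_ge0 //.
    by apply: le_trans (gF _ _) _; rewrite ler_wpM2r ?frob_ge0.
  by move: H H2; move: (Re _) (t^-1 * _) (t * _) => x y z; lra.
move: s0; rewrite le_eqVlt => /predU1P [s0|s0].
  have sE : s = (complex.Im s) *i by apply: complex_ext => //=.
  have := ub (complex.Im s); rewrite -sE fs => le1.
  have : t * frob2 h < frob2 h by rewrite gtr_pMl.
  by rewrite ltNge le1.
have Pf : PV (fun w => f (w *i) * (poisson s w)%:C) ((2 * pi : R)%:C * f s).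
  apply: eq_PV (PV_sum (index_enum 'I_p) (fun j => PVZ (h j 0) (PV_sum (index_enum 'I_p)
     (fun i => PVZ (v 0 i) (stable_poisson (sF i j) (@hF i j) s0))))).
  - move=> w; rewrite /f mxE mulr_suml; apply: eq_bigr => j _.
    rewrite [RHS]mulrAC [RHS]mulrC; congr (_ * _); rewrite mxE mulr_suml; apply: eq_bigr => i _.
    by rewrite mxE mulrA.
  - rewrite /f mxE mulr_sumr; apply: eq_bigr => j _.
    rewrite mulrA [RHS]mulrC; congr (_ * _); rewrite mxE mulr_sumr; apply: eq_bigr => i _.
    by rewrite mxE mulrCA.
have [Pr _] := Pf; have [Qr _] := PV_poisson s0.
have : 2 * pi * frob2 h <= t * frob2 h * (2 * pi).
  apply: (le_PVr _ (PVrZ (t * frob2 h) Qr)).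
    apply: eq_PVr Pr => //.
    by rewrite cReM /= fs mul0r subr0.
  move=> w /=; rewrite cReM /= mulr0 subr0.
  by rewrite ler_wpM2r ?poisson_ge0 ?ub.
have pi2 : 0 < 2 * pi :> R by rewrite mulr_gt0 ?pi_gt0.
rewrite mulrC ler_pM2r // => le1.
have : t * frob2 h < frob2 h by rewrite gtr_pMl.
by rewrite ltNge le1.
Qed.

End SmallGain.

End Perturbation.

(** * Absence of hidden modes, and bounds by the H-infinity norm *)

Section Minimality.
Variable R : realType.
Notation tofrac := (@FracField.tofrac {poly R}).
Notation RF := (ratfun R).

Lemma expmxS n m (A : 'M[R]_n) k (B : 'M[R]_(n, m)) : A ^+ k.+1 *m B = A *m (A ^+ k *m B).
Proof. by rewrite exprS mulmxA. Qed.

Lemma expmxSr n m (A : 'M[R]_n) k (B : 'M[R]_(m, n)) : B *m A ^+ k.+1 = B *m A ^+ k *m A.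
Proof. by rewrite exprSr -mulmxA. Qed.

(** The controllability matrix has a constant right inverse, so F is a constant
    combination of its products with the columns A^k B. *)
Lemma controllable_regular s n m a (A : 'M[R]_n) (B : 'M[R]_(n, m)) (F : 'M[RF]_(a, n)) :
  controllable A B -> (forall k, mregular s (F *m cstmx (A ^+ k *m B))) -> mregular s F.
Proof.
rewrite /controllable -/(row_free _) => /row_freeP [W EW] hF.
have -> : F = F *m cstmx (\mxrow_(k < n) (A ^+ k *m B)) *m cstmx W.
  by rewrite -mulmxA -cstmxM EW cstmx1 mulmx1.
apply: mregularM; last exact: mregular_cst.
have -> : cstmx (\mxrow_(k < n) (A ^+ k *m B)) = \mxrow_(k < n) cstmx (A ^+ k *m B).
  by apply/matrixP => i j; rewrite !mxE.
by rewrite mul_mxrow => i j; rewrite mxE; exact: hF.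
Qed.

Lemma observable_regular s n p a (Cc : 'M[R]_(p, n)) (A : 'M[R]_n) (F : 'M[RF]_(n, a)) :
  observable Cc A -> (forall k, mregular s (cstmx (Cc *m A ^+ k) *m F)) -> mregular s F.
Proof.
rewrite /observable -/(row_full _) => /row_fullP [W EW] hF.
have -> : F = cstmx W *m (cstmx (\mxcol_(k < n) (Cc *m A ^+ k)) *m F).
  by rewrite mulmxA -cstmxM EW cstmx1 mul1mx.
apply: mregularM; first exact: mregular_cst.
have -> : cstmx (\mxcol_(k < n) (Cc *m A ^+ k)) = \mxcol_(k < n) cstmx (Cc *m A ^+ k).
  by apply/matrixP => i j; rewrite !mxE.
by rewrite mxcol_mul => i j; rewrite mxE; exact: hF.
Qed.

Variables (n m p q : nat) (A : 'M[R]_n) (B : 'M[R]_(n, m)) (Cc : 'M[R]_(p, n)).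
Variables (AK : 'M[R]_q) (BK : 'M[R]_(q, p)) (CK : 'M[R]_(m, q)).
Notation M := (closed_loop_mx A B Cc AK BK CK).
Notation Rr := (ratres M).

(** Multiplication by M amounts to multiplication by s up to a polynomial
    term, which creates no pole. *)
Lemma ratres_cstr k (V : 'M[R]_(n + q, k)) :
  Rr *m cstmx (M *m V) = (tofrac 'X) *: (Rr *m cstmx V) - cstmx V.
Proof.
rewrite cstmxM mulmxA; have -> : Rr *m cstmx M = (tofrac 'X) *: Rr - 1%:M.
  have := ratres_ratX M; rewrite /ratX mulmxBr mul_mx_scalar => <-.
  by rewrite subKr.
by rewrite mulmxBl mul1mx scalemxAl.
Qed.

Lemma ratres_cstl k (V : 'M[R]_(k, n + q)) :
  cstmx (V *m M) *m Rr = (tofrac 'X) *: (cstmx V *m Rr) - cstmx V.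
Proof.
rewrite cstmxM -mulmxA; have -> : cstmx M *m Rr = (tofrac 'X) *: Rr - 1%:M.
  have := ratX_ratres M; rewrite /ratX mulmxBl mul_scalar_mx => <-.
  by rewrite subKr.
by rewrite mulmxBr mulmx1 scalemxAr.
Qed.

Lemma mregularZX s a b (F : 'M[RF]_(a, b)) : mregular s F -> mregular s ((tofrac 'X) *: F).
Proof. by move=> hF i j; rewrite mxE; case: (revalM (reval_X s).1 (hF i j)). Qed.

(** Output feedback preserves reachability: [A^(k+1) B] differs from the image of
    [A^k B] under the closed-loop matrix by a vector entering through the input
    of the controller, and symmetrically. *)
Lemma regular_inputs s a (F : 'M[R]_(a, n + q)) :
  controllable A B -> controllable AK BK ->
  mregular s (cstmx F *m Rr *m cstmx (inG q B)) ->
  mregular s (cstmx F *m Rr *m cstmx (inK n BK)) ->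
  mregular s (cstmx F *m Rr).
Proof.
move=> cA cK hG hK.
(* the V for which the product has no pole at s form a space stable under M *)
have step k (V : 'M[R]_(n + q, k)) : mregular s (cstmx F *m Rr *m cstmx V) ->
    mregular s (cstmx F *m Rr *m cstmx (M *m V)).
  move=> hV; rewrite -mulmxA ratres_cstr mulmxBr -scalemxAr mulmxA.
  apply: mregularD; first exact: mregularZX.
  by apply: mregularN; apply: mregularM; exact: mregular_cst.
have hA k : mregular s (cstmx F *m Rr *m cstmx (col_mx (A ^+ k *m B) 0)).
  elim: k => [|k IH]; first by rewrite expr0 mul1mx.
  have -> : col_mx (A ^+ k.+1 *m B) 0 = M *m col_mx (A ^+ k *m B) 0
      - inK n BK *m (Cc *m (A ^+ k *m B)).
    rewrite /closed_loop_mx /inK mul_block_col mul_col_mx !mulmx0 !addr0 mul0mx opp_col_mx add_col_mx.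
    by rewrite oppr0 addr0 -(mulmxA BK) subrr expmxS.
  rewrite cstmxD cstmxN (cstmxM (inK n BK)) mulmxDr mulmxN; apply: mregularD; first exact: step.
  apply: mregularN; rewrite (mulmxA (cstmx F *m Rr)).
  by apply: mregularM; [assumption|exact: mregular_cst].
have hB k : mregular s (cstmx F *m Rr *m cstmx (col_mx 0 (AK ^+ k *m BK))).
  elim: k => [|k IH]; first by rewrite expr0 mul1mx.
  have -> : col_mx 0 (AK ^+ k.+1 *m BK) = M *m col_mx 0 (AK ^+ k *m BK)
      - inG q B *m (CK *m (AK ^+ k *m BK)).
    rewrite /closed_loop_mx /inG mul_block_col mul_col_mx !mulmx0 !add0r mul0mx opp_col_mx add_col_mx.
    by rewrite oppr0 addr0 -(mulmxA B) subrr expmxS.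
  rewrite cstmxD cstmxN (cstmxM (inG q B)) mulmxDr mulmxN; apply: mregularD; first exact: step.
  apply: mregularN; rewrite (mulmxA (cstmx F *m Rr)).
  by apply: mregularM; [assumption|exact: mregular_cst].
have h1 : mregular s (cstmx F *m Rr *m cstmx (col_mx (1%:M : 'M[R]_n) (0 : 'M[R]_(q, n)))).
  apply: controllable_regular cA _ => k; rewrite -mulmxA -cstmxM mul_col_mx mul1mx mul0mx.
  exact: hA.
have h2 : mregular s (cstmx F *m Rr *m cstmx (col_mx (0 : 'M[R]_(n, q)) (1%:M : 'M[R]_q))).
  apply: controllable_regular cK _ => k; rewrite -mulmxA -cstmxM mul_col_mx mul1mx mul0mx.
  exact: hB.
have -> : cstmx F *m Rr = cstmx F *m Rr *m cstmx (col_mx 1%:M 0) *m cstmx (row_mx 1%:M 0) +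
    cstmx F *m Rr *m cstmx (col_mx 0 1%:M) *m cstmx (row_mx 0 1%:M).
  rewrite -!(mulmxA _ (cstmx (col_mx _ _))) -!cstmxM -mulmxDr -cstmxD !mul_col_row.
  by rewrite !mul1mx !mul0mx add_block_mx !addr0 add0r -scalar_mx_block cstmx1 mulmx1.
by apply: mregularD; apply: mregularM => //; exact: mregular_cst.
Qed.

Lemma regular_outputs s a (F : 'M[RF]_(n + q, a)) :
  observable Cc A -> observable CK AK ->
  (forall k (V : 'M[R]_(k, n + q)), mregular s (cstmx V *m F) ->
     mregular s (cstmx (V *m M) *m F)) ->
  mregular s (cstmx (outG q Cc) *m F) -> mregular s (cstmx (outK n CK) *m F) ->
  mregular s F.
Proof.
move=> oA oK step hG hK.
have hA k : mregular s (cstmx (row_mx (Cc *m A ^+ k) 0) *m F).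
  elim: k => [|k IH]; first by rewrite expr0 mulmx1.
  have -> : row_mx (Cc *m A ^+ k.+1) 0 = row_mx (Cc *m A ^+ k) 0 *m M
      - (Cc *m A ^+ k *m B) *m outK n CK.
    rewrite /closed_loop_mx /outK mul_row_block mul_mx_row !mulmx0 !mul0mx !addr0 opp_row_mx add_row_mx.
    by rewrite oppr0 addr0 mulmxA subrr expmxSr.
  rewrite cstmxD cstmxN (cstmxM _ (outK n CK)) mulmxDl mulNmx; apply: mregularD; first exact: step.
  apply: mregularN; rewrite -(mulmxA _ _ F).
  by apply: mregularM; [exact: mregular_cst|assumption].
have hB k : mregular s (cstmx (row_mx 0 (CK *m AK ^+ k)) *m F).
  elim: k => [|k IH]; first by rewrite expr0 mulmx1.
  have -> : row_mx 0 (CK *m AK ^+ k.+1) = row_mx 0 (CK *m AK ^+ k) *m M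
      - (CK *m AK ^+ k *m BK) *m outG q Cc.
    rewrite /closed_loop_mx /outG mul_row_block mul_mx_row !mulmx0 !mul0mx !add0r opp_row_mx add_row_mx.
    by rewrite oppr0 addr0 mulmxA subrr expmxSr.
  rewrite cstmxD cstmxN (cstmxM _ (outG q Cc)) mulmxDl mulNmx; apply: mregularD; first exact: step.
  apply: mregularN; rewrite -(mulmxA _ _ F).
  by apply: mregularM; [exact: mregular_cst|assumption].
have h1 : mregular s (cstmx (row_mx (1%:M : 'M[R]_n) (0 : 'M[R]_(n, q))) *m F).
  apply: observable_regular oA _ => k; rewrite mulmxA -cstmxM mul_mx_row mulmx1 mulmx0.
  exact: hA.
have h2 : mregular s (cstmx (row_mx (0 : 'M[R]_(q, n)) (1%:M : 'M[R]_q)) *m F).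
  apply: observable_regular oK _ => k; rewrite mulmxA -cstmxM mul_mx_row mulmx1 mulmx0.
  exact: hB.
have -> : F = cstmx (col_mx 1%:M 0) *m (cstmx (row_mx 1%:M 0) *m F) +
    cstmx (col_mx 0 1%:M) *m (cstmx (row_mx 0 1%:M) *m F).
  rewrite !mulmxA -!cstmxM -mulmxDl -cstmxD !mul_col_row.
  by rewrite !mul1mx !mul0mx add_block_mx !addr0 add0r -scalar_mx_block cstmx1 mul1mx.
by apply: mregularD; apply: mregularM => //; exact: mregular_cst.
Qed.

(** First the inputs and then the outputs are removed from the four blocks; what
    remains is the resolvent of M, whose poles are the eigenvalues of M. *)
Lemma minimal_regular s : minimal A B Cc -> minimal AK BK CK ->
  mregular s (loopX A B Cc AK BK CK) -> mregular s (loopXK A B Cc AK BK CK) ->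
  mregular s (loopKX A B Cc AK BK CK) -> mregular s (loopKY A B Cc AK BK CK) ->
  ~~ eigenvalue (cmx M) s.
Proof.
move=> /andP[cA oA] /andP[cK oK] h1 h2 h3 h4.
have hG : mregular s (cstmx (outG q Cc) *m Rr) by apply: regular_inputs.
have hK : mregular s (cstmx (outK n CK) *m Rr) by apply: regular_inputs.
have hR : mregular s Rr.
  apply: regular_outputs oA oK _ hG hK => k V hV.
  rewrite ratres_cstl; apply: mregularD; first exact: mregularZX.
  by apply: mregularN; exact: mregular_cst.
have := congr1 (meval s (n := _)) (ratX_ratres M).
rewrite mevalM //; last exact: mregular_ratX.
rewrite meval1 meval_ratX => /mulmx1_unit [+ _].
by rewrite unitmxE det_scalar_subr unitfE eigenvalue_root_char rootE.
Qed.

End Minimality.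

Section HinfNorm.
Variable R : realType.
Notation C := R[i].
Notation RF := (ratfun R).

Lemma freq_respE p m (F : 'M[RF]_(p, m)) w : freq_resp F w = meval (w *i) F.
Proof. by []. Qed.

Lemma hinf_norm_ge0 p m (F : 'M[RF]_(p, m)) : (0 <= hinf_norm F)%E.
Proof.
rewrite /hinf_norm; case: asboolP => // _.
apply: (@le_trans _ _ (sigma_max (freq_resp F 0))%:E).
  by rewrite lee_fin sigma_max_ge0.
by apply: ereal_sup_ubound; exists 0.
Qed.

Lemma hinf_ge0 p m (F : 'M[RF]_(p, m)) : 0 <= hinf F.
Proof. by rewrite /hinf fine_ge0 // hinf_norm_ge0. Qed.

Lemma hinf_norm_RHinf p m (F : 'M[RF]_(p, m)) : hinf_norm F \is a fin_num -> RHinf F.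
Proof. by rewrite /hinf_norm; case: asboolP. Qed.

Lemma sigma_le_hinf p m (F : 'M[RF]_(p, m)) w : hinf_norm F \is a fin_num ->
  sigma_max (freq_resp F w) <= hinf F.
Proof.
move=> fF; rewrite -lee_fin fineK //; rewrite /hinf_norm in fF *.
case: asboolP fF => // _ _; apply: ereal_sup_ubound; by exists w.
Qed.

Lemma hinf_fin p m (F : 'M[RF]_(p, m)) (c : R) : RHinf F ->
  (forall w, frob2 (freq_resp F w) <= c) -> hinf_norm F \is a fin_num.
Proof.
move=> hF hc; rewrite ge0_fin_numE ?hinf_norm_ge0 // /hinf_norm asboolT //.
apply: le_lt_trans (ltry (Num.sqrt c)); apply: ge_ereal_sup => _ [w _ <-].
rewrite lee_fin -(ler_pXn2r (n := 2)) ?nnegrE ?sigma_max_ge0 ?sqrtr_ge0 //.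
rewrite sqr_sqrtr; last by apply: le_trans (hc 0); exact: frob2_ge0.
exact: le_trans (sigma_max_le_frob2 _) (hc w).
Qed.

Lemma frob_mul_hinfl p m k (F : 'M[RF]_(p, m)) (B : 'M[C]_(m, k)) w :
  hinf_norm F \is a fin_num -> frob (meval (w *i) F *m B) <= hinf F * frob B.
Proof.
move=> fF; apply: le_trans (frob_mulmx_sigmal _ _) _.
by rewrite ler_wpM2r ?frob_ge0 // sigma_le_hinf.
Qed.

Lemma frob_mul_hinfr p m k (F : 'M[RF]_(p, m)) (B : 'M[C]_(k, p)) w :
  hinf_norm F \is a fin_num -> frob (B *m meval (w *i) F) <= hinf F * frob B.
Proof.
move=> fF; apply: le_trans (frob_mulmx_sigmar _ _) _.
by rewrite ler_wpM2r ?frob_ge0 // sigma_le_hinf.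
Qed.

(** The finiteness of the norm of D comes from the strict inequality, also when the
    norm of X is zero and its inverse infinite. *)
Lemma hinf_lt_inv p m p' m' (X : 'M[RF]_(p, m)) (D : 'M[RF]_(p', m')) :
  hinf_norm X \is a fin_num -> (hinf_norm D < (hinf_norm X)^-1)%E ->
  hinf_norm D \is a fin_num /\ hinf X * hinf D < 1.
Proof.
move=> fX lt; have fD : hinf_norm D \is a fin_num.
  by rewrite ge0_fin_numE ?hinf_norm_ge0 // (lt_le_trans lt) ?leey.
split=> //; move: lt; rewrite -(fineK fX) -(fineK fD) -/(hinf X) -/(hinf D) inver.
have := hinf_ge0 X; rewrite le_eqVlt => /predU1P [<-|x0].
  by rewrite mul0r ltr01.
by rewrite gt_eqF // lte_fin -div1r ltr_pdivlMr // mulrC.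
Qed.

End HinfNorm.

(** * Robust stability and pointwise bounds *)

Section StableTransfers.
Variable R : realType.
Notation C := R[i].
Notation Re := (@complex.Re R).
Notation RF := (ratfun R).

Definition mstable p m (F : 'M[RF]_(p, m)) :=
  forall i j (s : C), is_pole (F i j) s -> Re s < 0.

Lemma mstable_regular p m (F : 'M[RF]_(p, m)) s : mstable F -> 0 <= Re s -> mregular s F.
Proof. by move=> hF s0 i j; apply/negP => /hF; rewrite ltNge s0. Qed.

Lemma regular_mstable p m (F : 'M[RF]_(p, m)) :
  (forall s, 0 <= Re s -> mregular s F) -> mstable F.
Proof. by move=> hF i j s; apply: contraTT; rewrite -leNgt => /hF /(_ i j). Qed.

Lemma RHinf_mstable p m (F : 'M[RF]_(p, m)) : RHinf F -> mstable F.
Proof. by move=> hF i j s; have [_] := hF i j; apply. Qed.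

Lemma mstable_transfer n m p (M : 'M[R]_n) (B : 'M[R]_(n, m)) (Cc : 'M[R]_(p, n)) :
  hurwitz M -> mstable (transfer M B Cc).
Proof. by move=> hM; apply: regular_mstable => s s0; exact: mregular_transfer. Qed.

Lemma RHinf_sproper p m (F : 'M[RF]_(p, m)) : msproper F -> mstable F -> RHinf F.
Proof. by move=> sF hF i j; split; [exact: sproper_proper|exact: hF]. Qed.

Lemma RHinf_1D p (F : 'M[RF]_p) : msproper F -> mstable F -> RHinf (1%:M + F).
Proof.
move=> sF hF i j; split.
  rewrite !mxE; case: (i == j); rewrite ?mulr1n ?mulr0n ?add0r; first exact: proper_1D.
  exact: sproper_proper.
move: i j; apply: regular_mstable => s s0; apply: mregularD; first exact: mregular1.
exact: mstable_regular.
Qed.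

Lemma sproperM (f g : RF) : sproper f -> sproper g -> sproper (f * g).
Proof.
move=> [a [b [b0 sab ->]]] [c [d [d0 scd ->]]].
exists (a * c), (b * d); split; first by rewrite mulf_neq0.
- have L (x y z t : nat) : (x < y -> z < t -> (x + z).-1 < (y + t).-1)%N by lia.
  by apply: leq_ltn_trans (size_polyMleq _ _) _; rewrite (size_mul b0 d0); exact: L.
- by rewrite mulf_div -!rmorphM.
Qed.

Lemma msproperM m n p (F : 'M[RF]_(m, n)) (G : 'M[RF]_(n, p)) :
  msproper F -> msproper G -> msproper (F *m G).
Proof.
by move=> hF hG i j; rewrite mxE; apply: sproper_sum => k; exact: sproperM.
Qed.

Lemma mstableM m n p (F : 'M[RF]_(m, n)) (G : 'M[RF]_(n, p)) :
  mstable F -> mstable G -> mstable (F *m G).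
Proof.
by move=> hF hG; apply: regular_mstable => s s0; apply: mregularM; exact: mstable_regular.
Qed.

Lemma frob2_bound p m (F : 'M[RF]_(p, m)) : msproper F -> mstable F ->
  exists2 c : R, 0 <= c & forall w, frob2 (freq_resp F w) <= c / (1 + w ^+ 2).
Proof.
move=> sF hF; have /boolp.choice [f hf] : forall ij : 'I_p * 'I_m, exists c : R, 0 <= c /\
  forall w, nsq (reval (F ij.1 ij.2) (w *i)) <= c / (1 + w ^+ 2).
  move=> [i j]; have [c c0 hc] := stable_bound (sF i j) (@hF i j).
  by exists c; split.
exists (\sum_i \sum_j f (i, j)).
  by apply: sumr_ge0 => i _; apply: sumr_ge0 => j _; case: (hf (i, j)).
move=> w; rewrite /frob2 mulr_suml; apply: ler_sum => i _; rewrite mulr_suml.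
by apply: ler_sum => j _; rewrite mxE; case: (hf (i, j)) => _; apply.
Qed.

Lemma hinf_fin_sproper p m (F : 'M[RF]_(p, m)) : msproper F -> mstable F ->
  hinf_norm F \is a fin_num.
Proof.
move=> sF hF; have [c c0 hc] := frob2_bound sF hF.
apply: (@hinf_fin _ _ _ _ c); first exact: RHinf_sproper.
by move=> w; apply: le_trans (hc w) (ratio_le _ c0).
Qed.

Lemma hinf_fin_1D p (F : 'M[RF]_p) : msproper F -> mstable F ->
  hinf_norm (1%:M + F) \is a fin_num.
Proof.
move=> sF hF; have [c c0 hc] := frob2_bound sF hF.
apply: (@hinf_fin _ _ _ _ (2 * frob2 (1%:M : 'M[C]_p) + 2 * c)); first exact: RHinf_1D.
move=> w; have w0 : 0 <= Re (w *i) by [].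
rewrite freq_respE mevalD; [|exact: mregular1|exact: mstable_regular].
rewrite meval1; have := frob2D_weighted (1%:M : 'M[C]_p) (meval (w *i) F) ltr01.
rewrite invr1 => /le_trans; apply; rewrite lerD2l ler_wpM2l //.
exact: le_trans (hc w) (ratio_le _ c0).
Qed.

End StableTransfers.

Section RobustStability.
Variable R : realType.
Notation C := R[i].
Notation Re := (@complex.Re R).
Notation RF := (ratfun R).

Variables (n m p q qr : nat).
Variables (A : 'M[R]_n) (B : 'M[R]_(n, m)) (Cc : 'M[R]_(p, n)).
Variables (AK : 'M[R]_q) (BK : 'M[R]_(q, p)) (CK : 'M[R]_(m, q)).
Variables (AKr : 'M[R]_qr) (BKr : 'M[R]_(qr, p)) (CKr : 'M[R]_(m, qr)).

Notation K := (transfer AK BK CK).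
Notation Kr := (transfer AKr BKr CKr).
Notation Delta := (Kr - K).
Notation X := (loopX A B Cc AK BK CK).
Notation XK := (loopXK A B Cc AK BK CK).
Notation KX := (loopKX A B Cc AK BK CK).
Notation KY := (loopKY A B Cc AK BK CK).
Notation Xr := (loopX A B Cc AKr BKr CKr).
Notation XKr := (loopXK A B Cc AKr BKr CKr).
Notation KXr := (loopKX A B Cc AKr BKr CKr).
Notation KYr := (loopKY A B Cc AKr BKr CKr).

Hypothesis hM : hurwitz (closed_loop_mx A B Cc AK BK CK).
Hypothesis hDelta : (hinf_norm Delta < (hinf_norm X)^-1)%E.

Lemma X_fin : hinf_norm X \is a fin_num.
Proof. apply: hinf_fin_sproper; [exact: msproper_transfer|exact: mstable_transfer]. Qed.
Lemma KX_fin : hinf_norm KX \is a fin_num.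
Proof. apply: hinf_fin_sproper; [exact: msproper_transfer|exact: mstable_transfer]. Qed.
Lemma Y_fin : hinf_norm (1%:M + XK) \is a fin_num.
Proof. apply: hinf_fin_1D; [exact: msproper_transfer|exact: mstable_transfer]. Qed.

Lemma Delta_fin : hinf_norm Delta \is a fin_num.
Proof. by have [] := hinf_lt_inv X_fin hDelta. Qed.

Lemma gain_lt1 : hinf X * hinf Delta < 1.
Proof. by have [] := hinf_lt_inv X_fin hDelta. Qed.

Lemma gain_ge0 : 0 <= hinf X * hinf Delta.
Proof. by rewrite mulr_ge0 ?hinf_ge0. Qed.

Lemma msproper_Delta : msproper Delta.
Proof. by apply: msproperD; [|apply: msproperN]; exact: msproper_transfer. Qed.

Lemma mstable_Delta : mstable Delta.
Proof. exact: RHinf_mstable (hinf_norm_RHinf Delta_fin). Qed.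

Let regT (m' p' : nat) (B' : 'M[R]_(n + q, m')) (C' : 'M[R]_(p', n + q)) s :
  0 <= Re s -> mregular s (transfer (closed_loop_mx A B Cc AK BK CK) B' C').
Proof. exact: mregular_transfer. Qed.

Let regD s : 0 <= Re s -> mregular s Delta.
Proof. exact: mstable_regular mstable_Delta. Qed.

Lemma loop_gain w k (V : 'M[C]_(p, k)) :
  frob (meval (w *i) X *m meval (w *i) Delta *m V) <= hinf X * hinf Delta * frob V.
Proof.
rewrite -mulmxA; apply: le_trans (frob_mul_hinfl _ _ X_fin) _.
rewrite -mulrA ler_wpM2l ?hinf_ge0 //; exact: frob_mul_hinfl Delta_fin.
Qed.

Lemma loop_unit s : 0 <= Re s -> 1%:M - meval s X *m meval s Delta \in unitmx.
Proof.
move=> s0; rewrite -mevalM; [|exact: regT|exact: regD].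
apply: small_gain gain_ge0 gain_lt1 _ _ s0.
- by apply: msproperM; [exact: msproper_transfer|exact: msproper_Delta].
- by apply: mstableM; [exact: mstable_transfer|exact: mstable_Delta].
- move=> w k V; rewrite mevalM; [exact: loop_gain|exact: regT|exact: regD].
Qed.

Lemma mregular_loop_inv s : 0 <= Re s ->
  1%:M - X *m Delta \in unitmx /\ mregular s (invmx (1%:M - X *m Delta)).
Proof.
move=> s0; have h : mregular s (X *m Delta) by apply: mregularM; [exact: regT|exact: regD].
apply: mregular_invmx.
  by apply: mregularD; [exact: mregular1|exact: mregularN].
rewrite mevalD; [|exact: mregular1|exact: mregularN].
rewrite meval1 mevalN // mevalM; [exact: loop_unit|exact: regT|exact: regD].
Qed.

(** The perturbed closed-loop transfer matrices are built from stable matrices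
    and from (I - X Delta)^-1, which is stable by the small gain theorem. *)
Lemma robust_stability : minimal A B Cc -> minimal AKr BKr CKr ->
  hurwitz (closed_loop_mx A B Cc AKr BKr CKr).
Proof.
move=> mG mKr s; rewrite ltNge; apply: contraTN => s0.
have [u hZ] := mregular_loop_inv s0.
have solve k (V W : 'M[RF]_(p, k)) : W = V + X *m Delta *m W -> mregular s V -> mregular s W.
  move=> E hV; have -> : W = invmx (1%:M - X *m Delta) *m V.
    have -> : V = (1%:M - X *m Delta) *m W.
      by rewrite mulmxBl mul1mx {1}E addrK.
    by rewrite mulmxA mulVmx // mul1mx.
  exact: mregularM.
have h1 : mregular s Xr by apply: solve (perturbed_X _ _ _ _ _ _ _ _ _) _; exact: regT.
have h2 : mregular s (1%:M + XKr).
  apply: solve (perturbed_sensitivity _ _ _ _ _ _ _ _ _) _.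
  by apply: mregularD; [exact: mregular1|exact: regT].
have h2' : mregular s XKr.
  have -> : XKr = (1%:M + XKr) - 1%:M by rewrite addrC addKr.
  by apply: mregularD => //; apply: mregularN; exact: mregular1.
have hK : mregular s (1%:M + KX) by apply: mregularD; [exact: mregular1|exact: regT].
apply: minimal_regular => //.
- rewrite (perturbed_KX A B Cc AK BK CK); apply: mregularD; first exact: regT.
  by apply: mregularM => //; apply: mregularM => //; exact: regD.
- rewrite (perturbed_KY A B Cc AK BK CK); apply: mregularD; first exact: regT.
  by apply: mregularM => //; apply: mregularM => //; exact: regD.
Qed.

(** From W = V + (W - V). *)
Lemma frob_fixpoint (g : R) a b (V W : 'M[C]_(a, b)) : g < 1 ->
  frob (W - V) <= g * frob W -> frob W <= (1 - g)^-1 * frob V.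
Proof.
move=> g1 h; rewrite ler_pdivlMl ?subr_gt0 // mulrBl mul1r lerBlDr.
by rewrite -{1}(subrK V W) addrC; apply: le_trans (frobD _ _) _; rewrite lerD2l.
Qed.

Notation kappa := (1 - hinf X * hinf Delta)^-1.

Section Pointwise.
Hypothesis hMr : hurwitz (closed_loop_mx A B Cc AKr BKr CKr).
Variable w : R.
Notation ev F := (meval (w *i) F).

Let w0 : 0 <= Re (w *i). Proof. by []. Qed.
Let regr (m' p' : nat) (B' : 'M[R]_(n + qr, m')) (C' : 'M[R]_(p', n + qr)) :
  mregular (w *i) (transfer (closed_loop_mx A B Cc AKr BKr CKr) B' C').
Proof. exact: mregular_transfer. Qed.
Let reg (m' p' : nat) (B' : 'M[R]_(n + q, m')) (C' : 'M[R]_(p', n + q)) :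
  mregular (w *i) (transfer (closed_loop_mx A B Cc AK BK CK) B' C').
Proof. exact: mregular_transfer. Qed.
Let regd : mregular (w *i) Delta := regD w0.
Let rX : mregular (w *i) X. Proof. exact: reg. Qed.
Let rXK : mregular (w *i) XK. Proof. exact: reg. Qed.
Let rKX : mregular (w *i) KX. Proof. exact: reg. Qed.
Let rKY : mregular (w *i) KY. Proof. exact: reg. Qed.
Let rXr : mregular (w *i) Xr. Proof. exact: regr. Qed.
Let rXKr : mregular (w *i) XKr. Proof. exact: regr. Qed.
Let regXD : mregular (w *i) (X *m Delta).
Proof. exact: mregularM. Qed.
Let regY : mregular (w *i) (1%:M + XK).
Proof. by apply: mregularD; [exact: mregular1|exact: reg]. Qed.
Let regYr : mregular (w *i) (1%:M + XKr).
Proof. by apply: mregularD; [exact: mregular1|exact: regr]. Qed.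
Let regKX : mregular (w *i) (1%:M + KX).
Proof. by apply: mregularD; [exact: mregular1|exact: reg]. Qed.

Lemma frob_Xr : frob (ev Xr) <= kappa * frob (ev X).
Proof.
apply: frob_fixpoint gain_lt1 _.
rewrite {1}(perturbed_X A B Cc AK BK CK) mevalD //; last exact: mregularM.
by rewrite addrC addKr mevalM // mevalM // loop_gain.
Qed.

Lemma frob_XKr : frob (ev XKr) <= kappa * (frob (ev XK) + hinf Delta * frob (ev X)).
Proof.
have E : ev XKr = ev XK + ev X *m ev Delta + ev X *m ev Delta *m ev XKr.
  rewrite {1}(perturbed_XK A B Cc AK BK CK) mevalD //; last exact: mregularM.
  rewrite mevalM // (mevalD (@mregular1 R (w *i) _)) // meval1 mulmxDr mulmx1 addrA.
  by rewrite mevalM.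
apply: le_trans (frob_fixpoint (V := ev XK + ev X *m ev Delta) gain_lt1 _) _.
  by rewrite {1}E addrC addKr loop_gain.
rewrite ler_wpM2l ?invr_ge0 ?subr_ge0 ?(ltW gain_lt1) //.
apply: le_trans (frobD _ _) _; rewrite lerD2l; exact: frob_mul_hinfr Delta_fin.
Qed.

Let z := invmx (1%:M - ev X *m ev Delta).

Let z_solve k (V W : 'M[C]_(p, k)) : W = V + ev X *m ev Delta *m W -> W = z *m V.
Proof.
move=> E; have -> : V = (1%:M - ev X *m ev Delta) *m W by rewrite mulmxBl mul1mx {1}E addrK.
by rewrite mulmxA mulVmx ?mul1mx //; exact: loop_unit.
Qed.

Let frob_dz : frob (ev Delta *m z) <= kappa * frob (ev Delta).
Proof.
have zE : z = 1%:M + ev X *m ev Delta *m z.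
  have := mulmxV (loop_unit w0); rewrite mulmxBl mul1mx -/z => <-.
  by rewrite subrK.
apply: frob_fixpoint gain_lt1 _.
have -> : ev Delta *m z - ev Delta = ev Delta *m (ev X *m (ev Delta *m z)).
  by rewrite {1}zE mulmxDr mulmx1 addrC addKr !mulmxA.
apply: le_trans (frob_mul_hinfl _ _ Delta_fin) _.
rewrite [hinf X * _]mulrC -mulrA ler_wpM2l ?hinf_ge0 //; exact: frob_mul_hinfl X_fin.
Qed.

Let frob_1KX k (V : 'M[C]_(m, k)) : frob (ev (1%:M + KX) *m V) <= (1 + hinf KX) * frob V.
Proof.
rewrite (mevalD (@mregular1 R (w *i) _)) // meval1 mulmxDl mul1mx mulrDl mul1r.
apply: le_trans (frobD _ _) _; rewrite lerD2l; exact: frob_mul_hinfl KX_fin.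
Qed.

(** The factor Delta (I - X Delta)^-1 is estimated as a whole, so that the
    Frobenius norm falls on Delta, whose H2 norm enters the bound. *)
Let frob_term k (F : 'M[RF]_(p, k)) (Fr : 'M[RF]_(p, k)) :
  mregular (w *i) F -> mregular (w *i) Fr -> hinf_norm F \is a fin_num ->
  Fr = F + X *m Delta *m Fr ->
  frob (ev ((1%:M + KX) *m (Delta *m Fr))) <=
    kappa * ((1 + hinf KX) * hinf F * frob (ev Delta)).
Proof.
move=> rF rFr fF E; have Ez : ev Fr = z *m ev F.
  apply: z_solve; rewrite {1}E mevalD //; last exact: mregularM.
  by rewrite mevalM // mevalM.
rewrite mevalM //; last exact: mregularM.
apply: le_trans (frob_1KX _) _.
rewrite mulrCA -mulrA ler_wpM2l ?addr_ge0 ?hinf_ge0 //.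
rewrite mevalM // Ez mulmxA; apply: le_trans (frob_mul_hinfr _ _ fF) _.
by rewrite ler_wpM2l ?hinf_ge0.
Qed.

Let kappa_ge1 : 1 <= kappa.
Proof.
by rewrite invf_ge1 ?subr_gt0 ?gain_lt1 // gerBl gain_ge0.
Qed.

Let frob_kappa a b (F : 'M[C]_(a, b)) : frob F <= kappa * frob F.
Proof. by rewrite ler_peMl ?frob_ge0. Qed.

Lemma frob_KYr : frob (ev KYr) <=
  kappa * (frob (ev KY) + (1 + hinf KX) * hinf (1%:M + XK) * frob (ev Delta)).
Proof.
rewrite (perturbed_KY A B Cc AK BK CK) mevalD //; last by do 2 apply: mregularM => //.
apply: le_trans (frobD _ _) _; rewrite mulrDr lerD //.
exact: frob_term Y_fin (perturbed_sensitivity _ _ _ _ _ _ _ _ _).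
Qed.

Lemma frob_KXr : frob (ev KXr) <=
  kappa * (frob (ev KX) + (1 + hinf KX) * hinf X * frob (ev Delta)).
Proof.
rewrite (perturbed_KX A B Cc AK BK CK) mevalD //; last by do 2 apply: mregularM => //.
apply: le_trans (frobD _ _) _; rewrite mulrDr lerD //.
exact: frob_term X_fin (perturbed_X _ _ _ _ _ _ _ _ _).
Qed.

End Pointwise.

End RobustStability.

(** * The H2 norm *)

Section H2Norm.
Variable R : realType.
Notation mu := (@lebesgue_measure R).
Notation C := R[i].
Notation Re := (@complex.Re R).
Notation Im := (@complex.Im R).
Notation RF := (ratfun R).
Notation pC := (map_poly (@toC R)).

(** For a nonnegative integrand the principal value is a Lebesgue integral, by
    monotone convergence. *)
Lemma PVr_integral (f : R -> R) (c : R) : (forall w, 0 <= f w) -> PVr f c ->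
  mu.-integrable setT (EFin \o f) /\ \int[mu]_(w in setT) f w = c.
Proof.
move=> f0 [cf lc].
have mf : measurable_fun setT f by exact: continuous_measurable_fun.
pose F (k : nat) : set R := `[- k%:R, k%:R]%classic.
have FT : \bigcup_k F k = setT.
  apply/seteqP; split=> // x _.
  have [k hk] : exists k : nat, `|x| <= k%:R.
    by have /cvgryPge /(_ `|x|) [k _ hk] := @cvgr_idn R; exists k; apply: hk => /=.
  by exists k => //; rewrite /F /= in_itv /= -ler_norml.
have lim : (\int[mu]_(x in F k) (f x)%:E)%E @[k --> \oo] --> (\int[mu]_x (f x)%:E)%E.
  rewrite -FT; apply: ge0_nondecreasing_set_cvg_integral.
  - move=> a b ab; apply/subsetPset => x; rewrite /F /= !in_itv /= => /andP[h1 h2].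
    have abR : (a%:R : R) <= b%:R by rewrite ler_nat.
    by rewrite (le_trans _ h1) ?lerN2 // (le_trans h2).
  - by move=> k; exact: measurable_itv.
  - by move=> k; apply/measurable_EFinP; exact: measurable_funTS.
  - by move=> k x _; rewrite lee_fin.
have E k : (\int[mu]_(x in F k) (f x)%:E)%E = (\int[mu]_(x in `[- k%:R, k%:R]) f x)%:E.
  rewrite /Rintegral fineK //; apply: integrable_fin_num => //.
  exact: continuous_itv_integrable.
have EI : (\int[mu]_x (f x)%:E)%E = c%:E.
  move: lim; rewrite (_ : (fun k => _) = (fun k : nat => (\int[mu]_(x in `[- k%:R, k%:R]) f x)%:E)); last first.
    by apply/funext => k; rewrite E.
  have lc' : (\int[mu]_(x in `[- k%:R, k%:R]) f x)%:E @[k --> \oo] --> c%:E.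
    by apply: cvg_EFin; [exact: nearW|exact: lc].
  move=> lim; exact: (cvg_unique (@ereal_hausdorff R) lim lc').
split; last by rewrite /Rintegral EI.
apply/integrableP; split; first exact/measurable_EFinP.
rewrite (_ : (fun x => _) = (fun x => (f x)%:E)); first by rewrite EI ltry.
by apply/funext => x /=; rewrite ger0_norm.
Qed.

Lemma integrable_oneDsqV (c : R) : mu.-integrable setT (EFin \o (fun w : R => c / (1 + w ^+ 2))).
Proof.
have l0 : Re (-1) < 0 by rewrite cReN /= ltrN10.
have [Pr _] := PV_kern l0.
have [] := PVr_integral _ Pr.
  move=> w; rewrite -[X in 0 <= X]/(Re (kern (-1) w)) Re_kern cReN /=.
  by rewrite opprK mul1r invr_ge0 addr_ge0 ?sqr_ge0.
move=> int _; have := integrableZl measurableT c int; congr (mu.-integrable _ _).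
apply/funext => w; rewrite -[LHS]/((c * Re (kern (-1) w))%:E). rewrite Re_kern cReN cImN /=.
by rewrite opprK mul1r oppr0 subr0 sqrrN expr1n addrC.
Qed.

(** The coefficients are real; so the value at -iw is the conjugate of the value at
    iw, and the transpose in the H2 norm is a conjugate transpose. *)
Lemma reval_conj (f : RF) (s : C) : reval f (conjc s) = conjc (reval f s).
Proof.
have H (a : {poly R}) : (pC a).[conjc s] = conjc (pC a).[s].
  elim/poly_ind: a => [|a c IH]; first by rewrite pCE rmorph0 !horner0 rmorph0.
  rewrite pCD pCM !(hornerD, hornerM) IH !rmorphD !rmorphM /=.
  by rewrite pCE map_polyX map_polyC !hornerX !hornerC conjc_real.
by rewrite /reval !H rmorphM /= conjc_inv.
Qed.

Lemma trace_freq_resp p m (F : 'M[RF]_(p, m)) w :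
  Re (\tr ((freq_resp F (- w))^T *m freq_resp F w)) = frob2 (freq_resp F w).
Proof.
have -> : (freq_resp F (- w))^T = hct (freq_resp F w).
  apply/matrixP => i j; rewrite !mxE -[RHS]/(conjc _) -reval_conj.
  by congr reval; apply: complex_ext => //=; rewrite oppr0.
by rewrite -frob2E.
Qed.

Lemma h2_sqr p m (F : 'M[RF]_(p, m)) :
  h2 F ^+ 2 = (2 * pi)^-1 * \int[mu]_(w in setT) frob2 (freq_resp F w).
Proof.
have E : (fun w => Re (\tr ((freq_resp F (- w))^T *m freq_resp F w))) =
    (fun w => frob2 (freq_resp F w)) by apply/funext => w; exact: trace_freq_resp.
rewrite /h2 E.
rewrite sqr_sqrtr // mulr_ge0 ?invr_ge0 ?mulr_ge0 ?pi_ge0 //.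
by apply: Rintegral_ge0 => w _; exact: frob2_ge0.
Qed.

Lemma h2_ge0 p m (F : 'M[RF]_(p, m)) : 0 <= h2 F.
Proof. exact: sqrtr_ge0. Qed.

Lemma continuous_sumR (I : Type) (r : seq I) (f : I -> R -> R) :
  (forall i, continuous (f i)) -> continuous (fun w => \sum_(i <- r) f i w).
Proof.
move=> cf; elim: r => [|i r IH] x.
  by rewrite (_ : (fun _ => _) = cst 0); [exact: cvg_cst|apply/funext => w; rewrite big_nil].
rewrite (_ : (fun _ => _) = f i \+ (fun w => \sum_(j <- r) f j w)).
  by apply: continuousD; [exact: cf|exact: IH].
by apply/funext => w; rewrite big_cons.
Qed.

Lemma integrable_frob2 p m (F : 'M[RF]_(p, m)) : msproper F -> mstable F ->
  mu.-integrable setT (EFin \o (fun w => frob2 (freq_resp F w))).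
Proof.
move=> sF hF; have [c c0 hc] := frob2_bound sF hF.
apply: le_integrable (integrable_oneDsqV c) => //.
- apply/measurable_EFinP; apply: continuous_measurable_fun.
  apply: continuous_sumR => i; apply: continuous_sumR => j.
  have [c1 c2] := stable_ccont (@hF i j).
  rewrite (_ : (fun w => _) = ((fun w => Re (reval (F i j) (w *i))) \* (fun w => Re (reval (F i j) (w *i))))
     \+ ((fun w => Im (reval (F i j) (w *i))) \* (fun w => Im (reval (F i j) (w *i))))).
    by move=> x; apply: continuousD; apply: continuousM; (exact: c1 || exact: c2).
  by apply/funext => w; rewrite mxE /nsq !expr2.
- move=> w _ /=; rewrite lee_fin ger0_norm ?frob2_ge0 //.
  by apply: le_trans (hc w) _; rewrite ler_norm.
Qed.

(** Transfer matrices of different sizes are compared frequency by frequency;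
    the weights of [sqrD_weighted] keep the integrated inequality sharp. *)
Lemma h2_triangle p m p1 m1 p2 m2 (F : 'M[RF]_(p, m)) (F1 : 'M[RF]_(p1, m1))
    (F2 : 'M[RF]_(p2, m2)) (k a : R) :
  msproper F -> mstable F -> msproper F1 -> mstable F1 -> msproper F2 -> mstable F2 ->
  0 <= k -> 0 <= a ->
  (forall w, frob (freq_resp F w) <= k * (frob (freq_resp F1 w) + a * frob (freq_resp F2 w))) ->
  h2 F <= k * (h2 F1 + a * h2 F2).
Proof.
move=> sF hF sF1 hF1 sF2 hF2 k0 a0 le.
have i0 := integrable_frob2 sF hF.
have i1 := integrable_frob2 sF1 hF1; have i2 := integrable_frob2 sF2 hF2.
have pi2 : 0 < 2 * pi :> R by rewrite mulr_gt0 ?pi_gt0.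
rewrite -(ler_pXn2r (n := 2)) ?nnegrE ?h2_ge0 //; last first.
  by rewrite mulr_ge0 // addr_ge0 ?mulr_ge0 ?h2_ge0.
rewrite mulrDr; apply: sqrD_weighted; rewrite ?mulr_ge0 ?h2_ge0 // => t t0.
rewrite !exprMn !h2_sqr.
have E : (1 + t) * (k ^+ 2 * ((2 * pi)^-1 * \int[mu]_(w in setT) frob2 (freq_resp F1 w))) +
   (1 + t^-1) * (k ^+ 2 * (a ^+ 2 * ((2 * pi)^-1 * \int[mu]_(w in setT) frob2 (freq_resp F2 w)))) =
   (2 * pi)^-1 * (((1 + t) * k ^+ 2) * \int[mu]_(w in setT) frob2 (freq_resp F1 w) +
     ((1 + t^-1) * (k ^+ 2 * a ^+ 2)) * \int[mu]_(w in setT) frob2 (freq_resp F2 w)) by ring.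
rewrite E ler_wpM2l ?invr_ge0 ?(ltW pi2) // -!RintegralZl // -RintegralD //; last 2 first.
- by have := integrableZl measurableT ((1 + t) * k ^+ 2) i1; congr (mu.-integrable _ _).
- by have := integrableZl measurableT ((1 + t^-1) * (k ^+ 2 * a ^+ 2)) i2; congr (mu.-integrable _ _).
apply: le_Rintegral => //.
  apply: (@eq_integrable _ _ _ mu setT _ (fun w => (((1 + t) * k ^+ 2)%:E * (EFin \o (fun w => frob2 (freq_resp F1 w))) w
     + ((1 + t^-1) * (k ^+ 2 * a ^+ 2))%:E * (EFin \o (fun w => frob2 (freq_resp F2 w))) w)%E)) => //.
  by apply: integrableD => //; exact: integrableZl.
move=> w _; rewrite -!frob_sqr.
have h : 0 <= k * (frob (freq_resp F1 w) + a * frob (freq_resp F2 w)).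
  by rewrite mulr_ge0 // addr_ge0 ?mulr_ge0 ?frob_ge0.
apply: (@le_trans _ _ ((k * (frob (freq_resp F1 w) + a * frob (freq_resp F2 w))) ^+ 2)).
  by rewrite ler_pXn2r ?nnegrE ?frob_ge0 //; exact: le.
move: (frob (freq_resp F1 w)) (frob (freq_resp F2 w)) => x y.
have tn : t != 0 by rewrite gt_eqF.
rewrite -subr_ge0.
have -> : (1 + t) * k ^+ 2 * x ^+ 2 + (1 + t^-1) * (k ^+ 2 * a ^+ 2) * y ^+ 2 -
   (k * (x + a * y)) ^+ 2 = (k * (t * x - a * y)) ^+ 2 / t by field.
by rewrite divr_ge0 ?sqr_ge0 // ltW.
Qed.

(** Parseval's identity applied to the columns of B. *)
Lemma h2_transfer n m p (M : 'M[R]_n) (B : 'M[R]_(n, m)) (Cc : 'M[R]_(p, n)) (Pi : 'M[R]_n) :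
  hurwitz M -> M^T *m Pi + Pi *m M = - (Cc^T *m Cc) ->
  h2 (transfer M B Cc) ^+ 2 = \tr (B^T *m Pi *m B).
Proof.
move=> hM EPi.
have P : PVr (fun w => frob2 (freq_resp (transfer M B Cc) w)) (2 * pi * \tr (B^T *m Pi *m B)).
  have := PVr_sum (index_enum 'I_m) (fun j => PVr_lyapunov hM B j j EPi).
  apply: eq_PVr => [w|]; last by rewrite -mulr_sumr.
  rewrite freq_respE meval_transfer // frob2_reim !remx_cmxMr !immx_cmxMr.
  rewrite !remx_cmxMl !immx_cmxMl /mxtrace; apply: eq_bigr => j _.
  rewrite !trmx_mul mulmxDr mulmxDl !mulmxA [RHS]mxE [LHS]mxE; congr (_ + _).
have [_ I] := PVr_integral (fun w => frob2_ge0 _) P.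
rewrite h2_sqr I mulrA mulVf ?mul1r // gt_eqF // mulr_gt0 ?pi_gt0 //.
Qed.

End H2Norm.

(** * Primitives on a half-line and Gronwall's inequality *)

Section Primitives.
Variable R : realType.
Notation mu := (@lebesgue_measure R).
Implicit Types (f g F G : R -> R).

(** Continuity on the closed half-line, with the one-sided notion at 0, stated on
    the compact intervals over which one integrates. *)
Definition ray_continuous f := forall T : R, {within `[0, T], continuous f}.

Lemma ray_continuous_continuous f : continuous f -> ray_continuous f.
Proof. by move=> cf T; exact: continuous_subspaceT. Qed.

Lemma ray_continuousD f g : ray_continuous f -> ray_continuous g -> ray_continuous (fun t => f t + g t).
Proof. by move=> cf cg T x; apply: cvgD; [exact: cf|exact: cg]. Qed.

Lemma ray_continuousM f g : ray_continuous f -> ray_continuous g -> ray_continuous (fun t => f t * g t).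
Proof. by move=> cf cg T x; apply: cvgM; [exact: cf|exact: cg]. Qed.

Lemma ray_continuous_cst (c : R) : ray_continuous (fun=> c).
Proof. by apply: ray_continuous_continuous => x; exact: cvg_cst. Qed.

Lemma ray_continuousN f : ray_continuous f -> ray_continuous (fun t => - f t).
Proof. by move=> cf T x; apply: cvgN; exact: cf. Qed.

Lemma ray_continuous_int f t : ray_continuous f -> mu.-integrable `[0, t] (EFin \o f).
Proof.
by move=> cf; apply: continuous_compact_integrable; [exact: segment_compact|exact: cf].
Qed.

(** The integral form of a differential equation on the half-line, which is
    meaningful at the end point 0 as well. *)
Definition is_primitive F f := ray_continuous f /\
  forall t, 0 <= t -> F t = F 0 + \int[mu]_(s in `[0, t]) f s.

Lemma is_primitive_wcont F f : is_primitive F f -> ray_continuous F.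
Proof.
move=> [cf EF] T; have [T0|T0] := leP 0 T; last first.
  by rewrite set_itv_ge ?bnd_simp -?ltNge //; exact: continuous_subspace0.
have H : {within `[0, T], continuous (fun t => F 0 + \int[mu]_(s in `[0, t]) f s)}.
  move=> x; apply: cvgD; first exact: cvg_cst.
  exact: (parameterized_integral_continuous T0 (ray_continuous_int T cf)).
apply: subspace_eq_continuous H.
by move=> t; rewrite inE /= in_itv /= => /andP[t0 _]; apply/esym/EF.
Qed.

Lemma is_primitive_derive F f (x : R) : is_primitive F f -> 0 < x -> is_derive x 1 F (f x).
Proof.
move=> [cf EF] x0.
have x1 : x < x + 1 by rewrite ltrDl.
have fx : {for x, continuous f}.
  have /continuous_within_itvP [] // := cf (x + 1); first by rewrite (lt_trans x0).
  by move=> h _ _; apply: h; rewrite in_itv /= x0.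
have [d1 d2] := continuous_FTC1_closed x1 (ray_continuous_int (x + 1) cf) x0 fx.
have near : {near x, F =1 (fun t => F 0 + \int[mu]_(s in `[0, t]) f s)}.
  near=> t; apply: EF; apply: ltW; near: t; exact: lt_nbhsr.
have dG : is_derive x 1 (fun t => F 0 + \int[mu]_(s in `[0, t]) f s) (f x).
  have d3 : is_derive x 1 (fun t => \int[mu]_(s in `[0, t]) f s) (f x).
    by apply: DeriveDef; [exact: d1|rewrite -derive1E; exact: d2].
  by apply: is_derive_eq (is_deriveD (is_derive_cst (F 0) x 1) d3) _; rewrite add0r.
apply: near_eq_is_derive dG; near=> t; apply/esym; near: t; exact: near.
Unshelve. all: by end_near. Qed.

Lemma is_primitive_of_derive F f : ray_continuous F -> ray_continuous f ->
  (forall x : R, 0 < x -> is_derive x 1 F (f x)) -> is_primitive F f.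
Proof.
move=> cF cf dF; split=> // t; rewrite le_eqVlt => /predU1P[<-|t0].
  by rewrite set_itv1 Rintegral_set1 addr0.
rewrite /Rintegral (@continuous_FTC2 _ f F 0 t) //; first by rewrite -EFinB /= addrC subrK.
  have /continuous_within_itvP [] // := cF t => _ h1 h2.
  by split=> // x; rewrite in_itv /= => /andP[x0 _]; apply: ex_derive; exact: dF.
by move=> x; rewrite in_itv /= => /andP[x0 _]; rewrite derive1E; apply: derive_val; exact: dF.
Qed.

(** The product rule, obtained from derivatives inside the half-line and
    continuity at 0. *)
Lemma is_primitiveM F f G g : is_primitive F f -> is_primitive G g ->
  is_primitive (fun t => F t * G t) (fun t => f t * G t + F t * g t).
Proof.
move=> pF pG; have cF := is_primitive_wcont pF; have cG := is_primitive_wcont pG.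
apply: is_primitive_of_derive; first exact: ray_continuousM.
  by apply: ray_continuousD; apply: ray_continuousM => //; [case: pF|case: pG].
move=> x x0; apply: is_derive_eq (is_deriveM (is_primitive_derive pF x0) (is_primitive_derive pG x0)) _.
by rewrite /GRing.scale /= addrC [G x * _]mulrC.
Qed.

Lemma is_primitive_exp (c : R) : is_primitive (fun t => expR (c * t)) (fun t => c * expR (c * t)).
Proof.
have ce : continuous (fun t : R => expR (c * t)).
  move=> x; apply: continuous_comp; last exact: continuous_expR.
  by apply: cvgMr; exact: cvg_id.
apply: is_primitive_of_derive; first exact: ray_continuous_continuous.
  by apply: ray_continuousM; [exact: ray_continuous_cst|exact: ray_continuous_continuous].
move=> x _; apply: is_derive_eq.
by rewrite /GRing.scale /= mulr1 mulrC.
Qed.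

Lemma is_primitive_le F f t : is_primitive F f -> (forall s, 0 <= s <= t -> f s <= 0) -> 0 <= t -> F t <= F 0.
Proof.
move=> [cf EF] f0 t0; rewrite EF // gerDl.
apply: (@le_trans _ _ (\int[mu]_(s in `[0, t]) (0 : R))); last first.
  by rewrite Rintegral_cst // mul0r.
apply: le_Rintegral => //; first exact: ray_continuous_int.
  by apply: ray_continuous_int; exact: ray_continuous_cst.
Qed.

Lemma is_primitive_int f : ray_continuous f -> is_primitive (fun t => \int[mu]_(s in `[0, t]) f s) f.
Proof. by move=> cf; split=> // t t0; rewrite set_itv1 Rintegral_set1 add0r. Qed.

Lemma is_primitiveD F f G g : is_primitive F f -> is_primitive G g -> is_primitive (fun t => F t + G t) (fun t => f t + g t).
Proof.
move=> [cf EF] [cg EG]; split; first exact: ray_continuousD.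
by move=> t t0; rewrite RintegralD //; [rewrite EF // EG // addrACA|exact: ray_continuous_int|exact: ray_continuous_int].
Qed.

Lemma is_primitiveZ F f (k : R) : is_primitive F f -> is_primitive (fun t => k * F t) (fun t => k * f t).
Proof.
move=> [cf EF]; split; first by apply: ray_continuousM => //; exact: ray_continuous_cst.
by move=> t t0; rewrite RintegralZl //; [rewrite EF // mulrDr|exact: ray_continuous_int].
Qed.

(** The function exp(- c t) times the integral of g, minus the integral of a, is
    nonincreasing. *)
Lemma gronwall (g a : R -> R) (c T : R) : ray_continuous g -> ray_continuous a -> 0 <= T -> 0 <= c ->
  (forall t, 0 <= t <= T -> 0 <= a t) ->
  (forall t, 0 <= t <= T -> g t <= a t + c * \int[mu]_(s in `[0, t]) g s) ->
  \int[mu]_(s in `[0, T]) g s <= expR (c * T) * \int[mu]_(s in `[0, T]) a s.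
Proof.
move=> cg ca T0 c0 a0 h.
have p := is_primitiveD (is_primitiveM (is_primitive_exp (- c)) (is_primitive_int cg)) (is_primitiveZ (-1) (is_primitive_int ca)).
have : expR (- c * T) * \int[mu]_(s in `[0, T]) g s + -1 * \int[mu]_(s in `[0, T]) a s <= 0.
  have := is_primitive_le p _ T0; rewrite !set_itv1 !Rintegral_set1 !mulr0 addr0; apply.
  move=> s sT; have e1 : expR (- c * s) <= 1.
    by rewrite -expR0 ler_expR mulNr oppr_le0 mulr_ge0 //; case/andP: sT.
  have e0 : 0 <= expR (- c * s) by exact: expR_ge0.
  have hs := h _ sT; have as0 := a0 _ sT.
  move: e1 e0 hs as0; move: (expR _) (\int[mu]_(s in _) g s) (g s) (a s) => e I x y.
  move=> e1 e0 hs y0.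
  have : e * (x - c * I) <= e * y by rewrite ler_wpM2l // lerBlDr.
  have : e * y <= y by rewrite ler_piMl.
  lra.
rewrite mulN1r subr_le0 => H.
by rewrite -ler_pdivrMl ?expR_gt0 // -expRN -mulNr.
Qed.

Lemma gronwall0 (g : R -> R) (c T : R) : ray_continuous g -> 0 <= T -> 0 <= c ->
  (forall t, 0 <= t <= T -> g t <= c * \int[mu]_(s in `[0, t]) g s) -> g T <= 0.
Proof.
move=> cg T0 c0 h.
have I : \int[mu]_(s in `[0, T]) g s <= 0.
  have := @gronwall g (fun=> 0) c T cg (@ray_continuous_cst 0) T0 c0 (fun _ _ => lexx 0).
  rewrite Rintegral_cst // mul0r mulr0; apply => t tT; rewrite add0r; exact: h.
apply: (le_trans (h T _)); first by rewrite lexx T0.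
by rewrite mulr_ge0_le0.
Qed.

(** The function exp(k t) (G - c / k) is nonincreasing. *)
Lemma dissipation_bound (G g : R -> R) (k c : R) : is_primitive G g -> 0 < k ->
  (forall t, 0 <= t -> g t <= - k * G t + c) -> forall t, 0 <= t -> G t <= `|G 0| + `|c| / k.
Proof.
move=> pG k0 h t t0.
have p := is_primitiveD (is_primitiveM (is_primitive_exp k) pG) (is_primitiveZ (- (c / k)) (is_primitive_exp k)).
have := is_primitive_le p _ t0; rewrite !mulr0 !expR0 !mul1r mulr1 => H.
have {}H : expR (k * t) * G t - c / k * expR (k * t) <= G 0 - c / k.
  rewrite -mulNr; apply: H => s /andP[s0 _].
  have := h _ s0; have e0 : 0 <= expR (k * s) by exact: expR_ge0.
  have -> : k * expR (k * s) * G s + expR (k * s) * g s + - (c / k) * (k * expR (k * s))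
     = expR (k * s) * (g s - (- k * G s + c)) by field; rewrite gt_eqF.
  by move=> gs; rewrite mulr_ge0_le0 // subr_le0.
have e1 : 1 <= expR (k * t) by rewrite -expR0 ler_expR mulr_ge0 // ltW.
have ck : c / k <= `|c| / k by rewrite ler_wpM2r ?invr_ge0 ?(ltW k0) // ler_norm.
have ck' : - (c / k) <= `|c| / k.
  by rewrite -mulNr ler_wpM2r ?invr_ge0 ?(ltW k0) // -normrN ler_norm.
have g0 := ler_norm (G 0); have g1 : 0 <= `|G 0| by exact: normr_ge0.
have ck0 : 0 <= `|c| / k by rewrite divr_ge0 // ltW.
rewrite -(ler_pM2l (expR_gt0 (k * t))).
have q1 : 0 <= (`|c| / k - c / k) * (expR (k * t) - 1) by rewrite mulr_ge0 // subr_ge0.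
have q2 : 0 <= `|G 0| * (expR (k * t) - 1) by rewrite mulr_ge0 // subr_ge0.
move: H q1 q2 g0 ck0; move: (c / k) (`|c| / k) (expR _) (G t) (G 0) (`|G 0|) => x y e u v w.
by nra.
Qed.

End Primitives.

(** * Square-integrable processes and Fubini's theorem *)

Section Processes.
Variable R : realType.
Notation mu := (@lebesgue_measure R).
Context {d : measure_display} {Omega : measurableType d} (P : probability Omega R).
Notation "'Ex' f" := (Rintegral P setT f) (at level 10, f at level 9).
Implicit Types (X Y : R -> Omega -> R) (f g : Omega -> R).

Definition jointly_measurable X := measurable_fun [set: measurableTypeR R * Omega] (fun z => X z.1 z.2).

(** The bound on the second moment is part of the data so that it can be made
    uniform over a time interval. *)
Definition L2_le f (B : R) := measurable_fun setT f /\ (\int[P]_om ((f om) ^+ 2)%:E <= B%:E)%E.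

Lemma L2_le_integrable f B : L2_le f B -> P.-integrable setT (EFin \o (fun om => f om ^+ 2)).
Proof.
move=> [mf hB]; apply/integrableP; split.
  by apply/measurable_EFinP; exact: measurable_funX.
apply: le_lt_trans (ltry B); apply: le_trans hB.
by rewrite le_eqVlt; apply/orP; left; apply/eqP/eq_integral => om _ /=; rewrite ger0_norm ?sqr_ge0.
Qed.

Lemma L2_le_mul f g B B' : L2_le f B -> L2_le g B' ->
  P.-integrable setT (EFin \o (fun om => f om * g om)) /\
  (\int[P]_om `|f om * g om|%:E <= (B + B')%:E)%E.
Proof.
move=> hf hg; have i1 := L2_le_integrable hf; have i2 := L2_le_integrable hg.
have mfg : measurable_fun setT (fun om => f om * g om).
  by apply: measurable_funM; [case: hf|case: hg].
have le om : `|f om * g om| <= f om ^+ 2 + g om ^+ 2.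
  rewrite normrM -[f om ^+ 2]real_normK ?num_real // -[g om ^+ 2]real_normK ?num_real //.
  move: (`|f om|) (`|g om|) (normr_ge0 (f om)) (normr_ge0 (g om)) => a b a0 b0.
  by have := sqr_ge0 (a - b); have := mulr_ge0 a0 b0; nra.
have i12 : P.-integrable setT (EFin \o (fun om => f om ^+ 2 + g om ^+ 2)).
  exact: (integrableD measurableT i1 i2).
split.
  apply: le_integrable i12 => //; first exact/measurable_EFinP.
  by move=> om _ /=; rewrite lee_fin [leRHS]ger0_norm ?addr_ge0 ?sqr_ge0.
apply: (@le_trans _ _ (\int[P]_om ((f om ^+ 2)%:E + (g om ^+ 2)%:E))%E).
  apply: ge0_le_integral => //.
  - by apply/measurable_EFinP/measurableT_comp.
  - by apply: emeasurable_funD; [exact: (measurable_int P i1)|exact: (measurable_int P i2)].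
  - by move=> om _; rewrite -EFinD lee_fin le.
by rewrite integralD // EFinD leeD //; [case: hf|case: hg].
Qed.

Lemma L2_le_mul_le f g B B' : L2_le f B -> L2_le g B' ->
  `|Ex (fun om => f om * g om)| <= B + B'.
Proof.
move=> hf hg; have [i le] := L2_le_mul hf hg.
rewrite -lee_fin EFin_normr_Rintegral //; apply: le_trans le.
by apply: (le_trans (le_abse_integral _ _ _)) => //; exact: (measurable_int P i).
Qed.

Lemma L2_leD f g B B' : L2_le f B -> L2_le g B' ->
  L2_le (fun om => f om + g om) (2 * (B + B')).
Proof.
move=> hf hg; have i1 := L2_le_integrable hf; have i2 := L2_le_integrable hg.
split; first by apply: measurable_funD; [case: hf|case: hg].
apply: (@le_trans _ _ (\int[P]_om (2%:E * ((f om ^+ 2)%:E + (g om ^+ 2)%:E)))%E).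
  apply: ge0_le_integral => //.
  - by move=> om _; rewrite lee_fin sqr_ge0.
  - by apply/measurable_EFinP/measurable_funX/measurable_funD; [case: hf|case: hg].
  - apply: measurable_funeM; apply: emeasurable_funD.
      exact: (measurable_int P i1).
    exact: (measurable_int P i2).
  - move=> om _; rewrite -EFinD -EFinM lee_fin.
    by have := sqr_ge0 (f om - g om); move: (f om) (g om) => a b; nra.
rewrite ge0_integralZl //; last 2 first.
- by apply: emeasurable_funD; [exact: (measurable_int P i1)|exact: (measurable_int P i2)].
- by move=> om _; rewrite adde_ge0 // lee_fin sqr_ge0.
rewrite integralD // EFinM lee_pmul2l ?lte_fin // EFinD leeD //; [by case: hf|by case: hg].
Qed.

Lemma L2_leZ (k : R) f B : L2_le f B -> L2_le (fun om => k * f om) (k ^+ 2 * B).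
Proof.
move=> hf; have i1 := L2_le_integrable hf; split.
  by apply: measurable_funM => //; [case: hf].
under eq_integral do rewrite exprMn EFinM.
rewrite ge0_integralZl ?lee_fin ?sqr_ge0 //; last 2 first.
- exact: (measurable_int P i1).
- by move=> om _; rewrite lee_fin sqr_ge0.
by rewrite (EFinM (k ^+ 2) B) lee_wpmul2l ?lee_fin ?sqr_ge0 //; case: hf.
Qed.

Lemma L2_le_abs f B : L2_le f B -> L2_le (fun om => `|f om|) B.
Proof.
move=> [mf hB]; split; first exact: measurableT_comp.
by under eq_integral do rewrite real_normK ?num_real //.
Qed.

Lemma L2_le_cst (c : R) : L2_le (fun=> c) (c ^+ 2).
Proof.
split; first exact: measurable_cst.
rewrite integral_cst // (_ : _ [set: Omega] = 1%E) ?mule1 //; exact: probability_setT.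
Qed.

(** Joint measurability and locally bounded second moments serve Fubini's theorem,
    continuity of the paths serves the pathwise calculus. *)
Definition L2_process X := [/\ jointly_measurable X, forall om, continuous (fun t : R => X t om) &
  forall T, exists B, forall t, 0 <= t <= T -> L2_le (X t) B].

Lemma jointly_measurable_section X t : jointly_measurable X -> measurable_fun setT (X t).
Proof. by move=> mX; exact: (measurableT_comp mX (pair1_measurable t)). Qed.

Lemma processD X Y : L2_process X -> L2_process Y -> L2_process (fun t om => X t om + Y t om).
Proof.
move=> [mX cX bX] [mY cY bY]; split; first exact: measurable_funD.
  by move=> om x; apply: continuousD; [exact: cX|exact: cY].
move=> T; have [B hB] := bX T; have [B' hB'] := bY T.
by exists (2 * (B + B')) => t tT; apply: L2_leD; [exact: hB|exact: hB'].
Qed.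

Lemma processZ (k : R) X : L2_process X -> L2_process (fun t om => k * X t om).
Proof.
move=> [mX cX bX]; split.
- by apply: measurable_funM => //; exact: measurable_cst.
- by move=> om x; apply: continuousM; [exact: cvg_cst|exact: cX].
- by move=> T; have [B hB] := bX T; exists (k ^+ 2 * B) => t tT; apply: L2_leZ; exact: hB.
Qed.

Lemma process_abs X : L2_process X -> L2_process (fun t om => `|X t om|).
Proof.
move=> [mX cX bX]; split.
- exact: measurableT_comp.
- by move=> om x; apply: cvg_norm; exact: cX.
- by move=> T; have [B hB] := bX T; exists B => t tT; apply: L2_le_abs; exact: hB.
Qed.

Lemma process_cst (c : R) : L2_process (fun _ _ => c).
Proof.
split; first exact: measurable_cst.
  by move=> om x; exact: cvg_cst.
by move=> T; exists (c ^+ 2) => t _; exact: L2_le_cst.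
Qed.

Lemma process_frozen X t0 : L2_process X -> 0 <= t0 -> L2_process (fun _ => X t0).
Proof.
move=> [mX cX bX] h0; split.
- by apply: (measurableT_comp (jointly_measurable_section t0 mX)); exact: measurable_snd.
- by move=> om x; exact: cvg_cst.
- by move=> T; have [B hB] := bX t0; exists B => t _; apply: hB; rewrite h0 lexx.
Qed.

Lemma process_sum (I : Type) (r : seq I) (X : I -> R -> Omega -> R) :
  (forall i, L2_process (X i)) -> L2_process (fun t om => \sum_(i <- r) X i t om).
Proof.
move=> h; elim: r => [|i r IH].
  rewrite (_ : (fun _ => _) = fun _ _ => 0); first exact: process_cst.
  by apply/funext => t; apply/funext => om; rewrite big_nil.
rewrite (_ : (fun _ => _) = fun t om => X i t om + \sum_(j <- r) X j t om).
  exact: processD.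
by apply/funext => t; apply/funext => om; rewrite big_cons.
Qed.

Lemma process_integrable X Y t : L2_process X -> L2_process Y -> 0 <= t ->
  P.-integrable setT (EFin \o (fun om => X t om * Y t om)).
Proof.
move=> [_ _ bX] [_ _ bY] t0; have [B hB] := bX t; have [B' hB'] := bY t.
have tt : 0 <= t <= t by rewrite t0 lexx.
by case: (L2_le_mul (hB t tt) (hB' t tt)).
Qed.

Lemma ray_continuous_process X om : L2_process X -> ray_continuous (fun t => X t om).
Proof. by move=> [_ cX _]; apply: ray_continuous_continuous; exact: cX. Qed.

Section Fubini.
Variables (X Y : R -> Omega -> R) (T : R).
Hypotheses (pX : L2_process X) (pY : L2_process Y).

Let D : set (measurableTypeR R) := `[0, T].
(* the indicator function lets the product measure live on the whole line *)
Let h (z : measurableTypeR R * Omega) : \bar R := (X z.1 z.2 * Y z.1 z.2 * \1_D z.1)%:E.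

Let mh : measurable_fun setT h.
Proof.
apply/measurable_EFinP; apply: measurable_funM.
  by apply: measurable_funM; [case: pX|case: pY].
apply: (measurableT_comp (f := \1_D : measurableTypeR R -> R)); last exact: measurable_fst.
by apply: measurable_indic; exact: measurable_itv.
Qed.

Let ih : (mu \x P)%E.-integrable setT h.
Proof.
apply: (@integrable12ltyP _ _ _ _ R mu P h mh).2.
have [_ _ bX] := pX; have [_ _ bY] := pY.
have [B hB] := bX T; have [B' hB'] := bY T.
apply: (@le_lt_trans _ _ (\int[mu]_(t in D) (B + B')%:E)%E); last first.
  rewrite integral_cst //; last exact: measurable_itv.
  have fD : (mu `[0%R, T] < +oo)%E.
    by rewrite lebesgue_measure_itv; case: ifP => _; rewrite -?EFinB ltry.
  suff /fin_numPlt/andP[] : ((B + B')%:E * mu D)%E \is a fin_num by [].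
  by apply: fin_numM => //; rewrite ge0_fin_numE.
rewrite [leRHS]integral_mkcond; apply: ge0_le_integral => //.
- by move=> t _; exact: integral_ge0.
- apply: (@measurable_fun_fubini_tonelli_F _ _ _ _ R P (fun z => `|h z|%E)) => //.
  exact: measurableT_comp.
- apply/(measurable_restrictT _ _).1 => //.
  exact: measurable_itv.
- move=> t _; rewrite patchE /h /=; case: ifP => tD; last first.
    rewrite (_ : (fun y => _) = cst 0%E) ?integral0 //; apply/funext => om /=.
    by rewrite indicE tD mulr0 normr0.
  have tT : 0 <= t <= T by move: tD; rewrite inE /D /= in_itv.
  under eq_integral do rewrite indicE tD mulr1.
  by case: (L2_le_mul (hB _ tT) (hB' _ tT)).
Qed.

Let GE om : (\int[mu]_t h (t, om))%E = (\int[mu]_(t in `[0, T]) (X t om * Y t om))%:E.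
Proof.
have cXY : ray_continuous (fun t => X t om * Y t om) by apply: ray_continuousM; exact: ray_continuous_process.
rewrite /Rintegral fineK; last exact/integrable_fin_num/ray_continuous_int.
rewrite [RHS]integral_mkcond; apply: eq_integral => t _.
by rewrite patchE /h /= indicE; case: ifP; rewrite ?mulr1 ?mulr0.
Qed.

Let FE t : (\int[P]_om h (t, om))%E =
  (((fun t => (Ex (fun om => X t om * Y t om))%:E) \_ D) t)%E.
Proof.
rewrite patchE /h /=; case: ifP => tD; last first.
  by rewrite indicE tD; under eq_integral do rewrite mulr0; rewrite integral0.
have t0 : 0 <= t by move: tD; rewrite inE /D /= in_itv => /andP[].
rewrite indicE tD; under eq_integral do rewrite mulr1.
rewrite /Rintegral fineK //; apply: integrable_fin_num => //; exact: process_integrable.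
Qed.

Lemma process_int_moment :
  mu.-integrable `[0, T] (EFin \o (fun t => Ex (fun om => X t om * Y t om))).
Proof.
have := @integrable_fubini_F _ _ _ _ R mu P h ih.
rewrite (_ : fubini_F _ _ = ((fun t => (Ex (fun om => X t om * Y t om))%:E) \_ D)).
  by move=> H; apply/(integrable_mkcond _ _).2 => //; exact: measurable_itv.
by apply/funext => t; rewrite /fubini_F FE.
Qed.

Lemma int_process_integrable :
  P.-integrable setT (EFin \o (fun om => \int[mu]_(t in `[0, T]) (X t om * Y t om))).
Proof.
have GG : (EFin \o (fun om => \int[mu]_(t in `[0, T]) (X t om * Y t om))) = fubini_G mu h.
  by apply/funext => om; rewrite /fubini_G GE.
have mG := @measurable_fubini_G _ _ _ _ R mu P h ih.
rewrite GG; apply/integrableP; split => //.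
apply: le_lt_trans ((@integrable21ltyP _ _ _ _ R mu P h mh).1 ih).
apply: ge0_le_integral => //; first exact: measurableT_comp.
  apply: (@measurable_fun_fubini_tonelli_G _ _ _ _ R mu (fun z => `|h z|%E)) => //.
  exact: measurableT_comp.
move=> om _; apply: le_abse_integral => //.
exact: (measurableT_comp mh (pair2_measurable om)).
Qed.

Lemma process_Fubini :
  Ex (fun om => \int[mu]_(t in `[0, T]) (X t om * Y t om)) =
  \int[mu]_(t in `[0, T]) (Ex (fun om => X t om * Y t om)).
Proof.
rewrite /Rintegral; congr fine.
transitivity (\int[P]_om \int[mu]_t h (t, om))%E.
  by apply: eq_integral => om _; rewrite GE.
rewrite -(@Fubini _ _ _ _ R mu P h ih) [RHS]integral_mkcond.
by apply: eq_integral => t _; rewrite FE.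
Qed.

End Fubini.

End Processes.

(** * Cross moments of processes *)

Section Moments.
Variable R : realType.
Notation mu := (@lebesgue_measure R).

Lemma Rintegral_sum d (T : measurableType d) (m : {measure set T -> \bar R}) (D : set T)
    (I : Type) (r : seq I) (f : I -> T -> R) : measurable D ->
  (forall i, m.-integrable D (EFin \o f i)) ->
  m.-integrable D (EFin \o (fun x => \sum_(i <- r) f i x)) /\
  Rintegral m D (fun x => \sum_(i <- r) f i x) = \sum_(i <- r) Rintegral m D (f i).
Proof.
move=> mD h; elim: r => [|i r [IH1 IH2]].
  rewrite big_nil (_ : (fun x => _) = cst 0); last by apply/funext => x; rewrite big_nil.
  by split; [exact: integrable0|rewrite /Rintegral integral0].
rewrite big_cons -IH2 -RintegralD //.
rewrite (_ : (fun x => \sum_(j <- i :: r) f j x) = (f i \+ (fun x => \sum_(j <- r) f j x))%R).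
  by split => //; exact: (integrableD mD (h i) IH1).
by apply/funext => x; rewrite big_cons.
Qed.

Context {d : measure_display} {Omega : measurableType d} (P : probability Omega R).
Notation "'Ex' f" := (Rintegral P setT f) (at level 10, f at level 9).
Implicit Types (X Y : R -> Omega -> R) (f g : Omega -> R).
Notation L2_process := (L2_process P).

Definition cross_moment X Y t := Ex (fun om => X t om * Y t om).

Lemma cross_momentC X Y t : cross_moment X Y t = cross_moment Y X t.
Proof. by congr fine; apply: eq_integral => om _; rewrite mulrC. Qed.

Lemma cross_momentD X X' Y t : L2_process X -> L2_process X' -> L2_process Y -> 0 <= t ->
  cross_moment (fun t om => X t om + X' t om) Y t = cross_moment X Y t + cross_moment X' Y t.
Proof.
move=> pX pX' pY t0; rewrite /cross_moment -RintegralD //; try exact: process_integrable.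
by congr fine; apply: eq_integral => om _; rewrite mulrDl.
Qed.

Lemma cross_momentZ (k : R) X Y t : L2_process X -> L2_process Y -> 0 <= t ->
  cross_moment (fun t om => k * X t om) Y t = k * cross_moment X Y t.
Proof.
move=> pX pY t0; rewrite /cross_moment -RintegralZl //; last exact: process_integrable.
by congr fine; apply: eq_integral => om _; rewrite mulrA.
Qed.

Lemma cross_moment_sum (I : Type) (r : seq I) (X : I -> R -> Omega -> R) Y t :
  (forall i, L2_process (X i)) -> L2_process Y -> 0 <= t ->
  cross_moment (fun t om => \sum_(i <- r) X i t om) Y t = \sum_(i <- r) cross_moment (X i) Y t.
Proof.
move=> pX pY t0.
have [_ <-] := @Rintegral_sum _ _ P setT I r (fun i om => X i t om * Y t om) measurableT
  (fun i => process_integrable (pX i) pY t0).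
by congr fine; apply: eq_integral => om _; rewrite mulr_suml.
Qed.

(** The integral of the square of f minus its mean is nonnegative. *)
Lemma sqr_int_le (f : R -> R) T : ray_continuous f -> 0 <= T ->
  (\int[mu]_(t in `[0, T]) f t) ^+ 2 <= T * \int[mu]_(t in `[0, T]) (f t * f t).
Proof.
move=> cf; rewrite le_eqVlt => /predU1P[<-|T0].
  by rewrite set_itv1 !Rintegral_set1 expr0n /= mul0r.
set I := \int[mu]_(t in _) f t.
have : 0 <= \int[mu]_(t in `[0, T]) ((f t - I / T) * (f t - I / T)).
  by apply: Rintegral_ge0 => t _; rewrite -expr2 sqr_ge0.
have -> : \int[mu]_(t in `[0, T]) ((f t - I / T) * (f t - I / T)) =
   \int[mu]_(t in `[0, T]) ((f t * f t) + (- 2 * (I / T) * f t + I / T * (I / T))).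
  by apply: eq_Rintegral => t _; ring.
have c1 := ray_continuous_int T (ray_continuousM cf cf).
have c2 := ray_continuous_int T (ray_continuousM (@ray_continuous_cst R (- 2 * (I / T))) cf).
have c3 := ray_continuous_int T (@ray_continuous_cst R (I / T * (I / T))).
rewrite RintegralD //; last exact: (ray_continuous_int T (ray_continuousD (ray_continuousM (@ray_continuous_cst R (- 2 * (I / T))) cf) (@ray_continuous_cst R (I / T * (I / T))))).
rewrite RintegralD // RintegralZl //; last exact: ray_continuous_int.
have mT : fine (mu `[0%R, T]) = T by rewrite lebesgue_measure_itv /= lte_fin T0 /= subr0.
rewrite Rintegral_cst // ?mT -/I.
move: (\int[mu]_(t in _) _) => J H.
rewrite -subr_ge0 (_ : _ - _ = T * (J + (- 2 * (I / T) * I + I / T * (I / T) * T))).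
  by rewrite mulr_ge0 // ltW.
by field; rewrite gt_eqF.
Qed.

End Moments.

(** * Linear systems under noise with orthogonal increments *)

Lemma Rintegral_itv_le (R : realType) (f : R -> R) (t T : R) : ray_continuous f -> 0 <= t -> t <= T ->
  (forall s, 0 <= s -> 0 <= f s) ->
  \int[@lebesgue_measure R]_(s in `[0, t]) f s <= \int[@lebesgue_measure R]_(s in `[0, T]) f s.
Proof.
move=> cf t0 tT f0; apply: fine_le.
- exact/integrable_fin_num/ray_continuous_int.
- exact/integrable_fin_num/ray_continuous_int.
apply: ge0_subset_integral => //.
- exact: (measurable_int _ (ray_continuous_int T cf)).
- by move=> s /=; rewrite in_itv /= lee_fin => /andP[s0 _]; exact: f0.
- by move=> s /=; rewrite !in_itv /= => /andP[-> st]; exact: le_trans st tT.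
Qed.

Lemma Rintegral_itv_cst (R : realType) (c t : R) : 0 <= t ->
  \int[@lebesgue_measure R]_(s in `[0, t]) c = c * t.
Proof.
rewrite le_eqVlt => /predU1P[<-|t0]; first by rewrite set_itv1 Rintegral_set1 mulr0.
have h : fine (lebesgue_measure `[0%R, t]) = t by rewrite lebesgue_measure_itv /= lte_fin t0 sube0.
by rewrite Rintegral_cst // h.
Qed.

Section System.
Variable R : realType.
Notation mu := (@lebesgue_measure R).
Context {d : measure_display} {Omega : measurableType d} (P : probability Omega R).
Notation "'Ex' f" := (Rintegral P setT f) (at level 10, f at level 9).
Notation L2_process := (L2_process P).
Notation cross_moment := (cross_moment P).

Variables (k : nat) (M S : 'M[R]_k) (z0 : 'I_k -> R) (n Z : 'I_k -> R -> Omega -> R).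
Hypothesis pn : forall i, L2_process (n i).
Hypothesis n_mean : forall i t, 0 <= t -> Ex (n i t) = 0.
Hypothesis n_cov : forall i j s t, 0 <= s -> 0 <= t ->
  Ex (fun om => n i s om * n j t om) = S i j * Num.min s t.
Hypothesis mZ : forall i, jointly_measurable (Z i).
Hypothesis cZ : forall i om, continuous (fun t => Z i t om).
Let F i t om := \sum_m M i m * Z m t om.
Hypothesis eZ : forall i om t, 0 <= t ->
  Z i t om = z0 i + \int[mu]_(s in `[0, t]) F i s om + n i t om.

Let wZ i om : ray_continuous (fun t => Z i t om).
Proof. exact: ray_continuous_continuous. Qed.

Let ray_continuous_sum (I : Type) (r : seq I) (f : I -> R -> R) :
  (forall i, ray_continuous (f i)) -> ray_continuous (fun t => \sum_(i <- r) f i t).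
Proof.
move=> cf; elim: r => [|i r IH].
  by rewrite (_ : (fun t => _) = fun=> 0); [exact: ray_continuous_cst|apply/funext => t; rewrite big_nil].
rewrite (_ : (fun t => _) = fun t => f i t + \sum_(j <- r) f j t); first exact: ray_continuousD.
by apply/funext => t; rewrite big_cons.
Qed.

Let wF i om : ray_continuous (fun t => F i t om).
Proof. by apply: ray_continuous_sum => m; apply: ray_continuousM; [exact: ray_continuous_cst|exact: wZ]. Qed.

Let c : R := \sum_i \sum_m `|M i m|.
Let c0 : 0 <= c. Proof. by apply: sumr_ge0 => i _; apply: sumr_ge0. Qed.

Let g t om := \sum_i `|Z i t om|.
Let a t om := \sum_i (`|z0 i| + `|n i t om|).

Let wg om : ray_continuous (fun t => g t om).
Proof. by apply: ray_continuous_sum => i; apply: ray_continuous_continuous => x; apply: cvg_norm; exact: cZ. Qed.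

Let pa : L2_process a.
Proof.
by apply: process_sum => i; apply: processD; [exact: process_cst|exact: process_abs].
Qed.

Let Zg i t om : `|Z i t om| <= g t om.
Proof. by rewrite /g (bigD1 i) //= lerDl sumr_ge0. Qed.

Let g_le om t : 0 <= t -> g t om <= a t om + c * \int[mu]_(s in `[0, t]) g s om.
Proof.
move=> t0; rewrite /a /c mulr_suml -big_split /=; apply: ler_sum => i _.
rewrite eZ // addrAC; apply: (le_trans (ler_normD _ _)); apply: lerD; first exact: ler_normD.
apply: (le_trans (le_normr_Rintegral _ _)) => //; first exact: ray_continuous_int.
rewrite -RintegralZl //; last exact: ray_continuous_int.
apply: le_Rintegral => //.
- apply: ray_continuous_int; rewrite (_ : (fun _ => _) = (fun s => `|F i s om|)) //.
  by move=> T x; apply: cvg_norm; exact: wF.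
- by apply: ray_continuous_int; apply: ray_continuousM => //; exact: ray_continuous_cst.
- move=> s _; rewrite /F mulr_suml; apply: (le_trans (ler_norm_sum _ _ _)).
  by apply: ler_sum => m _; rewrite normrM ler_wpM2l.
Qed.

(** By Gronwall's inequality each path is bounded by the path of the noise and its
    integral, and these have finite second moments. *)
Lemma solution_process i : L2_process (Z i).
Proof.
split=> // T; have [T0|T0] := leP 0 T; last first.
  by exists 0 => t /andP[t0 tT]; have := le_lt_trans (le_trans t0 tT) T0; rewrite ltxx.
have [_ _ /(_ T)[B hB]] := pa.
have wa om : ray_continuous (fun t => a t om) by exact: ray_continuous_process pa.
have a_ge0 t om : 0 <= a t om by apply: sumr_ge0 => j _; exact: addr_ge0.
pose I om := \int[mu]_(s in `[0, T]) a s om.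
pose K := c * expR (c * T).
have K0 : 0 <= K by rewrite mulr_ge0 // expR_ge0.
have bnd t om : 0 <= t <= T -> `|Z i t om| <= a t om + K * I om.
  move=> /andP[t0 tT]; apply: (le_trans (Zg i t om)); apply: (le_trans (g_le om t0)).
  rewrite lerD2l /K -mulrA ler_wpM2l //.
  apply: (@le_trans _ _ (expR (c * t) * \int[mu]_(s in `[0, t]) a s om)).
    by apply: gronwall => // s /andP[s0 _]; exact: g_le.
  apply: ler_pM; rewrite ?expR_ge0 ?ler_expR ?ler_wpM2l //.
    exact: Rintegral_ge0.
  by apply: Rintegral_itv_le => // s _; exact: a_ge0.
have iaa t : 0 <= t -> P.-integrable setT (EFin \o (fun om => 2 * (a t om * a t om))).
  by move=> t0; apply: (integrableZl measurableT 2 (process_integrable pa pa t0)).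
have iII : P.-integrable setT (EFin \o (fun om => (2 * K ^+ 2 * T) * \int[mu]_(s in `[0, T]) (a s om * a s om))).
  exact: (integrableZl measurableT (2 * K ^+ 2 * T) (int_process_integrable T pa pa)).
exists (2 * (B + B) + (2 * K ^+ 2 * T) * Ex (fun om => \int[mu]_(s in `[0, T]) (a s om * a s om))).
move=> t tT; have t0 : 0 <= t by case/andP: tT.
split; first exact: jointly_measurable_section.
have iH := integrableD measurableT (iaa t t0) iII.
apply: (@le_trans _ _ (\int[P]_om ((2 * (a t om * a t om))%:E + ((2 * K ^+ 2 * T) * \int[mu]_(s in `[0, T]) (a s om * a s om))%:E))%E).
  apply: ge0_le_integral => //.
  - by move=> om _; rewrite lee_fin sqr_ge0.
  - by apply/measurable_EFinP/measurable_funX; exact: jointly_measurable_section.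
  - exact: (measurable_int P iH).
  - move=> om _; rewrite -EFinD lee_fin.
    apply: (@le_trans _ _ ((a t om + K * I om) ^+ 2)).
      rewrite -[Z i t om ^+ 2]real_normK ?num_real //.
      rewrite ler_sqr ?nnegrE //; first exact: bnd.
      exact: le_trans (normr_ge0 _) (bnd _ _ tT).
    apply: (@le_trans _ _ (2 * (a t om * a t om) + 2 * K ^+ 2 * I om ^+ 2)).
      rewrite -subr_ge0 (_ : _ - _ = (a t om - K * I om) ^+ 2); first exact: sqr_ge0.
      by ring.
    rewrite lerD2l -[2 * K ^+ 2 * T * _]mulrA ler_wpM2l ?mulr_ge0 ?sqr_ge0 //.
    exact: sqr_int_le.
rewrite (integralD measurableT (iaa t t0) iII).
have := integrable_fin_num measurableT (iaa t t0); have := integrable_fin_num measurableT iII.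
move=> /fineK <- /fineK <-; rewrite -EFinD lee_fin.
have e1 := RintegralZl (2 * K ^+ 2 * T) measurableT (int_process_integrable T pa pa).
have e2 := RintegralZl 2 measurableT (process_integrable pa pa t0).
rewrite -[X in _ <= _ + X]e1 lerD2r -/(Rintegral P setT (fun om => 2 * (a t om * a t om))) e2.
rewrite ler_pM2l //; apply: le_trans (ler_norm _) _; apply: L2_le_mul_le; exact: hB.
Qed.

Let pZ := solution_process.
Let pF i : L2_process (F i). Proof. by apply: process_sum => m; apply: processZ. Qed.

Let cross_momentF i Y t : L2_process Y -> 0 <= t -> cross_moment (F i) Y t = \sum_m M i m * cross_moment (Z m) Y t.
Proof.
move=> pY t0; rewrite /F cross_moment_sum //; last by move=> m; exact: processZ.
by apply: eq_bigr => m _; rewrite cross_momentZ.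
Qed.

Let ray_continuous_eq (f h : R -> R) : (forall t, 0 <= t -> f t = h t) -> ray_continuous f -> ray_continuous h.
Proof.
move=> e cf T; apply: subspace_eq_continuous (cf T).
by move=> t; rewrite inE /= in_itv /= => /andP[t0 _]; exact: e.
Qed.

Let ray_continuous_integral (h : R -> R) : (forall T, mu.-integrable `[0, T] (EFin \o h)) ->
  ray_continuous (fun t => \int[mu]_(s in `[0, t]) h s).
Proof.
move=> ih T; have [T0|T0] := leP 0 T.
  exact: (parameterized_integral_continuous T0 (ih T)).
by rewrite set_itv_ge ?bnd_simp -?ltNge //; exact: continuous_subspace0.
Qed.

Let process_const_integrable (Y : Omega -> R) : L2_process (fun _ => Y) ->
  P.-integrable setT (EFin \o Y).
Proof.
move=> pY; have := process_integrable (process_cst P 1) pY (lexx 0).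
by rewrite (_ : (fun om => _) = Y) //; apply/funext => om; rewrite mul1r.
Qed.

(** The cross moments of the state with a fixed random variable satisfy the
    equation of the system, with the covariance with the noise as input. *)
Let cross_moment_frozen i (Y : Omega -> R) s : L2_process (fun _ => Y) -> 0 <= s ->
  cross_moment (Z i) (fun _ => Y) s = z0 i * Ex Y + \int[mu]_(u in `[0, s]) cross_moment (F i) (fun _ => Y) u
    + cross_moment (n i) (fun _ => Y) s.
Proof.
move=> pY s0; rewrite -(process_Fubini s (pF i) pY).
have iY := process_const_integrable pY.
have i1 := integrableZl measurableT (z0 i) iY.
have i2 := int_process_integrable s (pF i) pY.
have i3 := process_integrable (pn i) pY s0.
rewrite -(RintegralZl _ measurableT iY) -(RintegralD measurableT i1 i2).
rewrite -(RintegralD measurableT (integrableD measurableT i1 i2) i3).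
apply: eq_Rintegral => om _; rewrite /= eZ // !mulrDl; congr (_ + _ + _).
by rewrite -RintegralZr //; exact: ray_continuous_int.
Qed.

Let cross_moment_frozen_wcont i j t : 0 <= t -> ray_continuous (cross_moment (Z i) (fun _ => n j t)).
Proof.
move=> t0; have pY := process_frozen (pn j) t0.
apply: (@ray_continuous_eq (fun s => z0 i * Ex (n j t) + \int[mu]_(u in `[0, s]) cross_moment (F i) (fun _ => n j t) u
    + S i j * Num.min s t)).
  by move=> s s0; rewrite cross_moment_frozen //; congr (_ + _); rewrite -n_cov.
apply: ray_continuousD; first apply: ray_continuousD; first exact: ray_continuous_cst.
  by apply: ray_continuous_integral => T; exact: process_int_moment.
apply: ray_continuousM; first exact: ray_continuous_cst.
apply: ray_continuous_continuous => x; apply: continuous_min; [exact: cvg_id|exact: cvg_cst].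
Qed.

(** The cross moments D of the state with a later increment of the noise satisfy
    D' = M D and D(0) = 0, since that increment is orthogonal to the earlier
    noise; hence they vanish by Gronwall's inequality. *)
Lemma state_increment_orthogonal i j s t : 0 <= s <= t ->
  Ex (fun om => Z i s om * n j t om) = cross_moment (Z i) (n j) s.
Proof.
move=> /andP[s0 st]; have t0 := le_trans s0 st.
pose D i u := cross_moment (Z i) (fun _ => n j t) u - cross_moment (Z i) (fun _ => n j s) u.
suff : \sum_i `|D i s| <= 0.
  rewrite le_eqVlt ltNge sumr_ge0 //= orbF => /eqP/psumr_eq0P H.
  have /normr0_eq0/eqP := H (fun _ _ => normr_ge0 _) i isT.
  by rewrite /D subr_eq0 => /eqP.
have cD l : ray_continuous (D l).
  by apply: ray_continuousD; [exact: cross_moment_frozen_wcont|apply: ray_continuousN; exact: cross_moment_frozen_wcont].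
have pt := process_frozen (pn j) t0; have ps := process_frozen (pn j) s0.
(* up to time s the noise has the same covariance with its values at s and t *)
have DE l u : 0 <= u <= s -> D l u = \int[mu]_(v in `[0, u]) (\sum_m M l m * D m v).
  move=> /andP[u0 us]; rewrite /D !cross_moment_frozen // !n_mean // mulr0 !add0r.
  rewrite (n_cov l j u0 t0 : cross_moment _ _ _ = _) (n_cov l j u0 s0 : cross_moment _ _ _ = _).
  rewrite !min_l //; last exact: le_trans us st.
  rewrite opprD addrACA subrr addr0 -RintegralB //; try exact: process_int_moment.
  apply: eq_Rintegral => v; rewrite inE /= in_itv /= => /andP[v0 _].
  by rewrite !cross_momentF // -sumrB; apply: eq_bigr => m _; rewrite mulrBr.
have wD : ray_continuous (fun u => \sum_l `|D l u|).
  by apply: ray_continuous_sum => l T x; apply: cvg_norm; exact: cD.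
apply: (@gronwall0 _ (fun u => \sum_i `|D i u|) c s wD s0 c0).
move=> u us; have u0 : 0 <= u by case/andP: us.
have wDM l : ray_continuous (fun v => \sum_m M l m * D m v).
  by apply: ray_continuous_sum => m; apply: ray_continuousM; [exact: ray_continuous_cst|exact: cD].
rewrite /c mulr_suml; apply: ler_sum => l _; rewrite DE //.
apply: (le_trans (le_normr_Rintegral _ _)) => //; first exact: ray_continuous_int.
rewrite -RintegralZl //; last exact: ray_continuous_int.
apply: le_Rintegral => //.
- by apply: ray_continuous_int => T x; apply: cvg_norm; exact: wDM.
- by apply: ray_continuous_int; apply: ray_continuousM => //; exact: ray_continuous_cst.
- move=> v _; rewrite mulr_suml; apply: (le_trans (ler_norm_sum _ _ _)).
  apply: ler_sum => m _; rewrite normrM ler_wpM2l //.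
  by rewrite (bigD1 m) //= lerDl sumr_ge0.
Qed.

Let y i t om := Z i t om + - 1 * n i t om.
Let py i : L2_process (y i). Proof. by apply: processD => //; exact: processZ. Qed.

Let yE i om t : 0 <= t -> y i t om = z0 i + \int[mu]_(s in `[0, t]) F i s om.
Proof. by move=> t0; rewrite /y eZ // mulN1r addrK. Qed.

Let y_prim i om : is_primitive (fun t => y i t om) (fun t => F i t om).
Proof.
split=> // t t0; rewrite yE // (yE i om (lexx 0)).
by rewrite set_itv1 Rintegral_set1 addr0.
Qed.

Let mom_yy i j t : 0 <= t -> cross_moment (y i) (y j) t =
  z0 i * z0 j + (\int[mu]_(s in `[0, t]) cross_moment (F i) (y j) s + \int[mu]_(s in `[0, t]) cross_moment (y i) (F j) s).
Proof.
move=> t0; rewrite -!process_Fubini //.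
have i1 := int_process_integrable t (pF i) (py j); have i2 := int_process_integrable t (py i) (pF j).
rewrite -(RintegralD measurableT i1 i2).
have ic : P.-integrable setT (EFin \o (fun _ : Omega => z0 i * z0 j)).
  by apply: process_const_integrable; exact: process_cst.
rewrite -[z0 i * z0 j in RHS](_ : Ex (fun=> z0 i * z0 j) = _); last first.
  rewrite Rintegral_cst // (_ : _ [set: Omega] = 1%E) ?mulr1 //; exact: probability_setT.
rewrite -(RintegralD measurableT ic (integrableD measurableT i1 i2)).
apply: eq_Rintegral => om _ /=.
have [_ /(_ t t0) ->] := is_primitiveM (y_prim i om) (y_prim j om).
have w f h : L2_process f -> L2_process h -> mu.-integrable `[0, t] (EFin \o (fun s => f s om * h s om)).
  by move=> pf ph; apply: ray_continuous_int; apply: ray_continuousM; [exact: ray_continuous_process pf|exact: ray_continuous_process ph].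
rewrite RintegralD //; try exact: w.
by congr (_ + _); rewrite !yE // set_itv1 !Rintegral_set1 !addr0.
Qed.

Let mom_yn i j t : 0 <= t -> cross_moment (y i) (n j) t = \int[mu]_(s in `[0, t]) cross_moment (F i) (n j) s.
Proof.
move=> t0; have pY := process_frozen (pn j) t0.
rewrite /y cross_momentD //; last exact: processZ.
rewrite cross_momentZ // (_ : cross_moment (Z i) (n j) t = cross_moment (Z i) (fun _ => n j t) t) //.
rewrite cross_moment_frozen // n_mean // mulr0 add0r mulN1r addrK.
apply: eq_Rintegral => s; rewrite inE /= in_itv /= => /andP[s0 st].
rewrite !cross_momentF //; apply: eq_bigr => m _; congr (_ * _).
by rewrite -(@state_increment_orthogonal m j s t) // s0.
Qed.

(** With y = z - n, which is differentiable, the product rule gives the derivative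
    of E y y^T; the cross terms E y n^T are evaluated by orthogonality, and
    E n n^T = t S. This replaces Ito's formula. *)
Lemma second_moment i j : is_primitive (cross_moment (Z i) (Z j))
  (fun t => \sum_m M i m * cross_moment (Z m) (Z j) t + \sum_m M j m * cross_moment (Z i) (Z m) t + S i j).
Proof.
have E l m t : 0 <= t -> cross_moment (Z l) (Z m) t = z0 l * z0 m
   + (\int[mu]_(s in `[0, t]) cross_moment (F l) (Z m) s + \int[mu]_(s in `[0, t]) cross_moment (Z l) (F m) s) + S l m * t.
  move=> t0; have e (b : 'I_k) X s : L2_process X -> 0 <= s -> cross_moment (Z b) X s = cross_moment (y b) X s + cross_moment (n b) X s.
    move=> pX s0; rewrite -cross_momentD //; congr fine; apply: eq_integral => om _.
    by rewrite /y mulN1r subrK.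
  have n_t : cross_moment (n l) (n m) t = S l m * t.
    by rewrite (n_cov l m t0 t0 : cross_moment _ _ _ = _) minxx.
  rewrite e // cross_momentC e // [cross_moment (n l) _ _]cross_momentC e // [cross_moment (n m) (n l) t]cross_momentC n_t.
  rewrite [cross_moment (y m) (y l) t]cross_momentC mom_yy // [cross_moment (n m) (y l) t]cross_momentC !mom_yn //.
  have -> : \int[mu]_(s in `[0, t]) cross_moment (F l) (Z m) s =
     \int[mu]_(s in `[0, t]) cross_moment (F l) (y m) s + \int[mu]_(s in `[0, t]) cross_moment (F l) (n m) s.
    rewrite -RintegralD //; try exact: process_int_moment.
    apply: eq_Rintegral => s; rewrite inE /= in_itv /= => /andP[s0 st].
    by rewrite cross_momentC e // ![cross_moment _ (F l) s]cross_momentC.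
  have -> : \int[mu]_(s in `[0, t]) cross_moment (Z l) (F m) s =
     \int[mu]_(s in `[0, t]) cross_moment (y l) (F m) s + \int[mu]_(s in `[0, t]) cross_moment (F m) (n l) s.
    rewrite -RintegralD //; try exact: process_int_moment.
    apply: eq_Rintegral => s; rewrite inE /= in_itv /= => /andP[s0 st].
    by rewrite e // [cross_moment (n l) (F m) s]cross_momentC.
  move: (\int[mu]_(s in _) _) (\int[mu]_(s in _) _) (\int[mu]_(s in _) _) (\int[mu]_(s in _) _) => A B C D.
  move: (z0 l * z0 m) (S l m * t) => E G; ring.
have cp l m : ray_continuous (cross_moment (Z l) (Z m)).
  apply: (ray_continuous_eq (fun t t0 => esym (E l m t t0))).
  apply: ray_continuousD; first (apply: ray_continuousD; first exact: ray_continuous_cst).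
    by apply: ray_continuousD; apply: ray_continuous_integral => T; exact: process_int_moment.
  by apply: ray_continuousM; [exact: ray_continuous_cst|apply: ray_continuous_continuous => x; exact: cvg_id].
have c1 : ray_continuous (fun t => \sum_m M i m * cross_moment (Z m) (Z j) t).
  by apply: ray_continuous_sum => m; apply: ray_continuousM => //; exact: ray_continuous_cst.
have c2 : ray_continuous (fun t => \sum_m M j m * cross_moment (Z i) (Z m) t).
  by apply: ray_continuous_sum => m; apply: ray_continuousM => //; exact: ray_continuous_cst.
split=> [|t t0]; first by apply: ray_continuousD; [exact: ray_continuousD|exact: ray_continuous_cst].
rewrite RintegralD //; try exact: ray_continuous_int; last exact/ray_continuous_int/ray_continuous_cst; last exact/ray_continuous_int/ray_continuousD.
rewrite RintegralD //; try exact: ray_continuous_int.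
rewrite E // (E i j _ (lexx 0)) set_itv1 !Rintegral_set1 mulr0 !addr0 -!addrA; congr (_ + _).
congr (_ + _); first by apply: eq_Rintegral => s; rewrite inE /= in_itv /= => /andP[s0 _]; rewrite cross_momentF.
congr (_ + _).
  apply: eq_Rintegral => s; rewrite inE /= in_itv /= => /andP[s0 _]; rewrite cross_momentC cross_momentF //.
  by apply: eq_bigr => m _; rewrite cross_momentC.
by rewrite Rintegral_itv_cst.
Qed.

End System.

(** * Long-run behaviour of the second moments *)

Section Covariance.
Variable R : realType.
Notation mu := (@lebesgue_measure R).
Variable k : nat.
Implicit Types (Q Pi : 'M[R]_k).

Lemma quadE Q (v : 'cV[R]_k) : (v^T *m Q *m v) 0 0 = \sum_i \sum_j Q i j * (v i 0 * v j 0).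
Proof.
rewrite -mulmxA mxE; apply: eq_bigr => i _; rewrite !mxE mulr_sumr.
by apply: eq_bigr => j _; rewrite mulrCA.
Qed.

Definition absum Q : R := \sum_i \sum_j `|Q i j|.

(** Each product v_i v_j is at most the sum of the squares of the v_m. *)
Lemma psd_dominant (c : R) Q : absum Q <= c -> psd_mx (c%:M + Q).
Proof.
move=> hc v; rewrite mulmxDr mulmxDl mxE mul_mx_scalar -scalemxAl mxE quadE.
have -> : (v^T *m v) 0 0 = \sum_i v i 0 ^+ 2.
  by rewrite mxE; apply: eq_bigr => i _; rewrite mxE expr2.
set s := \sum_i v i 0 ^+ 2.
have s0 : 0 <= s by apply: sumr_ge0 => i _; exact: sqr_ge0.
have vs i : v i 0 ^+ 2 <= s.
  by rewrite /s (bigD1 i) //= lerDl sumr_ge0 // => j _; exact: sqr_ge0.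
have vv i j : `|v i 0 * v j 0| <= s.
  have := vs i; have := vs j.
  have := sqr_ge0 (v i 0 - v j 0); have := sqr_ge0 (v i 0 + v j 0).
  by rewrite ler_norml; move: (v i 0) (v j 0) => x y; nra.
apply: (@le_trans _ _ (c * s - absum Q * s)); first by rewrite -mulrBl mulr_ge0 // subr_ge0.
rewrite lerD2l /absum mulr_suml -sumrN; apply: ler_sum => i _.
rewrite mulr_suml -sumrN; apply: ler_sum => j _.
rewrite lerNl; apply: le_trans (ler_norm _) _.
by rewrite normrN normrM ler_wpM2l.
Qed.

Variables (M S : 'M[R]_k) (p : 'I_k -> 'I_k -> R -> R).
Hypothesis hM : hurwitz M.
Hypothesis p_prim : forall i j, is_primitive (p i j)
  (fun t => \sum_m M i m * p m j t + \sum_m M j m * p i m t + S i j).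

(** The scalar product <Q, p> of matrices, that is the mean of z^T Q z when p is
    the matrix of second moments of z. *)
Definition pairing Q t := \sum_i \sum_j Q i j * p i j t.

Hypothesis p_psd : forall Q t, 0 <= t -> psd_mx Q -> 0 <= pairing Q t.

Lemma pairingD Q Q' t : pairing (Q + Q') t = pairing Q t + pairing Q' t.
Proof.
rewrite -big_split; apply: eq_bigr => i _; rewrite -big_split; apply: eq_bigr => j _.
by rewrite mxE mulrDl.
Qed.

Lemma pairingZ (a : R) Q t : pairing (a *: Q) t = a * pairing Q t.
Proof.
rewrite mulr_sumr; apply: eq_bigr => i _; rewrite mulr_sumr; apply: eq_bigr => j _.
by rewrite mxE mulrA.
Qed.

Lemma pairingN Q t : pairing (- Q) t = - pairing Q t.
Proof. by rewrite -scaleN1r pairingZ mulN1r. Qed.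

Lemma is_primitive_sum (I : Type) (r : seq I) (f F : I -> R -> R) : (forall i, is_primitive (F i) (f i)) ->
  is_primitive (fun t => \sum_(i <- r) F i t) (fun t => \sum_(i <- r) f i t).
Proof.
move=> h; elim: r => [|i r IH].
  have e : (fun t : R => \sum_(i <- [::]) F i t) = fun=> 0 by apply/funext => t; rewrite big_nil.
  have e' : (fun t : R => \sum_(i <- [::]) f i t) = fun=> 0 by apply/funext => t; rewrite big_nil.
  rewrite e e'; split; first exact: ray_continuous_cst.
  by move=> t t0; rewrite Rintegral_itv_cst // mul0r addr0.
have e (g : I -> R -> R) : (fun t => \sum_(j <- i :: r) g j t) = fun t => g i t + \sum_(j <- r) g j t.
  by apply/funext => t; rewrite big_cons.
by rewrite !e; apply: is_primitiveD.
Qed.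

Lemma pairing_prim Q Pi : M^T *m Pi + Pi *m M = - Q ->
  is_primitive (pairing Pi) (fun t => - pairing Q t + \sum_i \sum_j Pi i j * S i j).
Proof.
move=> lyap.
rewrite (_ : (fun t => - _ + _) = fun t => \sum_i \sum_j Pi i j *
   (\sum_m M i m * p m j t + \sum_m M j m * p i m t + S i j)).
  by apply: is_primitive_sum => i; apply: is_primitive_sum => j; apply: is_primitiveZ.
apply/funext => t; rewrite -pairingN -lyap pairingD.
have -> : \sum_i \sum_j Pi i j * (\sum_m M i m * p m j t + \sum_m M j m * p i m t + S i j) =
  \sum_i \sum_j \sum_m Pi i j * (M i m * p m j t) + \sum_i \sum_j \sum_m Pi i j * (M j m * p i m t)
  + \sum_i \sum_j Pi i j * S i j.
  rewrite -!big_split; apply: eq_bigr => i _; rewrite -!big_split; apply: eq_bigr => j _.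
  by rewrite /= !mulrDr !mulr_sumr.
congr (_ + _ + _).
  rewrite /pairing [LHS]exchange_big /= [RHS]exchange_big /=; apply: eq_bigr => j _.
  rewrite [RHS]exchange_big /=; apply: eq_bigr => m _.
  by rewrite mxE mulr_suml; apply: eq_bigr => i _; rewrite mxE mulrA [M i m * _]mulrC.
apply: eq_bigr => i _; rewrite [RHS]exchange_big /=; apply: eq_bigr => m _.
by rewrite mxE mulr_suml; apply: eq_bigr => j _; rewrite mulrA.
Qed.

Lemma pairing_le (c : R) Q t : 0 <= t -> absum Q <= c -> pairing Q t <= c * pairing 1%:M t.
Proof.
move=> t0 hc; rewrite -subr_ge0 -pairingZ -pairingN -pairingD scalemx1.
apply: p_psd => //; apply: psd_dominant.
rewrite /absum; under eq_bigr do under eq_bigr do rewrite mxE normrN; exact: hc.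
Qed.

Lemma absum_ge0 Q : 0 <= absum Q.
Proof. by apply: sumr_ge0 => i _; apply: sumr_ge0. Qed.

(** With Q = I, the pairing with Pi dissipates a multiple of itself, so it stays
    bounded; and Pi dominates a positive multiple of the identity, because
    Pi - e I solves the Lyapunov equation for I + e (M + M^T), which is positive
    for small e. *)
Lemma trace_bounded : exists B, forall t, 0 <= t -> pairing 1%:M t <= B.
Proof.
have [Pi lyap] := lyapunov_exists hM 1%:M.
have G := pairing_prim lyap.
set c := \sum_i _ in G.
pose K := 1 + absum Pi; have K0 : 0 < K by rewrite /K ltr_pwDl // absum_ge0.
have bG t : 0 <= t -> pairing Pi t <= `|pairing Pi 0| + `|c| / K^-1.
  move: t; apply: (dissipation_bound G); first by rewrite invr_gt0.
  move=> t t0; rewrite lerD2r mulNr lerN2 ler_pdivrMl //.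
  by apply: pairing_le => //; rewrite /K lerDr.
pose e := (1 + absum (M + M^T))^-1.
have e0 : 0 < e by rewrite invr_gt0 ltr_pwDl // absum_ge0.
have H : psd_mx (Pi - e%:M).
  apply: (@lyapunov_psd _ _ _ hM _ (1%:M + e *: (M + M^T))).
    rewrite mulmxBr mulmxBl addrACA lyap mul_mx_scalar mul_scalar_mx -opprD -opprD; congr (- (_ + _)).
    by rewrite scalerDr addrC.
  have -> : 1%:M + e *: (M + M^T) = e *: ((1 + absum (M + M^T))%:M + (M + M^T)).
    by rewrite [RHS]scalerDr scale_scalar_mx mulVf // gt_eqF // ltr_pwDl // absum_ge0.
  move=> v; rewrite -scalemxAr -scalemxAl mxE mulr_ge0 ?(ltW e0) //.
  by apply: psd_dominant; rewrite lerDr.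
exists (e^-1 * (`|pairing Pi 0| + `|c| / K^-1)) => t t0.
rewrite ler_pdivlMl //; apply: le_trans (bG t t0).
by rewrite -subr_ge0 -pairingZ -pairingN -pairingD scalemx1; exact: p_psd.
Qed.

Lemma pairing_bounded Q : exists B, forall t, 0 <= t -> `|pairing Q t| <= B.
Proof.
have [B hB] := trace_bounded; exists (absum Q * B) => t t0.
have : absum Q * pairing 1%:M t <= absum Q * B by rewrite ler_wpM2l ?absum_ge0 ?hB.
apply: le_trans; rewrite ler_norml; apply/andP; split; last exact: pairing_le.
rewrite lerNl -pairingN; apply: pairing_le => //.
by rewrite /absum; under eq_bigr do under eq_bigr do rewrite mxE normrN.
Qed.

(** The mean of <Q, p> over [0, T] differs from <Pi, S> by the increment of the
    bounded function <Pi, p>, divided by T. *)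
Lemma time_average Q Pi : M^T *m Pi + Pi *m M = - Q ->
  T^-1 * (\int[mu]_(t in `[0, T]) pairing Q t) @[T --> +oo] --> \sum_i \sum_j Pi i j * S i j.
Proof.
move=> lyap; have [cG EG] := pairing_prim lyap; set c := \sum_i _ in cG EG *.
have [B hB] := pairing_bounded Pi.
have cQ : ray_continuous (pairing Q).
  rewrite (_ : pairing Q = fun t => - (- pairing Q t + c) + c).
    by apply: ray_continuousD; [exact: ray_continuousN|exact: ray_continuous_cst].
  by apply/funext => t; rewrite opprD opprK subrK.
have E T : 0 < T -> T^-1 * (\int[mu]_(t in `[0, T]) pairing Q t) =
    c - T^-1 * (pairing Pi T - pairing Pi 0).
  move=> T0; rewrite (EG T (ltW T0)) RintegralD //; last exact/ray_continuous_int/ray_continuous_cst.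
    rewrite Rintegral_itv_cst ?(ltW T0) //.
    have -> : \int[mu]_(s in `[0, T]) (- pairing Q s) = - \int[mu]_(s in `[0, T]) pairing Q s.
      rewrite -mulN1r -RintegralZl //; last exact: ray_continuous_int.
      by apply: eq_Rintegral => s _; rewrite mulN1r.
    by field; rewrite gt_eqF.
  by apply: ray_continuous_int; exact: ray_continuousN.
apply/cvgrPdist_le => e e0; near=> T.
have T0 : 0 < T by near: T; apply: nbhs_pinfty_gt; rewrite num_real.
rewrite E // opprB addrCA subrr addr0 normrM normfV (gtr0_norm T0) ler_pdivrMl //.
apply: (le_trans (ler_normB _ _)).
apply: (@le_trans _ _ (B + B)); first by apply: lerD; apply: hB => //; exact: ltW.
rewrite -ler_pdivrMr //; near: T; apply: nbhs_pinfty_ge; rewrite num_real //.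
Unshelve. all: by end_near. Qed.

End Covariance.

(** * Time averages of quadratic functions of the state *)

Section MeanQuadratic.
Variable R : realType.
Notation mu := (@lebesgue_measure R).
Context {d : measure_display} {Omega : measurableType d} (P : probability Omega R).
Notation "'Ex' f" := (Rintegral P setT f) (at level 10, f at level 9).
Notation L2_process := (L2_process P).
Notation cross_moment := (cross_moment P).

Lemma mean_quadratic (k : nat) (Q : 'M[R]_k) (Z : 'I_k -> R -> Omega -> R) (T : R) :
  (forall i, L2_process (Z i)) -> 0 <= T ->
  P.-integrable setT (EFin \o (fun om => \int[mu]_(t in `[0, T])
     (\sum_i \sum_j Q i j * (Z i t om * Z j t om)))) /\
  Ex (fun om => \int[mu]_(t in `[0, T]) (\sum_i \sum_j Q i j * (Z i t om * Z j t om))) =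
  \int[mu]_(t in `[0, T]) pairing (fun i j => cross_moment (Z i) (Z j)) Q t.
Proof.
move=> pZ T0; pose Y i t om := \sum_j Q i j * Z j t om.
have pY i : L2_process (Y i) by apply: process_sum => j; exact: processZ.
have e om : \int[mu]_(t in `[0, T]) (\sum_i \sum_j Q i j * (Z i t om * Z j t om)) =
   \sum_i \int[mu]_(t in `[0, T]) (Z i t om * Y i t om).
  rewrite -(@Rintegral_sum _ _ _ mu `[0, T] _ _ (fun i t => Z i t om * Y i t om) _ _).2 //.
    apply: eq_Rintegral => t _; apply: eq_bigr => i _; rewrite mulr_sumr.
    by apply: eq_bigr => j _; rewrite mulrCA.
  by move=> i; apply: ray_continuous_int; apply: ray_continuousM; [exact: ray_continuous_process (pZ i)|exact: ray_continuous_process (pY i)].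
have [h1 h2] := @Rintegral_sum _ _ _ P setT _ (index_enum 'I_k)
  (fun i om => \int[mu]_(t in `[0, T]) (Z i t om * Y i t om)) measurableT
  (fun i => int_process_integrable T (pZ i) (pY i)).
under [X in P.-integrable _ (EFin \o X)]eq_fun do rewrite e.
split=> //.
transitivity (Ex (fun om => \sum_i \int[mu]_(t in `[0, T]) (Z i t om * Y i t om))).
  by apply: eq_Rintegral => om _; rewrite e.
rewrite h2; under eq_bigr do rewrite process_Fubini //.
rewrite -(@Rintegral_sum _ _ _ mu `[0, T] _ _ (fun i t => Ex (fun om => Z i t om * Y i t om)) _ _).2 //.
  apply: eq_Rintegral => t; rewrite inE /= in_itv /= => /andP[t0 _].
  apply: eq_bigr => i _; rewrite -/(cross_moment _ _ t) cross_momentC /Y cross_moment_sum //; last by move=> j; exact: processZ.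
  by apply: eq_bigr => j _; rewrite cross_momentZ // cross_momentC.
by move=> i; exact: process_int_moment.
Qed.

Lemma pairing_moments_ge0 (k : nat) (Q : 'M[R]_k) (Z : 'I_k -> R -> Omega -> R) t :
  (forall i, L2_process (Z i)) -> 0 <= t -> psd_mx Q ->
  0 <= pairing (fun i j => cross_moment (Z i) (Z j)) Q t.
Proof.
move=> pZ t0 hQ; pose Y i t om := \sum_j Q i j * Z j t om.
have pY i : L2_process (Y i) by apply: process_sum => j; exact: processZ.
rewrite (_ : pairing _ _ _ = Ex (fun om => \sum_i Z i t om * Y i t om)).
  apply: Rintegral_ge0 => om _; have := hQ (\col_i Z i t om); rewrite quadE.
  under eq_bigr do under eq_bigr do rewrite !mxE.
  rewrite (_ : \sum_i \sum_j _ = \sum_i Z i t om * Y i t om) //.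
  by apply: eq_bigr => i _; rewrite mulr_sumr; apply: eq_bigr => j _; rewrite mulrCA.
have [_ ->] := @Rintegral_sum _ _ _ P setT _ (index_enum 'I_k)
  (fun i om => Z i t om * Y i t om) measurableT (fun i => process_integrable (pZ i) (pY i) t0).
apply: eq_bigr => i _; rewrite -/(cross_moment _ _ t) cross_momentC /Y cross_moment_sum //; last by move=> j; exact: processZ.
by apply: eq_bigr => j _; rewrite cross_momentZ // cross_momentC.
Qed.

Theorem stationary_mean (k : nat) (M S Q Pi : 'M[R]_k) (z0 : 'I_k -> R)
    (n Z : 'I_k -> R -> Omega -> R) :
  hurwitz M -> M^T *m Pi + Pi *m M = - Q ->
  (forall i, L2_process (n i)) -> (forall i t, 0 <= t -> Ex (n i t) = 0) ->
  (forall i j s t, 0 <= s -> 0 <= t ->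
    Ex (fun om => n i s om * n j t om) = S i j * Num.min s t) ->
  (forall i, jointly_measurable (Z i)) -> (forall i om, continuous (fun t => Z i t om)) ->
  (forall i om t, 0 <= t -> Z i t om =
     z0 i + \int[mu]_(s in `[0, t]) (\sum_m M i m * Z m s om) + n i t om) ->
  ('E_P[fun om => (T^-1 * \int[mu]_(t in `[0, T])
     (\sum_i \sum_j Q i j * (Z i t om * Z j t om)))%R])%E @[T --> +oo]
  --> (\sum_i \sum_j Pi i j * S i j)%:E.
Proof.
move=> hM lyap pn n_mean n_cov mZ cZ eZ.
have pZ i := solution_process pn mZ cZ eZ i.
have sm := second_moment pn n_mean n_cov mZ cZ eZ.
have := @time_average _ _ M S _ hM sm (fun Q t t0 hQ => pairing_moments_ge0 pZ t0 hQ) Q Pi lyap.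
move=> lim.
have E T : 0 < T -> ('E_P[fun om => (T^-1 * \int[mu]_(t in `[0, T])
     (\sum_i \sum_j Q i j * (Z i t om * Z j t om)))%R])%E =
   (T^-1 * (\int[mu]_(t in `[0, T]) pairing (fun i j => cross_moment (Z i) (Z j)) Q t))%:E.
  move=> T0; have [i1 <-] := mean_quadratic Q pZ (ltW T0).
  rewrite -RintegralZl // unlock /Rintegral fineK //.
  exact: integrable_fin_num (integrableZl measurableT T^-1 i1).
have near_E := nbhs_pinfty_gt (num_real (0 : R)).
apply: cvg_EFin.
  by apply: filterS near_E => T T0; rewrite E.
apply: cvg_trans lim; apply: near_eq_cvg.
by apply: filterS near_E => T T0; rewrite /= E.
Qed.

End MeanQuadratic.

Section Clip.
Variable R : realType.
Context {d : measure_display} {Omega : measurableType d}.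

(** A process on the half-line is extended to negative times by its initial value,
    which keeps measurability and continuity. *)
Definition clip k (X : R -> Omega -> 'cV[R]_k) (i : 'I_k) (t : R) (om : Omega) :=
  X (Num.max 0 t) om i 0.

Lemma clipE k (X : R -> Omega -> 'cV[R]_k) i t om : 0 <= t -> clip X i t om = X t om i 0.
Proof. by move=> t0; rewrite /clip max_r. Qed.

Lemma clip_jointly_measurable k (X : R -> Omega -> 'cV[R]_k) i : measurable_process X -> jointly_measurable (clip X i).
Proof.
move=> /(_ i) mX.
pose c (z : measurableTypeR R * Omega) := ((Num.max 0 z.1 : measurableTypeR R), z.2).
have mc : measurable_fun setT c.
  apply: measurable_fun_pair; last exact: measurable_snd.
  by apply: measurable_maxr; [exact: measurable_cst|exact: measurable_fst].
apply: (measurable_comp _ _ mX mc).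
  apply: measurableX => //.
  rewrite (_ : [set t | 0 <= t] = `[0, +oo[%classic); first exact: measurable_itv.
  by apply/seteqP; split=> t /=; rewrite in_itv /= andbT.
by move=> _ [z _ <-]; split => //=; rewrite le_max lexx.
Qed.

Lemma clip_continuous k (X : R -> Omega -> 'cV[R]_k) i om : continuous_paths X ->
  continuous (fun t => clip X i t om).
Proof.
move=> /(_ om i)/subspace_continuousP cX x.
have A : [set` `[(0 : R), +oo[] (Num.max 0 x) by rewrite /= in_itv /= andbT le_max lexx.
have cm : Num.max 0 t @[t --> x] --> Num.max 0 x.
  by apply: continuous_max; [exact: cvg_cst|exact: cvg_id].
move=> U HU; have H := cm _ (cX _ A U HU).
apply: (@filterS _ (nbhs x) _ _ _ _ H) => t /= h; apply: h.
by rewrite in_itv /= andbT le_max lexx.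
Qed.

End Clip.

(** * The cost as a squared H2 norm *)

Section WhiteNoise.
Variable R : realType.
Context {d : measure_display} {Omega : measurableType d} (P : probability Omega R).
Notation "'Ex' f" := (Rintegral P setT f) (at level 10, f at level 9).
Notation L2_process := (L2_process P).
Notation cross_moment := (cross_moment P).
Variables (k l : nat) (W : R -> Omega -> 'cV[R]_l) (L : 'M[R]_(k, l)).
Hypothesis wn : white_noise P W.

Lemma noise_cov i j s t : 0 <= s -> 0 <= t ->
  (\int[P]_om (clip W i s om * clip W j t om)%:E)%E = ((i == j)%:R * Num.min s t)%:E.
Proof.
move=> s0 t0; have := wn_cov wn i j s0 t0; rewrite unlock => <-.
by apply: eq_integral => om _; rewrite !clipE.
Qed.

Lemma noise_process i : L2_process (clip W i).
Proof.
have mW := clip_jointly_measurable i (wn_measurable wn).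
split=> //; first by move=> om; exact: clip_continuous (wn_continuous wn).
move=> T; exists T => t /andP[t0 tT]; split; first exact: jointly_measurable_section.
under eq_integral do rewrite expr2.
by rewrite noise_cov // eqxx mul1r minxx lee_fin.
Qed.

Definition input_noise i t om := \sum_j L i j * clip W j t om.

Lemma input_noiseE i t om : 0 <= t -> input_noise i t om = (L *m W t om) i 0.
Proof. by move=> t0; rewrite mxE; apply: eq_bigr => j _; rewrite clipE. Qed.

Lemma input_noise_process i : L2_process (input_noise i).
Proof. by apply: process_sum => j; apply: processZ; exact: noise_process. Qed.

Lemma input_noise_mean i t : 0 <= t -> Ex (input_noise i t) = 0.
Proof.
move=> t0; have p1 := process_cst P 1.
transitivity (cross_moment (input_noise i) (fun _ _ => 1) t).
  by apply: eq_Rintegral => om _; rewrite mulr1.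
rewrite cross_moment_sum //; last by move=> j; apply: processZ; exact: noise_process.
apply: big1 => j _; rewrite cross_momentZ //; last exact: noise_process.
rewrite [cross_moment _ _ _](_ : _ = 0) ?mulr0 //.
have := wn_mean wn j t0; rewrite unlock /cross_moment /Rintegral => h.
rewrite (_ : integral _ _ _ = 0%E) // -h; apply: eq_integral => om _.
by rewrite clipE // mulr1.
Qed.

Lemma input_noise_cov i j s t : 0 <= s -> 0 <= t ->
  Ex (fun om => input_noise i s om * input_noise j t om) = (L *m L^T) i j * Num.min s t.
Proof.
move=> s0 t0; have pt : L2_process (fun _ => input_noise j t) by exact: process_frozen (input_noise_process j) t0.
have pN a := noise_process a; have pNt a := process_frozen (pN a) t0.
transitivity (cross_moment (input_noise i) (fun _ => input_noise j t) s) => //.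
rewrite cross_moment_sum //; last by move=> a; exact: processZ.
rewrite mxE mulr_suml; apply: eq_bigr => a _; rewrite cross_momentZ // cross_momentC.
rewrite (@cross_moment_sum _ _ _ P _ _ (fun b _ om => L j b * clip W b t om)) //; last first.
  by move=> b; exact: (processZ (L j b) (pNt b)).
rewrite -mulrA; congr (_ * _).
rewrite (bigD1 a) //= big1 => [|b ba].
  rewrite addr0 (cross_momentZ (L j a) (pNt a) (pN a) s0) mxE; congr (_ * _).
  by rewrite cross_momentC /cross_moment /Rintegral noise_cov // eqxx mul1r.
rewrite (cross_momentZ (L j b) (pNt b) (pN a) s0) cross_momentC.
by rewrite /cross_moment /Rintegral noise_cov // eq_sym (negbTE ba) mul0r mulr0.
Qed.

End WhiteNoise.

Section LQGCost.
Variable R : realType.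
Variables (n m p q : nat) (A : 'M[R]_n) (B : 'M[R]_(n, m)) (Cc : 'M[R]_(p, n)).
Variables (AK : 'M[R]_q) (BK : 'M[R]_(q, p)) (CK : 'M[R]_(m, q)).
Local Notation M := (closed_loop_mx A B Cc AK BK CK).
Hypothesis hM : hurwitz M.

Let L : 'M[R]_(n + q, m + p) := row_mx (inG q B) (inK n BK).

Lemma quad_trace k l (Pi : 'M[R]_k) (N : 'M[R]_(k, l)) :
  \sum_i \sum_j Pi i j * (N *m N^T) i j = \tr (N^T *m Pi *m N).
Proof.
rewrite -mulmxA mxtrace_mulC -mulmxA /mxtrace; apply: eq_bigr => i _.
rewrite mxE; apply: eq_bigr => j _; congr (_ * _).
by rewrite -[in LHS](trmxK (N *m N^T)) mxE trmx_mul trmxK.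
Qed.

(** The cost matrix is the sum of the Gram matrices of the outputs C x and u, and
    the noise covariance is the sum of those of the inputs w and v; the four
    combinations give the four squared H2 norms. *)
Lemma lqg_cost_h2 : is_lqg_cost A B Cc AK BK CK
  (h2 (loopX A B Cc AK BK CK) ^+ 2 + h2 (loopXK A B Cc AK BK CK) ^+ 2
   + h2 (loopKX A B Cc AK BK CK) ^+ 2 + h2 (loopKY A B Cc AK BK CK) ^+ 2).
Proof.
move=> d Omega P W V wn x0 xi0 x xi cl.
have [PG EG] := lyapunov_exists hM ((outG q Cc)^T *m outG q Cc).
have [PK EK] := lyapunov_exists hM ((outK n CK)^T *m outK n CK).
pose Q := (outG q Cc)^T *m outG q Cc + (outK n CK)^T *m outK n CK.
have lyap : M^T *m (PG + PK) + (PG + PK) *m M = - Q.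
  by rewrite mulmxDr mulmxDl addrACA EG EK -opprD.
pose z t om := col_mx (x t om) (xi t om).
pose z0 := col_mx x0 xi0.
have zE om t : 0 <= t -> z t om = z0 + integral_cV (fun s => M *m z s om) t
     + L *m col_mx (W t om) (V t om).
  move=> t0; rewrite /z (cl_x_eq cl om t0) (cl_xi_eq cl om t0).
  rewrite /L mul_row_col /inG /inK !mul_col_mx !mul0mx !add_col_mx addr0 add0r.
  rewrite -!addrA -add_col_mx -add_col_mx; congr (_ + (_ + _)); rewrite ?add_col_mx ?addr0 ?add0r //.
  apply/matrixP => i j; rewrite !ord1 mxE.
  have e s : M *m col_mx (x s om) (xi s om) =
     col_mx (A *m x s om + B *m (CK *m xi s om)) (AK *m xi s om + BK *m (Cc *m x s om)).
    by rewrite /closed_loop_mx mul_block_col !mulmxA [BK *m _ *m _ + _]addrC.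
  case: splitP => i' ei; rewrite !mxE; apply: eq_Rintegral => s _; rewrite e.
    by rewrite (_ : i = lshift q i') ?col_mxEu //; exact: val_inj.
  by rewrite (_ : i = rshift n i') ?col_mxEd //; exact: val_inj.
have mz : measurable_process z.
  move=> i; case: (splitP i) => i' ei.
    have := cl_x_measurable cl i'; rewrite (_ : i = lshift q i'); last exact: val_inj.
    rewrite (_ : (fun w : measurableTypeR R * Omega => x w.1 w.2 i' 0) =
      (fun w : measurableTypeR R * Omega => z w.1 w.2 (lshift q i') 0)) //.
    by apply/funext => w; rewrite /z col_mxEu.
  have := cl_xi_measurable cl i'; rewrite (_ : i = rshift n i'); last exact: val_inj.
  rewrite (_ : (fun w : measurableTypeR R * Omega => xi w.1 w.2 i' 0) =
    (fun w : measurableTypeR R * Omega => z w.1 w.2 (rshift n i') 0)) //.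
  by apply/funext => w; rewrite /z col_mxEd.
have cx : continuous_paths x := cl_x_continuous cl.
have cxi : continuous_paths xi := cl_xi_continuous cl.
have cz : continuous_paths z.
  move=> om i; case: (splitP i) => i' ei.
    have := cx om i'; rewrite (_ : i = lshift q i'); last exact: val_inj.
    rewrite (_ : (fun t => x t om i' 0) = (fun t => z t om (lshift q i') 0)) //.
    by apply/funext => t; rewrite /z col_mxEu.
  have := cxi om i'; rewrite (_ : i = rshift n i'); last exact: val_inj.
  rewrite (_ : (fun t => xi t om i' 0) = (fun t => z t om (rshift n i') 0)) //.
  by apply/funext => t; rewrite /z col_mxEd.
have lim := @stationary_mean _ _ _ P _ M (L *m L^T) Q (PG + PK) (fun i => z0 i 0)
  (input_noise (fun t om => col_mx (W t om) (V t om)) L) (clip z) hM lyap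
  (input_noise_process L wn) (input_noise_mean L wn) (input_noise_cov L wn)
  (fun i => clip_jointly_measurable i mz) (fun i om => clip_continuous cz).
have {}lim := lim _.
have J : \sum_i \sum_j (PG + PK) i j * (L *m L^T) i j =
   h2 (loopX A B Cc AK BK CK) ^+ 2 + h2 (loopXK A B Cc AK BK CK) ^+ 2
   + h2 (loopKX A B Cc AK BK CK) ^+ 2 + h2 (loopKY A B Cc AK BK CK) ^+ 2.
  rewrite (h2_transfer (inG q B) hM EG : h2 (loopX _ _ _ _ _ _) ^+ 2 = _).
  rewrite (h2_transfer (inK n BK) hM EG : h2 (loopXK _ _ _ _ _ _) ^+ 2 = _).
  rewrite (h2_transfer (inG q B) hM EK : h2 (loopKX _ _ _ _ _ _) ^+ 2 = _).
  rewrite (h2_transfer (inK n BK) hM EK : h2 (loopKY _ _ _ _ _ _) ^+ 2 = _).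
  rewrite -!quad_trace -!big_split; apply: eq_bigr => i _; rewrite -!big_split; apply: eq_bigr => j _.
  by rewrite /L tr_row_mx mul_row_col !mxE /=; ring.
rewrite -J; apply: cvg_trans (lim _); last first.
  move=> i om t t0; rewrite clipE // zE // mxE mxE input_noiseE //; congr (_ + _ + _).
  rewrite mxE; apply: eq_Rintegral => s; rewrite inE /= in_itv /= => /andP[s0 _].
  by rewrite mxE; apply: eq_bigr => j _; rewrite clipE.
apply: near_eq_cvg; have near_E := nbhs_pinfty_gt (num_real (0 : R)).
apply: filterS near_E => T T0; rewrite /mean_cost; congr expectation.
apply/funext => om; congr (_ * _); apply: eq_Rintegral => t; rewrite inE /= in_itv /= => /andP[t0 _].
transitivity (((z t om)^T *m Q *m z t om) 0 0).
  rewrite quadE; apply: eq_bigr => i _; apply: eq_bigr => j _; rewrite !clipE //.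
rewrite /Q mulmxDr mulmxDl mxE.
have e k (N : 'M[R]_(k, n + q)) v : v^T *m (N^T *m N) *m v = (N *m v)^T *m (N *m v).
  by rewrite trmx_mul !mulmxA.
rewrite !e /outG /outK /z !mul_row_col !mul0mx addr0 add0r.
by rewrite !trmx_mul !mulmxA.
Qed.

End LQGCost.

(** * The bound on the cost *)

(** The squares of the four bounds add up to the right-hand side. *)
Lemma cost_arith (R : realFieldType) (x xk kx ky d D hx hy hkx xr xkr kxr kyr : R) :
  0 <= xr -> 0 <= xkr -> 0 <= kyr -> 0 <= kxr ->
  xr <= (1 - hx * D)^-1 * x ->
  xkr <= (1 - hx * D)^-1 * (xk + D * x) ->
  kyr <= (1 - hx * D)^-1 * (ky + (1 + hkx) * hy * d) ->
  kxr <= (1 - hx * D)^-1 * (kx + (1 + hkx) * hx * d) ->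
  xr ^+ 2 + xkr ^+ 2 + kxr ^+ 2 + kyr ^+ 2 <=
  1 / (1 - hx * D) ^+ 2 *
    (x ^+ 2 + xk ^+ 2 + kx ^+ 2 + ky ^+ 2
     + (2 * D * x * xk + 2 * d * (ky * hy + kx * hx) * (1 + hkx))
     + (D ^+ 2 * x ^+ 2 + d ^+ 2 * (hy ^+ 2 + hx ^+ 2) * (1 + hkx) ^+ 2)).
Proof.
have sq (a b : R) : 0 <= a -> a <= b -> a ^+ 2 <= b ^+ 2.
  by move=> a0 ab; rewrite ler_sqr ?nnegrE // (le_trans a0 ab).
move=> h1 h2 h3 h4 /(sq _ _ h1) b1 /(sq _ _ h2) b2 /(sq _ _ h3) b3 /(sq _ _ h4) b4.
apply: (le_trans (lerD (lerD (lerD b1 b2) b4) b3)).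
rewrite !exprMn exprVn div1r -!mulrDr ler_wpM2l ?invr_ge0 ?sqr_ge0 //.
rewrite le_eqVlt; apply/orP; left; apply/eqP; ring.
Qed.

Section CostBound.
Variable R : realType.
Variables (n m p q qr : nat).
Variables (A : 'M[R]_n) (B : 'M[R]_(n, m)) (Cc : 'M[R]_(p, n)).
Variables (AK : 'M[R]_q) (BK : 'M[R]_(q, p)) (CK : 'M[R]_(m, q)).
Variables (AKr : 'M[R]_qr) (BKr : 'M[R]_(qr, p)) (CKr : 'M[R]_(m, qr)).
Notation Delta := (transfer AKr BKr CKr - transfer AK BK CK).
Notation X := (loopX A B Cc AK BK CK).
Notation XK := (loopXK A B Cc AK BK CK).
Notation KX := (loopKX A B Cc AK BK CK).
Notation KY := (loopKY A B Cc AK BK CK).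
Notation Xr := (loopX A B Cc AKr BKr CKr).
Notation XKr := (loopXK A B Cc AKr BKr CKr).
Notation KXr := (loopKX A B Cc AKr BKr CKr).
Notation KYr := (loopKY A B Cc AKr BKr CKr).
Hypothesis hM : hurwitz (closed_loop_mx A B Cc AK BK CK).
Hypothesis hMr : hurwitz (closed_loop_mx A B Cc AKr BKr CKr).
Hypothesis hDelta : (hinf_norm Delta < (hinf_norm X)^-1)%E.
Notation kappa := (1 - hinf X * hinf Delta)^-1.

Lemma kappa_ge0 : 0 <= kappa.
Proof. by rewrite invr_ge0 subr_ge0 ltW // gain_lt1. Qed.

Let sp (n' m' p' : nat) (M' : 'M[R]_n') (B' : 'M[R]_(n', m')) (C' : 'M[R]_(p', n')) :
  msproper (transfer M' B' C').
Proof. exact: msproper_transfer. Qed.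
Let st (m' p' : nat) (B' : 'M[R]_(n + q, m')) (C' : 'M[R]_(p', n + q)) :
  mstable (transfer (closed_loop_mx A B Cc AK BK CK) B' C').
Proof. exact: mstable_transfer. Qed.
Let str (m' p' : nat) (B' : 'M[R]_(n + qr, m')) (C' : 'M[R]_(p', n + qr)) :
  mstable (transfer (closed_loop_mx A B Cc AKr BKr CKr) B' C').
Proof. exact: mstable_transfer. Qed.
Let spD : msproper Delta := msproper_Delta AK BK CK AKr BKr CKr.
Let stD : mstable Delta := mstable_Delta hM hDelta.

Lemma h2_Xr : h2 Xr <= kappa * h2 X.
Proof.
rewrite [h2 X](_ : _ = h2 X + 0 * h2 X); last by rewrite mul0r addr0.
apply: (h2_triangle (sp _ _ _) (@str _ _ _ _) (sp _ _ _) (@st _ _ _ _) (sp _ _ _) (@st _ _ _ _)) => //; first exact: kappa_ge0.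
by move=> w; rewrite mul0r addr0 !freq_respE; exact: frob_Xr.
Qed.

Lemma h2_XKr : h2 XKr <= kappa * (h2 XK + hinf Delta * h2 X).
Proof.
apply: (h2_triangle (sp _ _ _) (@str _ _ _ _) (sp _ _ _) (@st _ _ _ _) (sp _ _ _) (@st _ _ _ _)) => //; [exact: kappa_ge0|exact: hinf_ge0|].
by move=> w; rewrite !freq_respE; exact: frob_XKr.
Qed.

Lemma h2_KYr : h2 KYr <= kappa * (h2 KY + (1 + hinf KX) * hinf (1%:M + XK) * h2 Delta).
Proof.
apply: (h2_triangle (sp _ _ _) (@str _ _ _ _) (sp _ _ _) (@st _ _ _ _) spD stD) => //; first exact: kappa_ge0.
  by rewrite mulr_ge0 ?addr_ge0 ?hinf_ge0.
by move=> w; rewrite !freq_respE; exact: frob_KYr.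
Qed.

Lemma h2_KXr : h2 KXr <= kappa * (h2 KX + (1 + hinf KX) * hinf X * h2 Delta).
Proof.
apply: (h2_triangle (sp _ _ _) (@str _ _ _ _) (sp _ _ _) (@st _ _ _ _) spD stD) => //; first exact: kappa_ge0.
  by rewrite mulr_ge0 ?addr_ge0 ?hinf_ge0.
by move=> w; rewrite !freq_respE; exact: frob_KXr.
Qed.

End CostBound.

Theorem theorem2 (R : realType) (n m p q qr : nat)
  (A : 'M[R]_n) (B : 'M[R]_(n, m)) (C : 'M[R]_(p, n))
  (AK : 'M[R]_q) (BK : 'M[R]_(q, p)) (CK : 'M[R]_(m, q))
  (AKr : 'M[R]_qr) (BKr : 'M[R]_(qr, p)) (CKr : 'M[R]_(m, qr)) :
  minimal A B C -> minimal AK BK CK -> minimal AKr BKr CKr ->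
  internally_stabilizes A B C AK BK CK ->
  let G := transfer A B C in
  let K := transfer AK BK CK in
  let Kr := transfer AKr BKr CKr in
  let Delta := Kr - K in
  let Y := invmx (1%:M - G *m K) in
  let X := Y *m G in
  (hinf_norm Delta < (hinf_norm X)^-1)%E ->
  let S1 := 2 * hinf Delta * h2 X * h2 (X *m K)
            + 2 * h2 Delta
              * (h2 (K *m Y) * hinf Y + h2 (K *m X) * hinf X)
              * (1 + hinf (K *m X)) in
  let S2 := hinf Delta ^+ 2 * h2 X ^+ 2
            + h2 Delta ^+ 2 * (hinf Y ^+ 2 + hinf X ^+ 2)
              * (1 + hinf (K *m X)) ^+ 2 in
  internally_stabilizes A B C AKr BKr CKr /\
  exists J Jr : R,
    [/\ is_lqg_cost A B C AK BK CK J,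
        is_lqg_cost A B C AKr BKr CKr Jr &
        Jr <= 1 / (1 - hinf X * hinf Delta) ^+ 2 * (J + S1 + S2)].

Proof.
move=> mG mK mKr hM G K Kr Delta Y X hDelta S1 S2.
have EX : X = loopX A B C AK BK CK by exact: sensitivityG.
have EY : Y = 1%:M + loopXK A B C AK BK CK by exact: sensitivityE.
have EXK : X *m K = loopXK A B C AK BK CK by exact: sensitivityGK.
have EKX : K *m X = loopKX A B C AK BK CK by rewrite EX; case: (loopX_eq A B C AK BK CK) => _ <-.
have EKY : K *m Y = loopKY A B C AK BK CK.
  by rewrite EY mulmxDr mulmx1; case: (loopKY_eq A B C AK BK CK) => _ <-.
have {}hDelta : (hinf_norm Delta < (hinf_norm (loopX A B C AK BK CK))^-1)%E by rewrite -EX.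
have hMr : hurwitz (closed_loop_mx A B C AKr BKr CKr) by exact: (robust_stability hM hDelta mG mKr).
split; first exact: hMr.
exists (h2 (loopX A B C AK BK CK) ^+ 2 + h2 (loopXK A B C AK BK CK) ^+ 2
   + h2 (loopKX A B C AK BK CK) ^+ 2 + h2 (loopKY A B C AK BK CK) ^+ 2).
exists (h2 (loopX A B C AKr BKr CKr) ^+ 2 + h2 (loopXK A B C AKr BKr CKr) ^+ 2
   + h2 (loopKX A B C AKr BKr CKr) ^+ 2 + h2 (loopKY A B C AKr BKr CKr) ^+ 2).
split; [exact: lqg_cost_h2|exact: lqg_cost_h2|].
have b1 := h2_Xr hM hMr hDelta; have b2 := h2_XKr hM hMr hDelta.
have b3 := h2_KYr hM hMr hDelta; have b4 := h2_KXr hM hMr hDelta.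
rewrite /S1 /S2 EKX EKY EXK EX EY.
exact: (cost_arith (h2_ge0 _) (h2_ge0 _) (h2_ge0 _) (h2_ge0 _) b1 b2 b3 b4).
Qed.
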